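(* A reduced plane curve $X=V(f)\subset\mathbb{P}^2$ is Torelli in the sense of Dolgachev-Kapranov if and only if it can be reconstructed from the local cohomology module $H^0_{\mathbf{m}}(R(f))$ of its jacobian ring.
   Context: Let $P=\mathbb{C}[X_0,X_1,X_2]$, $\mathbf{m}=(X_0,X_1,X_2)$. For a reduced homogeneous polynomial $f\in P$ of degree $d$, $R(f)=P/J(f)$ is the jacobian ring, $J(f)=\left(\frac{\partial f}{\partial X_0},\frac{\partial f}{\partial X_1},\frac{\partial f}{\partial X_2}\right)$, and $H^0_{\mathbf{m}}(R(f))=J(f)^{sat}/J(f)$ is the $0$-th local cohomology module of $R(f)$ with respect to $\mathbf{m}$, a graded $P$-module ($J(f)^{sat}$ is the saturation). The sheaf of logarithmic vector fields along $X=V(f)$ is $T\langle X\rangle=\ker(\eta)$, where $\eta:T_{\mathbb{P}^2}\to\mathcal{J}_{f/X}(d)$ is given by $\eta\left(\sum_iA_i\frac{\partial}{\partial X_i}\right)=\sum_iA_i\frac{\partial f}{\partial X_i}$, and $\mathcal{J}_{f/X}\subset\mathcal{O}_X$ is the image in $\mathcal{O}_X$ of the ideal sheaf $J(f)^\sim$. $X$ is Torelli in the sense of Dolgachev-Kapranov if it can be reconstructed from the sheaf $T\langle X\rangle$, i.e. if $X'\subset\mathbb{P}^2$ is a reduced plane curve with $T\langle X'\rangle\cong T\langle X\rangle$ then $X'=X$. Likewise, $X=V(f)$ can be reconstructed from $H^0_{\mathbf{m}}(R(f))$ if, whenever $X'=V(f')\subset\mathbb{P}^2$ is a reduced plane curve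 with $H^0_{\mathbf{m}}(R(f'))\cong H^0_{\mathbf{m}}(R(f))$ as graded $P$-modules, one has $X'=X$. *)

(* Defs.v *)
From HB Require Import structures.
From mathcomp Require Import all_boot all_order all_algebra.
From mathcomp Require Import generic_quotient ring_quotient.
From mathcomp Require Import boolp reals complex.
From mathcomp Require Import mpoly ring.

Set Implicit Arguments.
Unset Strict Implicit.
Unset Printing Implicit Defensive.

Import GRing.Theory.
Local Open Scope ring_scope.
Local Open Scope quotient_scope.

(* P is the coordinate ring of the projective plane over K. *)
Notation coord K := {mpoly K[3]} (only parsing).

Section GradedModules.
Variable K : fieldType.
Local Notation P := (coord K).

(* Graded modules over P, graded in degrees >= 0. *)
Record gmod := GMod {
  gm_sort :> lmodType P;
  ofdeg : nat -> gm_sort -> Prop;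
  ofdeg0 : forall k, ofdeg k 0;
  ofdegB : forall k x y, ofdeg k x -> ofdeg k y -> ofdeg k (x - y);
  ofdegZ : forall e h k x, h \is e.-homog -> ofdeg k x -> ofdeg (e + k) (h *: x);
  ofdeg_dec : forall x, exists n (c : nat -> gm_sort),
    (forall k, ofdeg k (c k)) /\ x = \sum_(k < n) c k;
  ofdeg_indep : forall n (c : nat -> gm_sort), (forall k, ofdeg k (c k)) ->
    \sum_(k < n) c k = 0 -> forall k, (k < n)%N -> c k = 0 }.

Definition gmod_iso (M N : gmod) : Prop :=
  exists phi : {linear M -> N},
    bijective phi /\ forall k x, ofdeg k x -> ofdeg k (phi x).

Record gsubmod (M : gmod) := GSubmod {
  gs_pred :> {pred M};
  gs_closed : submod_closed gs_pred;
  gs_graded : forall n (c : nat -> M), (forall k, ofdeg k (c k)) ->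
    \sum_(k < n) c k \in gs_pred -> forall k, (k < n)%N -> c k \in gs_pred }.

HB.instance Definition _ M (D : gsubmod M) :=
  GRing.isSubmodClosed.Build P M (gs_pred D) (gs_closed D).

Section QuotientModule.
Variables (M : gmod) (D : gsubmod M).

Definition quot_type : Type := Quotient.quot (gs_pred D).
HB.instance Definition _ := GRing.Zmodule.on quot_type.

Definition qproj (x : M) : quot_type := \pi_(Quotient.quot (gs_pred D)) x.

Lemma proj_eq x y : qproj x = qproj y <-> x - y \in gs_pred D.
Proof. by rewrite Quotient.idealrBE; split => [/eqP|/eqP]. Qed.

Lemma proj_onto (x : quot_type) : exists y, x = qproj y.
Proof. by exists (repr x); rewrite /qproj reprK. Qed.

Lemma projB x y : qproj (x - y) = qproj x - qproj y.
Proof. exact: (raddfB (\pi_(Quotient.quot (gs_pred D)))). Qed.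

Lemma projD x y : qproj (x + y) = qproj x + qproj y.
Proof. exact: (raddfD (\pi_(Quotient.quot (gs_pred D)))). Qed.

Definition qscale (a : P) (x : quot_type) : quot_type := qproj (a *: repr x).

Lemma qscaleE a x : qscale a (qproj x) = qproj (a *: x).
Proof.
apply/proj_eq; rewrite -scalerBr; apply: rpredZ; apply/proj_eq.
by rewrite /qproj reprK.
Qed.

Fact qscaleA a b x : qscale a (qscale b x) = qscale (a * b) x.
Proof. by have [y ->] := proj_onto x; rewrite !qscaleE scalerA. Qed.
Fact qscale1 : left_id 1 qscale.
Proof. by move=> x; have [y ->] := proj_onto x; rewrite !qscaleE scale1r. Qed.
Fact qscaleDr : right_distributive qscale +%R.
Proof.
move=> a x y; have [x' ->] := proj_onto x; have [y' ->] := proj_onto y.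
by rewrite !qscaleE -!projD qscaleE scalerDr.
Qed.
Fact qscaleDl v : {morph qscale^~ v : a b / a + b}.
Proof.
by move=> a b; have [x ->] := proj_onto v; rewrite !qscaleE -projD scalerDl.
Qed.
HB.instance Definition _ :=
  GRing.Zmodule_isLmodule.Build P quot_type qscaleA qscale1 qscaleDr qscaleDl.

Lemma projZ a x : qproj (a *: x) = a *: qproj x.
Proof. by rewrite -qscaleE. Qed.

Fact proj_linear : linear qproj.
Proof. by move=> a x y; rewrite projD projZ. Qed.
HB.instance Definition _ := GRing.isLinear.Build P M quot_type _ qproj proj_linear.

Lemma proj_eq0 x : qproj x = 0 <-> x \in gs_pred D.
Proof. by rewrite -[x in x \in _]subr0 -proj_eq raddf0. Qed.

Definition quot_ofdeg k (x : quot_type) : Prop := exists2 y, ofdeg k y & x = qproj y.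

Fact quot_ofdeg0 k : quot_ofdeg k 0.
Proof. by exists 0; [exact: ofdeg0 | rewrite raddf0]. Qed.
Fact quot_ofdegB k x y :
  quot_ofdeg k x -> quot_ofdeg k y -> quot_ofdeg k (x - y).
Proof.
by move=> [x' ? ->] [y' ? ->]; exists (x' - y'); [exact: ofdegB | rewrite raddfB].
Qed.
Fact quot_ofdegZ e h k x :
  h \is e.-homog -> quot_ofdeg k x -> quot_ofdeg (e + k) (h *: x).
Proof.
by move=> ? [x' ? ->]; exists (h *: x'); [exact: ofdegZ | rewrite linearZ].
Qed.
Fact quot_ofdeg_dec x : exists n (c : nat -> quot_type),
  (forall k, quot_ofdeg k (c k)) /\ x = \sum_(k < n) c k.
Proof.
have [y ->] := proj_onto x; have [n [c [hc ->]]] := ofdeg_dec y.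
exists n, (qproj \o c); split; first by move=> k; exists (c k).
by rewrite raddf_sum.
Qed.
Fact quot_ofdeg_indep n (c : nat -> quot_type) : (forall k, quot_ofdeg k (c k)) ->
  \sum_(k < n) c k = 0 -> forall k, (k < n)%N -> c k = 0.
Proof.
move=> hc; have /choice [y hy] : forall k, exists y, ofdeg k y /\ c k = qproj y.
  by move=> k; have [y ? ?] := hc k; exists y.
under eq_bigr do rewrite (proj2 (hy _)).
rewrite -raddf_sum => /proj_eq0 hs k kn.
rewrite (proj2 (hy k)); apply/proj_eq0.
by apply: gs_graded hs _ kn => j; exact: (proj1 (hy j)).
Qed.

Definition gquot : gmod :=
  GMod quot_ofdeg0 quot_ofdegB quot_ofdegZ quot_ofdeg_dec quot_ofdeg_indep.

End QuotientModule.

Section Submodule.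
Variables (M : gmod) (D : gsubmod M).

Definition submod_type : Type := {x : M | x \in gs_pred D}.
HB.instance Definition _ := SubChoice.on submod_type.
HB.instance Definition _ := [SubChoice_isSubLmodule of submod_type by <:].

Definition sub_ofdeg k (x : submod_type) : Prop := ofdeg k (val x).

Fact sub_ofdeg0 k : sub_ofdeg k 0.
Proof. by rewrite /sub_ofdeg raddf0; exact: ofdeg0. Qed.
Fact sub_ofdegB k x y : sub_ofdeg k x -> sub_ofdeg k y -> sub_ofdeg k (x - y).
Proof. by rewrite /sub_ofdeg raddfB; exact: ofdegB. Qed.
Fact sub_ofdegZ e h k x :
  h \is e.-homog -> sub_ofdeg k x -> sub_ofdeg (e + k) (h *: x).
Proof. by rewrite /sub_ofdeg linearZ; exact: ofdegZ. Qed.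
Fact sub_ofdeg_dec x : exists n (c : nat -> submod_type),
  (forall k, sub_ofdeg k (c k)) /\ x = \sum_(k < n) c k.
Proof.
have [n [c [hc ex]]] := ofdeg_dec (val x).
have hcD k : (k < n)%N -> c k \in gs_pred D.
  by apply: gs_graded => //; rewrite -ex; exact: valP.
exists n, (fun k => insubd (0 : submod_type) (c k)); split.
  move=> k; rewrite /sub_ofdeg val_insubd; case: ifP => // _.
  by rewrite raddf0; exact: ofdeg0.
apply: val_inj; rewrite ex raddf_sum; apply: eq_bigr => k _.
by rewrite /= val_insubd hcD.
Qed.
Fact sub_ofdeg_indep n (c : nat -> submod_type) : (forall k, sub_ofdeg k (c k)) ->
  \sum_(k < n) c k = 0 -> forall k, (k < n)%N -> c k = 0.
Proof.
move=> hc /(congr1 val); rewrite raddf_sum raddf0 => hs k kn.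
apply: val_inj; rewrite raddf0.
exact: (@ofdeg_indep M n (val \o c) hc hs k kn).
Qed.

Definition gsub : gmod :=
  GMod sub_ofdeg0 sub_ofdegB sub_ofdegZ sub_ofdeg_dec sub_ofdeg_indep.

End Submodule.

End GradedModules.

Section Constructions.
Variable K : fieldType.
Local Notation P := (coord K).

Section Free.
Variable r : nat.

Definition free_ofdeg k (x : 'rV[P]_r) : Prop := forall i, x 0 i \is k.-homog.

Fact free_ofdeg0 k : free_ofdeg k 0.
Proof. by move=> i; rewrite mxE; exact: dhomog0. Qed.
Fact free_ofdegB k x y : free_ofdeg k x -> free_ofdeg k y -> free_ofdeg k (x - y).
Proof. by move=> hx hy i; rewrite !mxE; apply: rpredB. Qed.
Fact free_ofdegZ e h k x :
  h \is e.-homog -> free_ofdeg k x -> free_ofdeg (e + k) (h *: x).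
Proof. by move=> hh hx i; rewrite mxE; apply: dhomogM. Qed.
Fact free_ofdeg_dec x : exists n (c : nat -> 'rV[P]_r),
  (forall k, free_ofdeg k (c k)) /\ x = \sum_(k < n) c k.
Proof.
exists (\max_(i < r) mmeasure mdeg (x 0%R i)).
exists (fun k => \row_i pihomog mdeg k (x 0 i)).
split=> [k i|]; first by rewrite mxE; exact: pihomogP.
apply/rowP => i; rewrite summxE; under eq_bigr do rewrite mxE.
by apply: pihomog_partitionE; exact: (leq_bigmax i).
Qed.
Fact free_ofdeg_indep n (c : nat -> 'rV[P]_r) : (forall k, free_ofdeg k (c k)) ->
  \sum_(k < n) c k = 0 -> forall k, (k < n)%N -> c k = 0.
Proof.
move=> hc hs k kn; apply/rowP => i; rewrite mxE.
have /(congr1 (fun y : 'rV[P]_r => pihomog mdeg k (y 0 i))) := hs.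
rewrite summxE mxE raddf0 raddf_sum (bigD1 (Ordinal kn)) //= big1.
  by rewrite addr0 pihomog_dE //; exact: hc.
move=> j jk; apply: (@pihomog_ne0 _ _ _ (j : nat)); last exact: hc.
by apply: contraNneq jk => jk; apply/eqP/val_inj.
Qed.

Definition gfree : gmod K :=
  GMod free_ofdeg0 free_ofdegB free_ofdegZ free_ofdeg_dec free_ofdeg_indep.

End Free.

(* P as a graded module over itself. *)
Section Regular.

Definition reg_ofdeg k (x : P^o) : Prop := (x : P) \is k.-homog.

Fact reg_ofdeg0 k : reg_ofdeg k 0.
Proof. exact: dhomog0. Qed.
Fact reg_ofdegB k x y : reg_ofdeg k x -> reg_ofdeg k y -> reg_ofdeg k (x - y).
Proof. by move=> hx hy; apply: rpredB. Qed.
Fact reg_ofdegZ e h k x :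
  h \is e.-homog -> reg_ofdeg k x -> reg_ofdeg (e + k) (h *: x).
Proof. by move=> hh hx; apply: dhomogM. Qed.
Fact reg_ofdeg_dec x : exists n (c : nat -> P^o),
  (forall k, reg_ofdeg k (c k)) /\ x = \sum_(k < n) c k.
Proof.
exists (mmeasure mdeg (x : P)), (fun k => pihomog mdeg k (x : P)).
by split=> [k|]; [exact: pihomogP | exact: pihomog_partitionE].
Qed.
Fact reg_ofdeg_indep n (c : nat -> P^o) : (forall k, reg_ofdeg k (c k)) ->
  \sum_(k < n) c k = 0 -> forall k, (k < n)%N -> c k = 0.
Proof.
move=> hc hs k kn; have /(congr1 (pihomog (R := K) mdeg k)) := hs.
rewrite raddf0 raddf_sum (bigD1 (Ordinal kn)) //= big1.
  by rewrite addr0 pihomog_dE //; exact: hc.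
move=> j jk; apply: (@pihomog_ne0 _ _ _ (j : nat)); last exact: hc.
by apply: contraNneq jk => jk; apply/eqP/val_inj.
Qed.

Definition greg : gmod K :=
  GMod reg_ofdeg0 reg_ofdegB reg_ofdegZ reg_ofdeg_dec reg_ofdeg_indep.

End Regular.

(* The submodule generated by finitely many elements of one degree e. *)
Section Span.
Variables (M : gmod K) (r e : nat) (g : 'I_r -> M).
Hypothesis hg : forall i, ofdeg e (g i).

Definition in_span : {pred M} :=
  [pred x | `[< exists A : 'I_r -> P, x = \sum_i A i *: g i >]].

Fact span_closed : submod_closed in_span.
Proof.
split; first by apply/asboolP; exists (fun=> 0); rewrite big1 // => i; rewrite scale0r.
move=> a x y /asboolP[A ->] /asboolP[B ->]; apply/asboolP.
exists (fun i => a * A i + B i); rewrite scaler_sumr -big_split /=.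
by apply: eq_bigr => i _; rewrite scalerDl scalerA.
Qed.

Fact span_graded n (c : nat -> M) : (forall k, ofdeg k (c k)) ->
  \sum_(k < n) c k \in in_span -> forall k, (k < n)%N -> c k \in in_span.
Proof.
move=> hc /asboolP[A hA] k kn.
pose N := \max_i mmeasure mdeg (A i).
pose b j := \sum_i pihomog mdeg j (A i) *: g i.
have hb j : ofdeg (j + e) (b j).
  rewrite /b; elim/big_ind: _ => [|x y hx hy|i _]; first exact: ofdeg0.
    by rewrite -[y]opprK -[- y]add0r; apply/ofdegB/ofdegB => //; exact: ofdeg0.
  by apply: ofdegZ => //; exact: pihomogP.
have hAb : \sum_i A i *: g i = \sum_(j < N) b j.
  rewrite exchange_big /=; apply: eq_bigr => i _; rewrite -scaler_suml.
  by rewrite -pihomog_partitionE //; exact: (leq_bigmax i).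
pose B j := if (e <= j < N + e)%N then b (j - e)%N else 0.
pose C j := (if (j < n)%N then c j else 0) - B j.
have hB j : ofdeg j (B j).
  rewrite /B; case: ifP => [/andP[ej _]|_]; last exact: ofdeg0.
  by rewrite -{1}(subnK ej).
have hC j : ofdeg j (C j).
  by apply: ofdegB => //; case: ifP => _ //; exact: ofdeg0.
have [m nm em] : exists2 m, (n <= m)%N & (N + e <= m)%N.
  by exists (maxn n (N + e)); rewrite ?leq_maxl ?leq_maxr.
have hs : \sum_(j < m) C j = 0.
  rewrite /C sumrB; apply/eqP; rewrite subr_eq0; apply/eqP.
  rewrite -big_mkcond /= -(big_ord_widen m (fun j => c j)) // hA hAb.
  rewrite -(big_mkord xpredT b) -(big_mkord xpredT B) [RHS](big_cat_nat (n := e)) //=; last first.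
    exact: leq_trans (leq_addl N e) em.
  rewrite [X in _ = X + _]big_nat [X in _ = X + _]big1 ?add0r => [|j /andP[_ je]]; last by rewrite /B leqNgt je.
  rewrite [RHS](big_cat_nat (n := N + e)) ?leq_addl //=.
  rewrite [X in _ = _ + X]big_nat [X in _ = _ + X]big1 ?addr0 => [|j /andP[je _]]; last first.
    by rewrite /B [(j < _)%N]ltnNge je andbF.
  rewrite -[X in _ = \big[_/_]_(X <= _ < _) _]add0n big_addn addnK; apply: eq_big_nat => j /andP[_ jN].
  by rewrite /B leq_addl ltn_add2r jN addnK.
have km : (k < m)%N by apply: leq_trans kn nm.
move: (ofdeg_indep hC hs km); rewrite /C kn => /eqP; rewrite subr_eq0 => /eqP ->.
apply/asboolP; rewrite /B; case: ifP => _.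
  by exists (fun i => pihomog mdeg (k - e) (A i)).
by exists (fun=> 0); rewrite big1 // => i _; rewrite scale0r.
Qed.

Definition gspan : gsubmod M := GSubmod span_closed span_graded.

End Span.

(* The elements killed by a power of the irrelevant ideal m; the homogeneous
   elements of m^n are the forms of degree >= n. *)
Section LocalCohomology.
Variable M : gmod K.

Definition in_tors : {pred M} := [pred x | `[< exists n,
  forall e (h : P), (n <= e)%N -> h \is e.-homog -> h *: x = 0 >]].

Fact tors_closed : submod_closed in_tors.
Proof.
split; first by apply/asboolP; exists 0 => e h _ _; rewrite scaler0.
move=> a x y /asboolP[n hx] /asboolP[m hy]; apply/asboolP.
exists (maxn n m) => e h; rewrite geq_max => /andP[ne me] hh.
by rewrite scalerDr scalerA mulrC -scalerA (hx e) // (hy e) // scaler0 addr0.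
Qed.

Fact tors_graded n (c : nat -> M) : (forall k, ofdeg k (c k)) ->
  \sum_(k < n) c k \in in_tors -> forall k, (k < n)%N -> c k \in in_tors.
Proof.
move=> hc /asboolP[m hm] k kn; apply/asboolP; exists m => e h me hh.
have hs := hm e h me hh; rewrite scaler_sumr in hs.
pose C j := if (e <= j)%N then h *: c (j - e)%N else 0.
have hC j : ofdeg j (C j).
  rewrite /C; case: ifP => [ej|_]; last exact: ofdeg0.
  by rewrite -{1}(subnKC ej); apply: ofdegZ.
have hsC : \sum_(j < n + e) C j = 0.
  rewrite -(big_mkord xpredT C) (big_cat_nat (n := e)) ?leq_addl //=.
  rewrite big_nat big1 ?add0r => [|j /andP[_ je]]; last by rewrite /C leqNgt je.
  rewrite -[e in LHS]add0n big_addn addnK big_mkord -[RHS]hs.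
  by apply: eq_bigr => j _; rewrite /C leq_addl addnK.
have := @ofdeg_indep _ M (n + e) C hC hsC (k + e).
by rewrite ltn_add2r /C leq_addl addnK; apply.
Qed.

Definition H0m : gmod K := gsub (GSubmod tors_closed tors_graded).

End LocalCohomology.

Section Lift.
Variables (M : gmod K) (D : gsubmod M) (N : lmodType P) (h : {linear M -> N}).
Hypothesis hD : forall x, x \in gs_pred D -> h x = 0.

Definition qlift (x : quot_type D) : N := h (repr x).

Lemma qliftE x : qlift (qproj D x) = h x.
Proof.
apply/eqP; rewrite -subr_eq0 -raddfB; apply/eqP/hD/proj_eq.
by rewrite /qproj reprK.
Qed.

Fact qlift_linear : linear qlift.
Proof.
move=> a x y; have [x' ->] := proj_onto x; have [y' ->] := proj_onto y.
by rewrite -linearP !qliftE linearP.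
Qed.

End Lift.
End Constructions.

Section Sheaves.
Variable K : fieldType.
Local Notation P := (coord K).

(* The projective plane as the scheme Proj P. *)
Record ppoint := PPoint {
  pt_ideal :> P -> bool;
  pt_idealr : idealr_closed pt_ideal;
  pt_prime : prime_idealr_closed pt_ideal;
  pt_homog : forall g, g \in pt_ideal -> forall k, pihomog mdeg k g \in pt_ideal;
  pt_relevant : exists i, 'X_i \notin pt_ideal }.

Lemma pt1 (p : ppoint) : 1 \notin pt_ideal p.
Proof. by have [] := pt_idealr p. Qed.

Lemma ptM (p : ppoint) (g h : P) :
  (g * h \in pt_ideal p) = (g \in pt_ideal p) || (h \in pt_ideal p).
Proof.
have [p0 _ pD] := pt_idealr p.
apply/idP/orP => [/pt_prime/orP //|[gp|hp]].
  by rewrite mulrC -[_ * _]addr0; apply: pD.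
by rewrite -[_ * _]addr0; apply: pD.
Qed.

Record zopen := ZOpen {
  zset :> ppoint -> Prop;
  zset_open : exists T : P -> Prop, (forall g, T g -> exists k, g \is k.-homog) /\
    forall p, zset p <-> exists2 g, T g & g \notin pt_ideal p }.

Definition zsub (V U : zopen) : Prop := forall p, V p -> U p.

Fact zopenI_open (U V : zopen) :
  exists T : P -> Prop, (forall g, T g -> exists k, g \is k.-homog) /\
    forall p : ppoint, (U p /\ V p) <-> exists2 g, T g & g \notin pt_ideal p.
Proof.
have [S [hS eS]] := zset_open U; have [T [hT eT]] := zset_open V.
exists (fun g => exists g1 g2, [/\ S g1, T g2 & g = g1 * g2]); split.
  move=> _ [g1 [g2 [/hS[k hk] /hT[l hl] ->]]]; exists (k + l)%N.
  exact: dhomogM.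
move=> p; split=> [[/eS[g1 ? h1] /eT[g2 ? h2]]|[_ [g1 [g2 [? ? ->]]]]].
  exists (g1 * g2); first by exists g1, g2.
  by rewrite ptM negb_or h1.
rewrite ptM negb_or => /andP[? ?].
by split; [apply/eS; exists g1 | apply/eT; exists g2].
Qed.
Definition zopenI (U V : zopen) : zopen := ZOpen (zopenI_open U V).

(* The stalk at p of the sheaf attached to M(a): fractions m / g with g a form
   not in p and m homogeneous of degree deg g + a. *)
Section Stalk.
Variables (M : gmod K) (a : nat) (p : ppoint).

Definition is_frac (x : M * P) : Prop :=
  exists k, [/\ ofdeg (k + a) x.1, x.2 \is k.-homog & x.2 \notin pt_ideal p].

Definition hfrac : Type := {x : M * P | `[< is_frac x >]}.
HB.instance Definition _ := Choice.on hfrac.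

Definition mkfrac x (hx : is_frac x) : hfrac := exist _ x (asboolT hx).

Lemma fracP (x : hfrac) : is_frac (val x).
Proof. exact: asboolW (valP x). Qed.

Definition frac_eq (x y : hfrac) : bool :=
  `[< exists e (u : P), [/\ u \is e.-homog, u \notin pt_ideal p &
        u *: ((val y).2 *: (val x).1 - (val x).2 *: (val y).1) = 0] >].

Fact frac_eq_refl : reflexive frac_eq.
Proof.
move=> x; apply/asboolP; exists 0%N, 1.
by rewrite dhomog1 pt1 subrr scaler0.
Qed.
Fact frac_eq_sym : ssrbool.symmetric frac_eq.
Proof.
suff h x y : frac_eq x y -> frac_eq y x by move=> x y; apply/idP/idP; exact: h.
move=> /asboolP[e [u [? ? h]]]; apply/asboolP; exists e, u; split=> //.
by rewrite -opprB scalerN h oppr0.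
Qed.
Fact frac_eq_trans : transitive frac_eq.
Proof.
move=> y x z /asboolP[e1 [u [hu pu hxy]]] /asboolP[e2 [v [hv pv hyz]]].
have [k [_ ht pt]] := fracP y.
apply/asboolP; exists (e1 + e2 + k)%N, (u * v * (val y).2).
split; first by do !apply: dhomogM.
  by rewrite !ptM !negb_or pu pv pt.
set m := (val x).1; set n := (val y).1; set o := (val z).1.
set s := (val x).2; set t := (val y).2; set w := (val z).2.
rewrite -/m -/n -/s -/t in hxy; rewrite -/n -/o -/t -/w in hyz.
transitivity ((v * w) *: (u *: (t *: m - s *: n)) +
              (u * s) *: (v *: (w *: n - t *: o))); last first.
  by rewrite hxy hyz !scaler0 addr0.
rewrite !scalerBr !scalerA addrA.
have -> : v * w * u * s = u * s * v * w by ring.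
rewrite addrNK; congr (_ *: _ - _ *: _); ring.
Qed.

Canonical frac_equiv := EquivRel frac_eq frac_eq_refl frac_eq_sym frac_eq_trans.
Definition stalk : Type := {eq_quot frac_eq}.
HB.instance Definition _ := Choice.on stalk.

Definition germ (x : hfrac) : stalk := \pi_{eq_quot frac_eq} x.

Lemma germ_eq x y : germ x = germ y <-> frac_eq x y.
Proof. by split=> [/eqmodP|h]; [|apply/eqmodP]. Qed.

Lemma germ_val x y : val x = val y -> germ x = germ y.
Proof. by move=> /val_inj ->. Qed.

Lemma germ_onto (x : stalk) : exists y, x = germ y.
Proof. by exists (repr x); rewrite /germ reprK. Qed.

Fact is_frac0 : is_frac (0, 1).
Proof. by exists 0%N; rewrite dhomog1 pt1; split=> //; exact: ofdeg0. Qed.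

Lemma ofdegN k (x : M) : ofdeg k x -> ofdeg k (- x).
Proof. by move=> hx; rewrite -sub0r; apply: ofdegB => //; exact: ofdeg0. Qed.

Lemma ofdegD k (x y : M) : ofdeg k x -> ofdeg k y -> ofdeg k (x + y).
Proof. by move=> hx hy; rewrite -[y]opprK; apply/ofdegB/ofdegN. Qed.

Fact is_fracN x : is_frac x -> is_frac (- x.1, x.2).
Proof. by move=> [k [? ? ?]]; exists k; split=> //; exact: ofdegN. Qed.

Fact is_fracD x y : is_frac x -> is_frac y ->
  is_frac (y.2 *: x.1 + x.2 *: y.1, x.2 * y.2).
Proof.
move=> [k [hx hs ps]] [l [hy ht pt]]; exists (k + l)%N; split => /=.
- apply: ofdegD; last by rewrite -addnA; exact: ofdegZ.
  by rewrite [(k + l)%N]addnC -addnA; exact: ofdegZ.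
- exact: dhomogM.
- by rewrite ptM negb_or ps.
Qed.

Definition frac0 : hfrac := mkfrac is_frac0.
Definition frac_opp (x : hfrac) : hfrac := mkfrac (is_fracN (fracP x)).
Definition frac_add (x y : hfrac) : hfrac := mkfrac (is_fracD (fracP x) (fracP y)).

Definition stalk0 : stalk := germ frac0.
Definition stalk_opp (x : stalk) : stalk := germ (frac_opp (repr x)).
Definition stalk_add (x y : stalk) : stalk := germ (frac_add (repr x) (repr y)).

Lemma repr_germ x : frac_eq (repr (germ x)) x.
Proof. by apply/germ_eq; rewrite /germ reprK. Qed.

Lemma stalk_oppE x : stalk_opp (germ x) = germ (frac_opp x).
Proof.
apply/germ_eq; have /asboolP[e [u [hu pu h]]] := repr_germ x.
apply/asboolP; exists e, u; split=> //=.
by rewrite -[RHS]oppr0 -h -[RHS]scalerN opprB !scalerN opprK addrC.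
Qed.

Lemma stalk_addE x y : stalk_add (germ x) (germ y) = germ (frac_add x y).
Proof.
apply/germ_eq; have /asboolP[e [u [hu pu h]]] := repr_germ x.
have /asboolP[e' [u' [hu' pu' h']]] := repr_germ y.
apply/asboolP; exists (e + e')%N, (u * u'); split=> /=.
- exact: dhomogM.
- by rewrite ptM negb_or pu.
set m := (val (repr (germ x))).1; set s := (val (repr (germ x))).2.
set m' := (val (repr (germ y))).1; set s' := (val (repr (germ y))).2.
set n := (val x).1; set t := (val x).2.
set n' := (val y).1; set t' := (val y).2.
rewrite -/m -/n -/s -/t in h; rewrite -/m' -/n' -/s' -/t' in h'.
transitivity ((u' * s' * t') *: (u *: (t *: m - s *: n)) +
              (u * s * t) *: (u' *: (t' *: m' - s' *: n'))); last first.
  by rewrite h h' !scaler0 addr0.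
rewrite !scalerBr !scalerDr !scalerA opprD addrACA.
by congr (_ *: _ - _ *: _ + (_ *: _ - _ *: _)); ring.
Qed.

Fact stalk_addA : associative stalk_add.
Proof.
move=> x y z; have [x' ->] := germ_onto x; have [y' ->] := germ_onto y.
have [z' ->] := germ_onto z; rewrite !stalk_addE; apply: germ_val => /=.
rewrite !scalerDr !scalerA mulrA addrA; congr (_, _).
by congr (_ *: _ + _ *: _ + _ *: _); ring.
Qed.
Fact stalk_addC : commutative stalk_add.
Proof.
move=> x y; have [x' ->] := germ_onto x; have [y' ->] := germ_onto y.
by rewrite !stalk_addE; apply: germ_val; rewrite /= addrC mulrC.
Qed.
Fact stalk_add0 : left_id stalk0 stalk_add.
Proof.
move=> x; have [x' ->] := germ_onto x; rewrite stalk_addE; apply: germ_val.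
by rewrite /= scaler0 add0r scale1r mul1r -surjective_pairing.
Qed.
Fact stalk_addN : left_inverse stalk0 stalk_opp stalk_add.
Proof.
move=> x; have [x' ->] := germ_onto x; rewrite stalk_oppE stalk_addE.
apply/germ_eq/asboolP; exists 0%N, 1; rewrite dhomog1 pt1; split=> //=.
by rewrite scalerN addNr !scaler0 subr0 scaler0.
Qed.
HB.instance Definition _ :=
  GRing.isZmodule.Build stalk stalk_addA stalk_addC stalk_add0 stalk_addN.

Lemma germD x y : germ x + germ y = germ (frac_add x y).
Proof. exact: stalk_addE. Qed.

(* Action of the local ring at p, which is the stalk attached to P itself. *)
Fact is_fracM (s : greg K * P) x :
  (exists k, [/\ ofdeg (k + 0) s.1, s.2 \is k.-homog & s.2 \notin pt_ideal p]) ->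
  is_frac x -> is_frac ((s.1 : P) *: x.1, s.2 * x.2).
Proof.
move=> [k [h1 h2 h3]] [l [? ? ?]]; exists (k + l)%N; split => /=.
- by rewrite -addnA; apply: ofdegZ => //; rewrite addn0 in h1.
- exact: dhomogM.
- by rewrite ptM negb_or h3.
Qed.
End Stalk.

Section Action.
Variables (M : gmod K) (a : nat) (p : ppoint).
Local Notation "''O'" := (stalk (greg K) 0 p).
Local Notation stalk := (stalk M a p).

Definition frac_act (s : hfrac (greg K) 0 p) (x : hfrac M a p) : hfrac M a p :=
  mkfrac (is_fracM (fracP s) (fracP x)).

Definition stalk_act (s : 'O) (x : stalk) : stalk :=
  germ (frac_act (repr s) (repr x)).

Lemma stalk_actE s x : stalk_act (germ s) (germ x) = germ (frac_act s x).
Proof.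
apply/germ_eq; have /asboolP[e [u [hu pu h]]] := repr_germ x.
have /asboolP[e' [u' [hu' pu' h']]] := repr_germ s.
apply/asboolP; exists (e' + e)%N, (u' * u); split=> /=.
- exact: dhomogM.
- by rewrite ptM negb_or pu'.
set m := (val (repr (germ x))).1; set b := (val (repr (germ x))).2.
set n := (val x).1; set c := (val x).2.
set m' : P := (val (repr (germ s))).1; set b' := (val (repr (germ s))).2.
set n' : P := (val s).1; set c' := (val s).2.
rewrite -/m -/n -/b -/c in h.
have {}h' : u' * (c' * m' - b' * n') = 0 := h'.
transitivity ((u' * c' * m') *: (u *: (c *: m - b *: n)) +
              (u' * (c' * m' - b' * n')) *: ((u * b) *: n)); last first.
  by rewrite h h' !scaler0 scale0r addr0.
rewrite mulrBr scalerBl !scalerBr !scalerA addrA.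
have -> : u' * (c' * m') * (u * b) = u' * c' * m' * u * b by ring.
by rewrite addrNK; congr (_ *: _ - _ *: _); ring.
Qed.

Fact stalk_actDr s x y : stalk_act s (x + y) = stalk_act s x + stalk_act s y.
Proof.
have [s' ->] := germ_onto s; have [x' ->] := germ_onto x.
have [y' ->] := germ_onto y; rewrite germD !stalk_actE germD.
apply/germ_eq/asboolP; exists 0%N, 1; rewrite dhomog1 pt1; split=> //=.
apply/eqP; rewrite scale1r subr_eq0; apply/eqP.
by rewrite !scalerDr !scalerA; congr (_ *: _ + _ *: _); ring.
Qed.

Fact stalk_actDl s t x : stalk_act (s + t) x = stalk_act s x + stalk_act t x.
Proof.
have [s' ->] := germ_onto s; have [x' ->] := germ_onto x.
have [t' ->] := germ_onto t; rewrite germD !stalk_actE germD.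
apply/germ_eq/asboolP; exists 0%N, 1; rewrite dhomog1 pt1; split=> //=.
apply/eqP; rewrite scale1r subr_eq0; apply/eqP.
rewrite scalerDr !scalerA -scalerDl; congr (_ *: _).
by rewrite /GRing.scale /=; ring.
Qed.

Fact is_frac1 : is_frac (M := greg K) 0 p (1 : P, 1).
Proof. by exists 0%N; rewrite pt1; split=> //; exact: dhomog1. Qed.

Definition stalk1 : 'O := germ (mkfrac is_frac1).

Fact stalk_act1 x : stalk_act stalk1 x = x.
Proof.
have [x' ->] := germ_onto x; rewrite stalk_actE; apply: germ_val.
by rewrite /= scale1r mul1r -surjective_pairing.
Qed.
End Action.

Section LocalRing.
Variable p : ppoint.
Local Notation "''O'" := (stalk (greg K) 0 p).
Local Notation mul := (@stalk_act (greg K) 0 p).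

Fact stalk_actA M a (s t : 'O) (x : stalk M a p) :
  stalk_act s (stalk_act t x) = stalk_act (mul s t) x.
Proof.
have [s' ->] := germ_onto s; have [t' ->] := germ_onto t.
have [x' ->] := germ_onto x; rewrite !stalk_actE; apply: germ_val.
by rewrite /= scalerA mulrA.
Qed.
Fact stalk_mulA : associative mul.
Proof. by move=> x y z; rewrite stalk_actA. Qed.
Fact stalk_mulC : commutative mul.
Proof.
move=> s t; have [s' ->] := germ_onto s; have [t' ->] := germ_onto t.
by rewrite !stalk_actE; apply: germ_val; congr (_, _); exact: mulrC.
Qed.
Fact stalk_mul1 : left_id (stalk1 p) mul.
Proof. exact: stalk_act1. Qed.
Fact stalk_mulDl : left_distributive mul +%R.
Proof. by move=> x y z; exact: stalk_actDl. Qed.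

Definition localring : Type := 'O.
HB.instance Definition _ := GRing.Zmodule.on localring.
HB.instance Definition _ := GRing.Zmodule_isComPzRing.Build localring
  stalk_mulA stalk_mulC stalk_mul1 stalk_mulDl.
End LocalRing.

HB.instance Definition _ M a p :=
  GRing.Zmodule_isLmodule.Build (localring p) (stalk M a p)
    (@stalk_actA p M a) (@stalk_act1 M a p) (@stalk_actDr M a p)
    (fun x s t => @stalk_actDl M a p s t x).
End Sheaves.

Section Modules.
Variable K : fieldType.
Local Notation P := (coord K).
Local Notation zopen := (zopen K).

(* The sheaf attached to M(a): functions to the stalks that are locally given
   by a single fraction. *)
Section Sections.
Variables (M : gmod K) (a : nat) (U : zopen).

Definition is_section (s : forall p, U p -> stalk M a p) : Prop :=
  forall p, U p -> exists (V : zopen) (x : M * P), V p /\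
    forall q (Uq : U q), V q -> exists2 z : hfrac M a q, val z = x & s q Uq = germ z.

Record tsec := TSec {
  tval :> forall p, U p -> stalk M a p;
  tvalP : is_section tval }.

HB.instance Definition _ := gen_eqMixin tsec.
HB.instance Definition _ := gen_choiceMixin tsec.

Lemma tsec_eq (s t : tsec) : (forall p (Up : U p), s p Up = t p Up) -> s = t.
Proof.
move=> h; have e : tval s = tval t.
  by apply: functional_extensionality_dep => p; apply: functional_extensionality_dep.
by case: s t e {h} => [s hs] [t ht] /= e; case: t / e ht => ht; congr TSec; exact: Prop_irrelevance.
Qed.

Fact is_section0 : is_section (fun p _ => 0).
Proof.
by move=> p Up; exists U, (0, 1); split=> // q Uq _; exists (frac0 M a q).
Qed.
Fact is_sectionN (s : tsec) : is_section (fun p Up => - s p Up).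
Proof.
move=> p Up; have [V [x [Vp h]]] := tvalP s Up.
exists V, (- x.1, x.2); split=> // q Uq Vq; have [z <- ->] := h q Uq Vq.
by exists (frac_opp z) => //; exact: stalk_oppE.
Qed.
Fact is_sectionD (s t : tsec) : is_section (fun p Up => s p Up + t p Up).
Proof.
move=> p Up; have [V [x [Vp h]]] := tvalP s Up.
have [W [y [Wp k]]] := tvalP t Up.
exists (zopenI V W), (y.2 *: x.1 + x.2 *: y.1, x.2 * y.2); split=> // q Uq [Vq Wq].
have [z <- ->] := h q Uq Vq; have [w <- ->] := k q Uq Wq.
by exists (frac_add z w) => //; exact: germD.
Qed.

Definition tsec0 := TSec is_section0.
Definition tsec_opp s := TSec (is_sectionN s).
Definition tsec_add s t := TSec (is_sectionD s t).

Fact tsec_addA : associative tsec_add.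
Proof. by move=> x y z; apply: tsec_eq => p Up; exact: addrA. Qed.
Fact tsec_addC : commutative tsec_add.
Proof. by move=> x y; apply: tsec_eq => p Up; exact: addrC. Qed.
Fact tsec_add0 : left_id tsec0 tsec_add.
Proof. by move=> x; apply: tsec_eq => p Up; exact: add0r. Qed.
Fact tsec_addN : left_inverse tsec0 tsec_opp tsec_add.
Proof. by move=> x; apply: tsec_eq => p Up; exact: addNr. Qed.
HB.instance Definition _ :=
  GRing.isZmodule.Build tsec tsec_addA tsec_addC tsec_add0 tsec_addN.
End Sections.

Definition regfun (U : zopen) : Type := tsec (greg K) 0 U.
HB.instance Definition _ U := GRing.Zmodule.on (regfun U).

Section Structure.
Variable U : zopen.

Section Action.
Variables (M : gmod K) (a : nat).

Fact is_section_act (r : regfun U) (s : tsec M a U) :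
  is_section (fun p Up => (r p Up : localring p) *: s p Up).
Proof.
move=> p Up; have [V [x [Vp h]]] := tvalP r Up.
have [W [y [Wp k]]] := tvalP s Up.
exists (zopenI V W), ((x.1 : P) *: y.1, x.2 * y.2); split=> // q Uq [Vq Wq].
have [z <- ->] := h q Uq Vq; have [w <- ->] := k q Uq Wq.
by exists (frac_act z w) => //; exact: stalk_actE.
Qed.
Definition tsec_act (r : regfun U) (s : tsec M a U) : tsec M a U :=
  TSec (is_section_act r s).
End Action.

Fact is_section1 : @is_section (greg K) 0 U (fun p _ => 1 : localring p).
Proof.
move=> p Up; exists U, (1 : P, 1); split=> // q Uq _.
by exists (mkfrac (is_frac1 q)).
Qed.
Definition O1 : regfun U := TSec is_section1.
Definition Omul (r s : regfun U) : regfun U := tsec_act r s.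

Fact OmulA : associative Omul.
Proof. by move=> x y z; apply: tsec_eq => p Up; exact: (@mulrA (localring p)). Qed.
Fact OmulC : commutative Omul.
Proof. by move=> x y; apply: tsec_eq => p Up; exact: (@mulrC (localring p)). Qed.
Fact Omul1 : left_id O1 Omul.
Proof. by move=> x; apply: tsec_eq => p Up; exact: (@mul1r (localring p)). Qed.
Fact OmulDl : left_distributive Omul +%R.
Proof. by move=> x y z; apply: tsec_eq => p Up; exact: (@mulrDl (localring p)). Qed.
HB.instance Definition _ :=
  GRing.Zmodule_isComPzRing.Build (regfun U) OmulA OmulC Omul1 OmulDl.

Variables (M : gmod K) (a : nat).
Local Notation act := (@tsec_act M a).
Fact tsec_actA (r s : regfun U) x : act r (act s x) = act (r * s) x.
Proof. by apply: tsec_eq => p Up; exact: stalk_actA. Qed.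
Fact tsec_act1 : left_id 1 act.
Proof. by move=> x; apply: tsec_eq => p Up; exact: scale1r. Qed.
Fact tsec_actDr : right_distributive act +%R.
Proof. by move=> r x y; apply: tsec_eq => p Up; exact: scalerDr. Qed.
Fact tsec_actDl x : {morph act^~ x : r s / r + s}.
Proof. by move=> r s; apply: tsec_eq => p Up; exact: stalk_actDl. Qed.
HB.instance Definition _ := GRing.Zmodule_isLmodule.Build (regfun U) (tsec M a U)
  tsec_actA tsec_act1 tsec_actDr tsec_actDl.
End Structure.

Section Restriction.
Variables (M : gmod K) (a : nat) (U V : zopen) (h : zsub V U).
Fact is_section_res (s : tsec M a U) : is_section (fun p Vp => s p (h Vp)).
Proof.
move=> p Vp; have [W [x [Wp k]]] := tvalP s (h Vp).
by exists W, x; split=> // q Vq; exact: k.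
Qed.
Definition tres (s : tsec M a U) : tsec M a V := TSec (is_section_res s).
End Restriction.

Definition Ores (U V : zopen) (h : zsub V U) (r : regfun U) : regfun V := tres h r.

(* Sheaves of O-modules on the projective plane. *)
Record omod := OMod {
  om_sec :> forall U : zopen, lmodType (regfun U);
  om_res : forall U V, zsub V U -> om_sec U -> om_sec V;
  om_resP : forall U V (h : zsub V U) (r : regfun U) (s t : om_sec U),
    om_res h (r *: s + t) = Ores h r *: om_res h s + om_res h t;
  om_res_id : forall U (h : zsub U U) (s : om_sec U), om_res h s = s;
  om_res_comp : forall U V W (h : zsub V U) (h' : zsub W V) (h'' : zsub W U)
    (s : om_sec U), om_res h' (om_res h s) = om_res h'' s;
  om_sep : forall U I (V : I -> zopen) (h : forall i, zsub (V i) U),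
    (forall p, U p -> exists i, V i p) ->
    forall s t : om_sec U, (forall i, om_res (h i) s = om_res (h i) t) -> s = t;
  om_glue : forall U I (V : I -> zopen) (h : forall i, zsub (V i) U),
    (forall p, U p -> exists i, V i p) ->
    forall s : (forall i, om_sec (V i)),
    (forall i j W (hi : zsub W (V i)) (hj : zsub W (V j)),
       om_res hi (s i) = om_res hj (s j)) ->
    exists t : om_sec U, forall i, om_res (h i) t = s i }.

Lemma om_res0 (A : omod) (U V : zopen) (h : zsub V U) : om_res h (0 : A U) = 0.
Proof.
have := om_resP h (-1) (0 : A U) 0; rewrite scaler0 addr0.
have -> : Ores h (-1) = -1 by exact: tsec_eq.
by rewrite scaleN1r addNr.
Qed.

Record omod_hom (A B : omod) := OModHom {
  oh_map :> forall U, {linear A U -> B U};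
  oh_res : forall U V (h : zsub V U) (s : A U),
    oh_map V (om_res h s) = om_res h (oh_map U s) }.

Definition omod_iso (A B : omod) : Prop :=
  exists phi : omod_hom A B, forall U, bijective (phi U).

Section Tilde.
Variables (M : gmod K) (a : nat).
Local Notation T := (tsec M a).

Fact tilde_resP (U V : zopen) (h : zsub V U) (r : regfun U) (s t : T U) :
  tres h (r *: s + t) = Ores h r *: tres h s + tres h t.
Proof. exact: tsec_eq. Qed.
Fact tilde_res_id (U : zopen) (h : zsub U U) (s : T U) : tres h s = s.
Proof. by apply: tsec_eq => p Up /=; congr (tval s _); exact: Prop_irrelevance. Qed.
Fact tilde_res_comp (U V W : zopen) (h : zsub V U) (h' : zsub W V) (h'' : zsub W U)
  (s : T U) : tres h' (tres h s) = tres h'' s.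
Proof. by apply: tsec_eq => p Wp /=; congr (tval s _); exact: Prop_irrelevance. Qed.
Fact tilde_sep (U : zopen) I (V : I -> zopen) (h : forall i, zsub (V i) U) :
  (forall p, U p -> exists i, V i p) ->
  forall s t : T U, (forall i, tres (h i) s = tres (h i) t) -> s = t.
Proof.
move=> hU s t hst; apply: tsec_eq => p Up; have [i Vp] := hU p Up.
have := congr1 (fun x : T (V i) => x p Vp) (hst i).
by rewrite /= (Prop_irrelevance (h i p Vp) Up).
Qed.
Fact tilde_glue (U : zopen) I (V : I -> zopen) (h : forall i, zsub (V i) U) :
  (forall p, U p -> exists i, V i p) ->
  forall s : (forall i, T (V i)),
  (forall i j W (hi : zsub W (V i)) (hj : zsub W (V j)),
     tres hi (s i) = tres hj (s j)) ->
  exists t : T U, forall i, tres (h i) t = s i.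
Proof.
move=> hU s hs.
have hs' i j p (Vi : V i p) (Vj : V j p) : s i p Vi = s j p Vj.
  have := hs i j (zopenI (V i) (V j)) (fun q => @proj1 _ _) (fun q => @proj2 _ _).
  move/(congr1 (fun x => @tval M a (zopenI (V i) (V j)) x p (conj Vi Vj))) => /=.
  by rewrite (Prop_irrelevance (proj1 _) Vi) (Prop_irrelevance (proj2 _) Vj).
pose c p (Up : U p) := cid (hU p Up).
pose t p (Up : U p) := s (sval (c p Up)) p (svalP (c p Up)).
have tE i p (Up : U p) (Vp : V i p) : t p Up = s i p Vp by exact: hs'.
have ht : is_section t.
  move=> p Up; have [i Vp] := hU p Up; have [W [x [Wp k]]] := tvalP (s i) Vp.
  exists (zopenI (V i) W), x; split=> // q Uq [Vq Wq].
  by rewrite (tE i q Uq Vq); exact: k.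
by exists (TSec ht) => i; apply: tsec_eq => p Vp; exact: tE.
Qed.

Definition tilde : omod :=
  @OMod T (@tres M a) tilde_resP tilde_res_id tilde_res_comp tilde_sep tilde_glue.
End Tilde.

(* A linear map of degree b - a induces M(a)~ -> N(b)~. *)
Section TildeHom.
Variables (M N : gmod K) (a b : nat) (h : {linear M -> N}).
Hypothesis hdeg : forall k x, ofdeg (k + a) x -> ofdeg (k + b) (h x).

Section AtPoint.
Variable p : ppoint K.

Fact is_frac_map (x : M * P) : is_frac a p x -> is_frac b p (h x.1, x.2).
Proof. by move=> [k [? ? ?]]; exists k; split=> //; exact: hdeg. Qed.
Definition frac_map (x : hfrac M a p) : hfrac N b p := mkfrac (is_frac_map (fracP x)).
Definition stalk_map (x : stalk M a p) : stalk N b p := germ (frac_map (repr x)).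

Lemma stalk_mapE x : stalk_map (germ x) = germ (frac_map x).
Proof.
apply/germ_eq; have /asboolP[e [u [hu pu k]]] := repr_germ x.
apply/asboolP; exists e, u; split=> //=; have := congr1 h k.
by rewrite linear0 linearZ linearB !linearZ.
Qed.

Fact stalk_mapP (r : localring p) x y :
  stalk_map (r *: x + y) = r *: stalk_map x + stalk_map y.
Proof.
have [r' ->] := germ_onto r; have [x' ->] := germ_onto x.
have [y' ->] := germ_onto y.
have -> : (germ r' : localring p) *: germ x' = germ (frac_act r' x').
  exact: stalk_actE.
rewrite germD !stalk_mapE.
have -> : (germ r' : localring p) *: germ (frac_map x') = germ (frac_act r' (frac_map x')).
  exact: stalk_actE.
by rewrite germD; apply: germ_val; rewrite /= linearD !(linearZ_LR h).
Qed.
End AtPoint.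

Section OnOpen.
Variable U : zopen.
Fact is_section_map (s : tsec M a U) : is_section (fun p Up => stalk_map (s p Up)).
Proof.
move=> p Up; have [V [x [Vp k]]] := tvalP s Up.
exists V, (h x.1, x.2); split=> // q Uq Vq; have [z <- ->] := k q Uq Vq.
by exists (frac_map z) => //; exact: stalk_mapE.
Qed.
Definition tsec_map (s : tsec M a U) : tsec N b U := TSec (is_section_map s).
Fact tsec_map_linear : linear tsec_map.
Proof. by move=> r s t; apply: tsec_eq => p Up; exact: stalk_mapP. Qed.
HB.instance Definition _ :=
  GRing.isLinear.Build (regfun U) (tsec M a U) (tsec N b U) _ tsec_map tsec_map_linear.
End OnOpen.

Fact tsec_map_res (U V : zopen) (k : zsub V U) (s : tsec M a U) :
  tsec_map (tres k s) = tres k (tsec_map s).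
Proof. exact: tsec_eq. Qed.

Definition tilde_hom : omod_hom (tilde M a) (tilde N b) :=
  @OModHom (tilde M a) (tilde N b) (fun U => tsec_map (U := U)) tsec_map_res.
End TildeHom.

Section Kernel.
Variables (A B : omod) (phi : omod_hom A B).

Section OnOpen.
Variable U : zopen.
Definition in_ker : {pred A U} := [pred s | phi U s == 0].
Fact in_ker_closed : submod_closed in_ker.
Proof.
split=> [|r s t]; first by rewrite inE linear0.
by rewrite !inE linearP => /eqP-> /eqP->; rewrite scaler0 addr0.
Qed.
HB.instance Definition _ := GRing.isSubmodClosed.Build (regfun U) (A U) in_ker in_ker_closed.
Definition kersec : Type := {s : A U | s \in in_ker}.
HB.instance Definition _ := SubChoice.on kersec.
HB.instance Definition _ := [SubChoice_isSubLmodule of kersec by <:].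
End OnOpen.

Fact kerres_subproof (U V : zopen) (h : zsub V U) (s : kersec U) :
  om_res h (val s) \in @in_ker V.
Proof.
rewrite inE oh_res; have /eqP -> := valP s.
exact/eqP/om_res0.
Qed.
Definition kerres (U V : zopen) (h : zsub V U) (s : kersec U) : kersec V :=
  exist (fun x => x \in @in_ker V) _ (kerres_subproof h s).

Fact kerresP (U V : zopen) (h : zsub V U) (r : regfun U) (s t : kersec U) :
  kerres h (r *: s + t) = Ores h r *: kerres h s + kerres h t.
Proof.
by apply: val_inj; exact: om_resP.
Qed.
Fact kerres_id (U : zopen) (h : zsub U U) (s : kersec U) : kerres h s = s.
Proof. by apply: val_inj; exact: om_res_id. Qed.
Fact kerres_comp (U V W : zopen) (h : zsub V U) (h' : zsub W V) (h'' : zsub W U)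
  (s : kersec U) : kerres h' (kerres h s) = kerres h'' s.
Proof. by apply: val_inj; exact: om_res_comp. Qed.
Fact ker_sep (U : zopen) I (V : I -> zopen) (h : forall i, zsub (V i) U) :
  (forall p, U p -> exists i, V i p) ->
  forall s t : kersec U, (forall i, kerres (h i) s = kerres (h i) t) -> s = t.
Proof.
move=> hU s t e; apply/val_inj/(om_sep hU) => i.
exact: (congr1 val (e i)).
Qed.
Fact ker_glue (U : zopen) I (V : I -> zopen) (h : forall i, zsub (V i) U) :
  (forall p, U p -> exists i, V i p) ->
  forall s : (forall i, kersec (V i)),
  (forall i j W (hi : zsub W (V i)) (hj : zsub W (V j)),
     kerres hi (s i) = kerres hj (s j)) ->
  exists t : kersec U, forall i, kerres (h i) t = s i.
Proof.
move=> hU s e.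
have [|t ht] := @om_glue A U I V h hU (fun i => val (s i)).
  by move=> i j W hi hj; exact: (congr1 val (e i j W hi hj)).
have kt : t \in @in_ker U.
  rewrite inE; apply/eqP/(om_sep hU) => i.
  by rewrite -oh_res ht om_res0; apply/eqP; exact: valP (s i).
by exists (exist (fun x => x \in @in_ker U) t kt) => i; apply: val_inj; exact: ht.
Qed.

Definition omod_ker : omod :=
  @OMod kersec kerres kerresP kerres_id kerres_comp ker_sep ker_glue.
End Kernel.
End Modules.

Section Curves.
Variable K : fieldType.
Local Notation P := (coord K).

Record plane_curve := PlaneCurve {
  eqn : P;
  cdeg : nat;
  cdeg_gt0 : (0 < cdeg)%N;
  eqn_homog : eqn \is cdeg.-homog;
  eqn_reduced : forall g h : P, eqn = g ^+ 2 * h -> g \is a GRing.unit }.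

Variable X : plane_curve.
Local Notation f := (eqn X).
Local Notation d := (cdeg X).

Fact partial_homog i : f^`M(i) \is d.-1.-homog.
Proof.
rewrite [f]mpolyE raddf_sum big_seq; apply: rpred_sum => m hm /=.
rewrite mderivZ mderivX; apply/rpredZ; have [->|mi] := eqVneq (m i) 0%N.
  by rewrite scale0r; exact: dhomog0.
have eU : (m - U_(i) + U_(i))%MM = m.
  by apply/submK/mnm_lepP => j; rewrite mnm1E; case: eqP => // <-; rewrite lt0n.
apply: rpredZ; rewrite dhomogX -(dhomog_mf (eqn_homog X) hm) -[X in _ == (mdeg X).-1]eU.
by rewrite mdegD mdeg1 addn1.
Qed.

Lemma euler : \sum_i 'X_i * f^`M(i) = d%:R *: f.
Proof.
have hX m i : 'X_i * ('X_[m])^`M(i) = (m i)%:R *: 'X_[m] :> P.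
  rewrite mderivX -scalerAr; have [->|mi] := eqVneq (m i) 0%N.
    by rewrite !scale0r.
  rewrite -mpolyXD addmC submK //.
  by apply/mnm_lepP => j; rewrite mnm1E; case: eqP => // <-; rewrite lt0n.
under eq_bigr => i _ do rewrite {1}[f]mpolyE raddf_sum mulr_sumr.
rewrite exchange_big /= {3}[f]mpolyE scaler_sumr !big_seq.
apply: eq_bigr => m hm.
under eq_bigr => i _ do rewrite mderivZ -scalerAr hX.
rewrite -scaler_sumr -scaler_suml -natr_sum scalerA mulrC -scalerA.
by rewrite -mdegE (dhomog_mf (eqn_homog X) hm).
Qed.

(* The jacobian ring R(f) = P / J(f). *)
Definition jacobian_ideal : gsubmod (greg K) :=
  gspan (M := greg K) (g := fun i : 'I_3 => f^`M(i)) partial_homog.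
Definition Rjac : gmod K := gquot jacobian_ideal.

(* H^0_m(R(f)) is J(f)^sat / J(f). *)
Lemma tors_Rjac (g : P) : qproj jacobian_ideal g \in in_tors (M := Rjac) <->
  exists n, forall e (h : P), (n <= e)%N -> h \is e.-homog ->
    h * g \in gs_pred jacobian_ideal.
Proof.
split=> [/asboolP|] [n hn]; last (apply/asboolP); exists n => e h ne hh.
  apply/(@proj_eq0 _ _ jacobian_ideal); rewrite -[RHS](hn e h ne hh).
  exact: (projZ jacobian_ideal h g).
transitivity (qproj jacobian_ideal (h * g)); first exact: (esym (projZ jacobian_ideal h g)).
exact: (proj2 (proj_eq0 jacobian_ideal _) (hn e h ne hh)).
Qed.

(* T_{P^2} as the cokernel of the Euler field O -> O(1)^3; the class of the row
   (A_0, A_1, A_2) stands for sum_i A_i d/dX_i. *)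
Definition euler_field : 'rV[P]_3 := \row_i 'X_i.
Fact euler_field_homog (_ : 'I_1) : free_ofdeg 1 euler_field.
Proof. by move=> i; rewrite mxE dhomogX; apply/eqP; exact: mdeg1. Qed.
Definition tangent_gmod : gmod K := gquot (gspan (M := gfree K 3) euler_field_homog).
Definition tangent_sheaf : omod K := tilde tangent_gmod 1.

(* J_{f/X}, the image of the ideal sheaf of J(f) in O_X = (P / f)~. *)
Definition eqn_ideal : gsubmod (greg K) :=
  gspan (M := greg K) (r := 1) (fun=> eqn_homog X : @ofdeg _ (greg K) d f).
Definition coord_gmod : gmod K := gquot eqn_ideal.
Definition partialX i : coord_gmod := qproj eqn_ideal (f^`M(i)).
Fact partialX_homog i : ofdeg d.-1 (partialX i).
Proof. by exists (f^`M(i)); first exact: partial_homog. Qed.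
Definition jacobianX : gsubmod coord_gmod := gspan partialX_homog.
Definition jacobianX_sheaf (a : nat) : omod K := tilde (gsub jacobianX) a.

Fact eta_row_subproof (A : 'rV[P]_3) :
  \sum_i A 0 i *: partialX i \in gs_pred jacobianX.
Proof. by apply/asboolP; exists (A 0). Qed.
Definition eta_row (A : gfree K 3) : submod_type jacobianX :=
  exist (fun x => x \in gs_pred jacobianX) _ (eta_row_subproof A).

Fact eta_row_linear : linear eta_row.
Proof.
move=> a A B; apply: val_inj; rewrite /= scaler_sumr -big_split /=.
by apply: eq_bigr => i _; rewrite !mxE scalerDl scalerA.
Qed.
HB.instance Definition _ :=
  GRing.isLinear.Build P (gfree K 3) (submod_type jacobianX) _ eta_row eta_row_linear.

Fact eta_row_euler A : A \in gs_pred (gspan (M := gfree K 3) euler_field_homog) ->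
  eta_row A = 0.
Proof.
move=> /asboolP[B ->]; rewrite big_ord1 linearZ /=.
suff -> : eta_row euler_field = 0 by rewrite scaler0.
apply: val_inj => /=; under eq_bigr do rewrite mxE -projZ.
rewrite -raddf_sum; apply/proj_eq0/asboolP; exists (fun=> d%:R).
rewrite big_ord1; apply: (etrans euler).
by rewrite scaler_nat -(mulr_natl f).
Qed.

Definition eta_gmod : tangent_gmod -> gsub jacobianX :=
  qlift (D := gspan (M := gfree K 3) euler_field_homog) eta_row.
HB.instance Definition _ := GRing.isLinear.Build P tangent_gmod (gsub jacobianX) _
  eta_gmod (qlift_linear eta_row_euler).

Fact eta_gmod_homog k x : ofdeg (k + 1) x -> ofdeg (k + d) (eta_gmod x).
Proof.
move=> [A hA ->]; rewrite /eta_gmod qliftE; last exact: eta_row_euler.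
change (@ofdeg _ coord_gmod (k + d) (\sum_i A 0 i *: partialX i)).
elim/big_ind: _ => [|x1 x2 h1 h2|i _]; first exact: (@ofdeg0 _ coord_gmod).
  exact: (@ofdegD _ coord_gmod).
have -> : (k + d = k + 1 + d.-1)%N by rewrite -addnA add1n prednK // cdeg_gt0.
by apply: (@ofdegZ _ coord_gmod) (partialX_homog i); exact: hA.
Qed.

(* eta : T_{P^2} -> J_{f/X}(d), sum_i A_i d/dX_i |-> sum_i A_i df/dX_i *)
Definition eta : omod_hom tangent_sheaf (jacobianX_sheaf d) :=
  tilde_hom (h := eta_gmod) eta_gmod_homog.

(* The sheaf T<X> of logarithmic vector fields. *)
Definition log_sheaf : omod K := omod_ker eta.

End Curves.

Section Reconstruction.
Variable K : fieldType.

Definition same_curve (X X' : plane_curve K) : Prop :=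
  forall p : ppoint K, eqn X \in pt_ideal p <-> eqn X' \in pt_ideal p.

(* Torelli in the sense of Dolgachev and Kapranov *)
Definition torelli (X : plane_curve K) : Prop :=
  forall X' : plane_curve K,
    omod_iso (log_sheaf X') (log_sheaf X) -> same_curve X' X.

Definition reconstructible_from_H0m (X : plane_curve K) : Prop :=
  forall X' : plane_curve K,
    gmod_iso (H0m (Rjac X')) (H0m (Rjac X)) -> same_curve X' X.

End Reconstruction.

(* Main.v *)
From HB Require Import structures.
From mathcomp Require Import all_boot all_order all_algebra.
From mathcomp Require Import boolp reals complex mpoly ring zify.
Require Import Defs.

Set Implicit Arguments.
Unset Strict Implicit.
Unset Printing Implicit Defensive.

Import GRing.Theory.
Local Open Scope ring_scope.

(** Write [AR f] for the graded module of syzygies of the gradient of [f], the rows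
    [A] with [A . grad f = 0], and [I] for the saturation of the jacobian ideal [J].
    Both sides of the equivalence are governed by [AR f].

    The sheaf. By Euler's relation the Euler field maps [f] to a nonzero multiple of
    [f], so a vector field tangent to the curve is, modulo the Euler field, a unique
    syzygy: [T<X>] is the sheaf of [AR f], up to a twist ([log_sheaf_iso]).
    Conversely the sheaf gives back the graded module ([syz_iso_of_omod_iso]): a map
    of sheaves is followed at the generic point and at the points of the irreducible
    curves, and a fraction whose denominator divides locally at all primes of height
    one is a polynomial, the polynomial ring being factorial.

    The degree. On [AR f], of rank two, [A x B = delta(A, B) grad f] for a unique
    polynomial [delta(A, B)]. As [f] is reduced its partial derivatives have no common
    factor ([primitive_grad]), and [delta] is determined by the module up to a
    constant. Hence an isomorphism between [AR f] and [AR f'] with given twists fixes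
    a relation between the two degrees ([syz_iso_degree]), which forces them to agree
    in both situations where it is needed.

    The local cohomology. A class of [I / J] is the obstruction to gluing local
    presentations of a polynomial by the gradient, that is a Cech class of syzygies;
    so [AR f] determines [I / J] ([h0_iso_of_syz_iso]). In the other direction let
    [F] be the module of relations between [grad f] and generators of [I]; it is
    free, and [AR f] is the kernel of [F -> P^m], a presentation of [I / J]. If
    [I <> J] then [AR f] has no free direct summand, so it lies in [m F], lifts of an
    isomorphism of the modules [I / J] to the free modules are isomorphisms by
    nilpotence, and they restrict to the syzygies ([syz_iso_of_h0_iso]).

    Thus the isomorphisms of [T<X>] with [T<X'>] and those of the local cohomology
    modules exist for the same curves, unless [I = J]. In that case the local
    cohomology vanishes, but [X] is not Torelli either ([torelli_not_saturated]):
    [AR f] is free, its sheaf only depends on the degrees of a basis, and these do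
    not change when [X] is moved by a linear change of coordinates. *)

(** * Divisibility and factorial domains *)
Definition rdvd (R : comNzRingType) (a b : R) := exists c, b = c * a.

Section Divisibility.
Variable R : comNzRingType.
Implicit Types a b c : R.

Lemma rdvdd a : rdvd a a. Proof. by exists 1; rewrite mul1r. Qed.
Lemma rdvd0 a : rdvd a 0. Proof. by exists 0; rewrite mul0r. Qed.
Lemma rdvdMl a b c : rdvd a c -> rdvd a (b * c).
Proof. by move=> [d ->]; exists (b * d); rewrite mulrA. Qed.
Lemma rdvdMr a b c : rdvd a b -> rdvd a (b * c).
Proof. by rewrite mulrC; exact: rdvdMl. Qed.
Lemma rdvdD a b c : rdvd a b -> rdvd a c -> rdvd a (b + c).
Proof. by move=> [d ->] [e ->]; exists (d + e); rewrite mulrDl. Qed.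
Lemma rdvdN a b : rdvd a b -> rdvd a (- b).
Proof. by move=> [d ->]; exists (- d); rewrite mulNr. Qed.
Lemma rdvd_trans b a c : rdvd a b -> rdvd b c -> rdvd a c.
Proof. by move=> h [d ->]; exact: rdvdMl. Qed.
Lemma rdvd_sum I (r : seq I) (Q : pred I) (F : I -> R) a :
  (forall i, Q i -> rdvd a (F i)) -> rdvd a (\sum_(i <- r | Q i) F i).
Proof. by move=> h; elim/big_ind: _ => //; [exact: rdvd0 | exact: rdvdD]. Qed.
End Divisibility.

Section Primes.
Variable R : idomainType.
Implicit Types a b p : R.

Definition prime_elt p := [/\ p != 0, p \isn't a GRing.unit &
  forall a b, rdvd p (a * b) -> rdvd p a \/ rdvd p b].

(** [n] bounds the number of prime factors, for inductions on it. *)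
Definition factored n a := exists u (s : seq R),
  [/\ u \is a GRing.unit, (size s <= n)%N, forall p, p \in s -> prime_elt p &
      a = u * \prod_(p <- s) p].

Definition factorial_ring := forall a, a != 0 -> exists n, factored n a.

Lemma factored_unit u n : u \is a GRing.unit -> factored n u.
Proof. by move=> hu; exists u, [::]; split=> //; rewrite big_nil mulr1. Qed.

Lemma factored_prime p : prime_elt p -> factored 1 p.
Proof.
move=> hp; exists 1, [:: p]; split=> //; rewrite ?unitr1 ?big_seq1 ?mul1r //.
by move=> q; rewrite inE => /eqP ->.
Qed.

Lemma factoredM m n a b : factored m a -> factored n b -> factored (m + n) (a * b).
Proof.
move=> [u [s [hu hs ps ->]]] [v [t [hv ht pt ->]]]; exists (u * v), (s ++ t).
split; first by rewrite unitrM hu.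
- by rewrite size_cat leq_add.
- by move=> p; rewrite mem_cat => /orP[/ps|/pt].
- by rewrite big_cat /= mulrACA.
Qed.

Lemma rdvd_unit a u : u \is a GRing.unit -> rdvd a u -> a \is a GRing.unit.
Proof. by move=> hu [c e]; move: hu; rewrite e unitrM => /andP[]. Qed.

Lemma prime_dvd_prod p (s : seq R) : prime_elt p ->
  rdvd p (\prod_(q <- s) q) -> exists2 q, q \in s & rdvd p q.
Proof.
move=> hp; have [_ nu h] := hp; elim: s => [|q s IH].
  by rewrite big_nil => /(rdvd_unit (unitr1 R)); rewrite (negbTE nu).
rewrite big_cons => /h [pq|/IH [r rs pr]]; first by exists q; rewrite ?mem_head.
by exists r => //; rewrite inE rs orbT.
Qed.

(** Cancelling a prime shortens a factorization: the prime is, up to a unit,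
    one of the listed factors. *)
Lemma factored_cancel n p b : prime_elt p -> factored n (b * p) -> b != 0 ->
  (0 < n)%N /\ factored n.-1 b.
Proof.
move=> hp [u [s [hu hs ps e]]] b0; have [p0 nu h] := hp.
have : rdvd p (u * \prod_(q <- s) q) by exists b.
case/h => [/(rdvd_unit hu)|/(prime_dvd_prod hp) [q qs [v eq]]]; first by rewrite (negbTE nu).
have [q0 nq hq] := ps q qs.
have hv : v \is a GRing.unit.
  have [] : rdvd q v \/ rdvd q p by apply: hq; rewrite -eq; exact: rdvdd.
    move=> [w ev]; have : q * 1 = q * (w * p) by rewrite mulr1 {1}eq ev; ring.
    move/(mulfI q0) => /esym e1; have : w * p \is a GRing.unit by rewrite e1 unitr1.
    by rewrite unitrM (negbTE nu) andbF.
  move=> [w ew]; have : q * 1 = q * (v * w) by rewrite mulr1 {1}eq ew; ring.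
  move/(mulfI q0) => /esym e1; have : v * w \is a GRing.unit by rewrite e1 unitr1.
  by rewrite unitrM => /andP[].
have n0 : (0 < n)%N by apply: leq_trans hs; case: (s) qs.
split=> //; exists (u * v), (rem q s); split; first by rewrite unitrM hu.
- by rewrite size_rem // -!subn1 leq_sub2r.
- by move=> r /mem_rem /ps.
- apply: (mulIf p0); rewrite e (perm_big _ (perm_to_rem qs)) big_cons; move: (\prod_(j <- rem q s) j) => t; rewrite eq /=; ring.
Qed.
End Primes.

(** * Polynomials over a factorial domain *)
Section PolyFactorial.
Variable R : idomainType.
Implicit Types (c : R) (p q g h : {poly R}).

Lemma rdvd_polyC c p : rdvd c%:P p <-> forall i, rdvd c p`_i.
Proof.
split=> [[q ->] i|h]; first by exists q`_i; rewrite coefMC.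
have [e he] := choice h; exists (\poly_(i < size p) e i).
apply/polyP => i; rewrite coefMC coef_poly; case: ltnP => [_|hi]; first exact: he.
by rewrite nth_default // mul0r.
Qed.

Lemma first_nondiv c p : ~ rdvd c%:P p ->
  exists i, ~ rdvd c p`_i /\ forall j, (j < i)%N -> rdvd c p`_j.
Proof.
move=> hn; have /existsNP [i0 hi0] : ~ forall i, rdvd c p`_i by move/rdvd_polyC.
have ex : exists i, `[< ~ rdvd c p`_i >] by exists i0; apply/asboolP.
case: (ex_minnP ex) => i /asboolP hi hmin; exists i; split=> // j ji.
by apply: contrapT => /asboolP /hmin; rewrite leqNgt ji.
Qed.

(** The first coefficients of [p] and [q] that [c] does not divide have a product
    which is the only term of its coefficient of [p * q] that [c] does not divide. *)
Lemma prime_polyC c : prime_elt c -> prime_elt c%:P.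
Proof.
move=> [c0 nu hc]; split; first by rewrite polyC_eq0.
  by rewrite poly_unitE coefC eqxx negb_and nu orbT.
move=> p q /rdvd_polyC hpq; apply: contrapT => /not_orP [np nq].
have [i [hi li]] := first_nondiv np; have [j [hj lj]] := first_nondiv nq.
suff : rdvd c (p`_i * q`_j) by case/hc.
have := hpq (i + j)%N; have ii : (i < (i + j).+1)%N by lia.
rewrite coefM (bigD1 (Ordinal ii)) //= addKn => h.
rewrite -[X in rdvd c X](addrK (\sum_(k < (i + j).+1 | k != Ordinal ii) p`_k * q`_(i + j - k))).
apply: rdvdD => //; apply/rdvdN/rdvd_sum => k ki.
have [kl|kl] := ltnP k i; first exact/rdvdMr/li.
apply/rdvdMl/lj; have : (k : nat) != i by apply: contraNneq ki => ki; exact/eqP/val_inj.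
by have := ltn_ord k; lia.
Qed.

Definition primitive_poly p := forall c, prime_elt c -> ~ rdvd c%:P p.

(** Each prime constant taken out of [p] is taken out of a factorization of the
    leading coefficient, so the process stops. *)
Lemma primitive_part n p : p != 0 -> factored n (lead_coef p) ->
  exists c q, [/\ c != 0, p = c%:P * q & primitive_poly q].
Proof.
move: {2}n (leqnn n) => N; elim: N n p => [|N IH] n p nN p0 hn.
all: case: (pselect (primitive_poly p)) => [pp|];
  first by exists 1, p; rewrite oner_eq0 mul1r.
all: move=> /existsNP [c /not_implyP [hc /contrapT [q eq]]].
all: have q0 : q != 0 by apply: contraNneq p0 => q0; rewrite eq q0 mul0r.
all: rewrite eq lead_coefM lead_coefC in hn.
all: have [|n0 hq] := factored_cancel hc hn; rewrite ?lead_coef_eq0 //.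
  by lia.
have [|d [r [d0 er hr]]] := IH n.-1 q _ q0 hq; first by lia.
exists (d * c), r; split=> //; last by rewrite eq er polyCM; ring.
by have [c0 _ _] := hc; rewrite mulf_neq0.
Qed.

Hypothesis hR : factorial_ring R.

(** The primes of [c] divide [k] one after the other, as they do not divide the
    primitive [p]. *)
Lemma clear_const c p q k : primitive_poly p -> c != 0 ->
  c%:P * q = p * k -> rdvd p q.
Proof.
move=> pp c0; have [n [u [s [hu _ hs ->]]]] := hR c0.
elim: s k hs => [|d s IH] k hs.
  rewrite big_nil mulr1 => e; exists ((u^-1)%:P * k).
  apply: (@mulfI _ u%:P); first by rewrite polyC_eq0; apply: contraTneq hu => ->; rewrite unitr0.
  by rewrite e !mulrA -polyCM divrr // mul1r mulrC.
have hd := hs d (mem_head _ _); have [d0 _ _] := hd.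
have [_ _ hP] := prime_polyC hd.
rewrite big_cons => e; have : rdvd d%:P (p * k).
  by exists ((u * \prod_(j <- s) j)%:P * q); rewrite -e !polyCM; ring.
case/hP => [/(pp d hd)//|[k' ek]]; apply: (IH k').
  by move=> x xs; apply: hs; rewrite inE xs orbT.
apply: (@mulIf _ d%:P); first by rewrite polyC_eq0.
by move: e; rewrite ek !polyCM => e; transitivity (p * (k' * d%:P)); [rewrite -e|]; ring.
Qed.

(** The primes of [c] are distributed one by one over the two factors. *)
Lemma split_const c p g h : c != 0 -> c%:P * p = g * h ->
  exists g1 h1, [/\ p = g1 * h1, size g1 = size g & size h1 = size h].
Proof.
move=> c0; have [n [u [s [hu _ hs ->]]]] := hR c0.
have u0 : u != 0 by apply: contraTneq hu => ->; rewrite unitr0.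
elim: s g h hs => [|d s IH] g h hs.
  rewrite big_nil mulr1 => e; exists ((u^-1)%:P * g), h; split=> //.
    apply: (@mulfI _ u%:P); first by rewrite polyC_eq0.
    by rewrite e !mulrA -polyCM divrr // mul1r.
  by rewrite size_Cmul // invr_eq0.
have hd := hs d (mem_head _ _); have [d0 _ _] := hd.
have [_ _ hP] := prime_polyC hd.
have hs' x : x \in s -> prime_elt x by move=> xs; apply: hs; rewrite inE xs orbT.
rewrite big_cons => e; have : rdvd d%:P (g * h).
  by exists ((u * \prod_(j <- s) j)%:P * p); rewrite -e !polyCM; ring.
case/hP => [[g' eg]|[h' eh]].
  have [|g1 [h1 [-> e1 e2]]] := IH g' h hs'; last first.
    by exists g1, h1; rewrite e1 e2 eg [g' * _]mulrC size_Cmul.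
  apply: (@mulIf _ d%:P); first by rewrite polyC_eq0.
  by move: e; rewrite eg !polyCM => e; transitivity (g' * d%:P * h); [rewrite -e|]; ring.
have [|g1 [h1 [-> e1 e2]]] := IH g h' hs'; last first.
  by exists g1, h1; rewrite e1 e2 eh [h' * _]mulrC size_Cmul.
apply: (@mulIf _ d%:P); first by rewrite polyC_eq0.
by move: e; rewrite eh !polyCM => e; transitivity (g * (h' * d%:P)); [rewrite -e|]; ring.
Qed.

(** Gauss's lemma. Up to constants [p] has a gcd with [a], and irreducibility leaves
    two cases: the gcd is constant and [p] divides [b] up to a constant, or it is
    associate to [p]. Primitivity of [p] then clears the constant. *)
Lemma irreducible_primitive_prime p : (1 < size p)%N -> primitive_poly p ->
  (forall g h, p = g * h -> (size g <= 1)%N \/ (size h <= 1)%N) -> prime_elt p.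
Proof.
move=> sp pp hirr; have p0 : p != 0 by rewrite -size_poly_gt0; lia.
split=> //; first by rewrite poly_unitE; case: eqP => // e; rewrite e in sp.
move=> a b [e eab].
have /Pdiv.WeakIdomain.dvdpP [[c k] /= c0] := dvdp_gcdl p a.
rewrite -mul_polyC => /(split_const c0) [g1 [h1 [ep s1 s2]]].
have div d : p %| d -> rdvd p d.
  move/Pdiv.WeakIdomain.dvdpP => [[c' k'] /= c'0]; rewrite -mul_polyC mulrC [k' * _]mulrC => e'.
  by apply: (@clear_const c' p d k') => //; rewrite mulrC.
have [s3|s3] := hirr _ _ ep; last first.
  right; apply: div.
  have cop : coprimep p a.
    rewrite /coprimep -s2 eqn_leq s3 lt0n size_poly_eq0.
    by apply: contraNneq p0 => h0; rewrite ep h0 mulr0.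
  rewrite -(Gauss_dvdpr b cop); apply/Pdiv.WeakIdomain.dvdpP; exists (1, e) => /=; first exact: oner_neq0.
  by rewrite scale1r eab.
left; apply: div.
have sk : size k = 1%N.
  apply/eqP; rewrite -s1 eqn_leq s3 lt0n size_poly_eq0.
  by apply: contraNneq p0 => g0; rewrite ep g0 mul0r.
apply: dvdp_trans (dvdp_gcdr p a).
have [d d0 ek] : exists2 d, d != 0 & k = d%:P.
  have /eqP/size_poly1P [d d0 ek] := sk; by exists d.
have : size p = size (gcdp p a).
  have g10 : g1 != 0 by apply: contraNneq p0 => g0; rewrite ep g0 mul0r.
  have h10 : h1 != 0 by apply: contraNneq p0 => h0; rewrite ep h0 mulr0.
  by rewrite {1}ep size_mul // s1 s2 sk.
move/eqP; rewrite eq_sym (dvdp_size_eqp (dvdp_gcdl p a)) => /eqp_dvdl <-.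
exact: dvdpp.
Qed.

Lemma poly_factorial : factorial_ring {poly R}.
Proof.
have const c : c != 0 -> exists n, factored n c%:P.
  move=> /hR [n [u [s [hu sn hs ->]]]]; exists n, u%:P, (map polyC s).
  split; last by rewrite polyCM big_map rmorph_prod.
  - have u0 : u != 0 by apply: contraTneq hu => ->; rewrite unitr0.
    by rewrite poly_unitE coefC size_polyC u0.
  - by rewrite size_map.
  - by move=> p /mapP [c' /hs h ->]; exact: prime_polyC.
move=> p; move: {2}(size p) (leqnn (size p)) => N.
elim: N p => [|N IH] p sp p0; first by move: p0; rewrite -size_poly_gt0; lia.
have [s1|s1] := leqP (size p) 1.
  have e := size1_polyC s1; rewrite e; apply: const.
  by apply: contraNneq p0 => h; rewrite e h.
have [n hn] : exists n, factored n (lead_coef p) by apply: hR; rewrite lead_coef_eq0.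
have [c [q [c0 ep hq]]] := primitive_part p0 hn.
have [m hm] := const c c0.
have sq : size q = size p by rewrite ep size_Cmul.
have q0 : q != 0 by rewrite -size_poly_gt0 sq; lia.
suff [k hk] : exists k, factored k q by exists (m + k)%N; rewrite ep; exact: factoredM.
have [hirr|] := pselect (forall g h, q = g * h -> (size g <= 1)%N \/ (size h <= 1)%N).
  by exists 1%N; apply/factored_prime/irreducible_primitive_prime => //; rewrite sq.
move=> /existsNP [g /existsNP [h /not_implyP [e /not_orP []]]] /negP sg /negP sh.
have g0 : g != 0 by apply: contraNneq q0 => g0; rewrite e g0 mul0r.
have h0 : h != 0 by apply: contraNneq q0 => h0; rewrite e h0 mulr0.
have e3 : size p = (size g + size h).-1 by rewrite -sq e size_mul.
have [||a ha] := IH g => //; first by lia.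
have [||b hb] := IH h => //; first by lia.
by exists (a + b)%N; rewrite e; exact: factoredM.
Qed.
End PolyFactorial.

(** * Noetherian modules and polynomial rings *)
Section Noetherian.
Variables (R : comNzRingType) (V : lmodType R).
Implicit Types (S : V -> Prop) (s : seq V).

Definition submod S := S 0 /\ forall a x y, S x -> S y -> S (a *: x + y).
(** The submodule generated by [s], as an intersection: the members inherit any
    closed property of the generators without a choice of coefficients. *)
Definition lspan s x := forall S, submod S -> (forall y, y \in s -> S y) -> S x.
Definition noetherian := forall S, submod S ->
  exists s, (forall y, y \in s -> S y) /\ forall x, S x -> lspan s x.

Lemma submodD S x y : submod S -> S x -> S y -> S (x + y).
Proof. by move=> [_ h] hx hy; rewrite -[x]scale1r; exact: h. Qed.
Lemma submodZ S a x : submod S -> S x -> S (a *: x).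
Proof. by move=> [h0 h] hx; rewrite -[_ *: _]addr0; exact: h. Qed.
Lemma submodB S x y : submod S -> S x -> S y -> S (x - y).
Proof. by move=> h hx hy; apply: submodD => //; rewrite -scaleN1r; exact: submodZ. Qed.
Lemma submod_sum S I (r : seq I) (Q : pred I) (F : I -> V) : submod S ->
  (forall i, Q i -> S (F i)) -> S (\sum_(i <- r | Q i) F i).
Proof.
by move=> h hF; elim/big_ind: _ => //; [case: h | move=> x y; exact: submodD].
Qed.

Lemma lspan_submod s : submod (lspan s).
Proof.
split=> [S [] //|a x y hx hy S hS hs].
by have [_ h] := hS; apply: h; [exact: hx | exact: hy].
Qed.
Lemma lspan_mem s x : x \in s -> lspan s x.
Proof. by move=> xs S _; exact. Qed.
End Noetherian.

(** Hilbert's argument: the ideals [L n] of the leading coefficients in degree [n]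
    increase to the ideal [La], which they reach at some [N]; lifts of generators of
    [L 0], ..., [L N] generate [I]. *)
Lemma poly_noetherian (R : comNzRingType) :
  noetherian R^o -> noetherian {poly R}^o.
Proof.
move=> hR I hI.
pose L n (c : R^o) := exists p : {poly R}, [/\ I p, (size p <= n.+1)%N & p`_n = c].
have hL n : submod (L n).
  split=> [|a _ _ [p [ip sp <-]] [q [iq sq <-]]].
    by exists 0; rewrite size_poly0 coef0; split=> //; case: hI.
  exists (a *: p + q); split; last by rewrite coefD coefZ.
    by rewrite -mul_polyC; case: hI => _; apply.
  rewrite (leq_trans (size_polyD _ _)) // geq_max sq andbT.
  exact: leq_trans (size_scale_leq _ _) sp.
have LS n c : L n c -> L n.+1 c.
  move=> [p [ip sp <-]]; exists ('X * p); split; first exact: (submodZ 'X hI ip).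
    by rewrite -commr_polyX (leq_trans (size_polyMleq _ _)) // size_polyX; lia.
  by rewrite coefXM.
have Lle m n c : (m <= n)%N -> L m c -> L n c.
  by move=> /subnK <-; elim: (n - m)%N => [//|k IH] /IH /LS.
pose La c := exists n, L n c.
have hLa : submod La.
  split=> [|a x y [m hx] [n hy]]; first by exists 0%N; case: (hL 0%N).
  exists (maxn m n); have [_ h] := hL (maxn m n).
  by apply: h; [apply: Lle hx | apply: Lle hy]; rewrite ?leq_maxl ?leq_maxr.
have [s [hs gs]] := hR La hLa.
have [N hN] : exists N, forall c, c \in s -> L N c.
  elim: (s) hs => [|c t IH] ht; first by exists 0%N.
  have [|N hN] := IH; first by move=> y yt; apply: ht; rewrite inE yt orbT.
  have [n hn] := ht c (mem_head _ _); exists (maxn n N) => y; rewrite inE.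
  move=> /orP[/eqP ->|/hN h]; first by apply: Lle hn; rewrite leq_maxl.
  by apply: Lle h; rewrite leq_maxr.
have LN n c : L n c -> L (minn n N) c.
  move=> h; have [nN|nN] := leqP n N; first by [].
  have : La c by exists n.
  by move=> /gs h'; exact: (h' (L N) (hL N) hN).
have [t ht] := choice (fun n => hR (L n) (hL n)).
have /choice [g hg] : forall nc : nat * R^o, exists p : {poly R}, L nc.1 nc.2 ->
    [/\ I p, (size p <= nc.1.+1)%N & p`_nc.1 = nc.2].
  move=> [n c] /=; have [[p hp]|h] := pselect (L n c); first by exists p.
  by exists 0.
pose G : seq {poly R}^o := flatten [seq [seq g (n, c) | c <- t n] | n <- iota 0 N.+1].
exists G; split=> [p /flatten_mapP [n _ /mapP [c ct ->]]|].
  by have [] := hg (n, c) ((ht n).1 c ct).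
have hG := lspan_submod G.
pose Q n (c : R^o) := exists q : {poly R}, [/\ lspan G q, (size q <= n.+1)%N & q`_n = c].
have lift n c : (n <= N)%N -> L n c -> Q n c.
  move=> nN /((ht n).2 c) h; apply: (h (Q n)).
    split=> [|a _ _ [p [ip sp <-]] [q [iq sq <-]]].
      by exists 0; rewrite size_poly0 coef0; split=> //; case: hG.
    exists (a *: p + q); split; last by rewrite coefD coefZ.
      by rewrite -mul_polyC; case: hG => _; apply.
    rewrite (leq_trans (size_polyD _ _)) // geq_max sq andbT.
    exact: leq_trans (size_scale_leq _ _) sp.
  move=> y yt; have [_ sy ey] := hg (n, y) ((ht n).1 y yt).
  exists (g (n, y)); split=> //; apply: lspan_mem; apply/flatten_mapP.
  by exists n; [rewrite mem_iota | exact: map_f].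
move=> p; move: {2}(size p) (leqnn (size p)) => n.
elim: n p => [|n IH] p sp ip.
  by move: sp; rewrite leqn0 size_poly_eq0 => /eqP ->; case: hG.
have Lp : L (minn n N) p`_n by apply: LN; exists p.
have [q [hq sq eq]] := lift _ _ (geq_minr _ _) Lp.
pose r : {poly R} := 'X^(n - minn n N) * q.
have lr : lspan G r by exact: (submodZ 'X^(n - minn n N) hG hq).
rewrite -[p](subrK r); apply: (submodD hG) => //; apply: IH; last first.
  apply: (submodB hI ip); apply: (lr I hI) => y /flatten_mapP [k _ /mapP [c ct ->]].
  by have [] := hg (k, c) ((ht k).1 c ct).
apply/leq_sizeP => j nj; rewrite coefB /r coefXnM.
have -> : (j < n - minn n N)%N = false by lia.
have [e|ne] := eqVneq j n.
  have em : (n - (n - minn n N) = minn n N)%N by lia.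
  by rewrite e em eq subrr.
rewrite !nth_default ?subrr //; last by apply: leq_trans sp _; lia.
by apply: leq_trans sq _; lia.
Qed.

(** The first coordinates of [S] form an ideal, and the members of [S] without first
    coordinate a module of shorter rows. *)
Lemma row_noetherian (R : comNzRingType) r : noetherian R^o -> noetherian 'rV[R]_r.
Proof.
move=> hR; elim: r => [|r IH] S hS.
  by exists [::]; split=> // x _; rewrite [x]thinmx0; case: (lspan_submod (V := 'rV[R]_0) [::]).
pose L (c : R^o) := exists2 v, S v & v 0 0 = c.
have hL : submod L.
  split=> [|a _ _ [v sv <-] [w sw <-]]; first by exists 0; rewrite ?mxE //; case: hS.
  by exists (a *: v + w); rewrite ?mxE //; case: hS => _; apply.
pose E (w : 'rV[R]_r) : 'rV[R]_r.+1 := row_mx (0 : 'rV_1) w.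
have E0 : E 0 = 0 by rewrite /E row_mx0.
have ED a v w : a *: E v + E w = E (a *: v + w).
  have := add_row_mx (a *: (0 : 'rV_1)) (a *: v) 0 w.
  by rewrite -scale_row_mx scaler0 addr0.
pose S0 (w : 'rV[R]_r) := S (E w).
have hS0 : submod S0.
  split=> [|a v w hv hw]; first by rewrite /S0 E0; case: hS.
  have [_ h] := hS; have := h a _ _ hv hw.
  by rewrite ED.
have [s [hs gs]] := hR L hL; have [t [ht gt]] := IH S0 hS0.
have /choice [g hg] : forall c : R^o, exists v, L c -> S v /\ v 0 0 = c.
  move=> c; have [[v hv]|h] := pselect (L c); first by exists v.
  by exists 0.
pose G := [seq g c | c <- s] ++ [seq E w | w <- t].
have hGS y : y \in G -> S y.
  rewrite mem_cat => /orP[/mapP [c /hs /hg [h _] ->] //|/mapP [w /ht h ->]].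
  exact: h.
exists G; split=> // x Sx; have hG := lspan_submod G.
pose Q (c : R^o) := exists2 v, lspan G v & v 0 0 = c.
have [v hv ev] : Q (x 0 0).
  have /gs h : L (x 0 0) by exists x.
  apply: (h Q).
    split=> [|a _ _ [v sv <-] [w sw <-]]; first by exists 0; rewrite ?mxE //; case: hG.
    by exists (a *: v + w); rewrite ?mxE //; case: hG => _; apply.
  move=> c cs; have [_ e] := hg c (hs c cs); exists (g c) => //.
  by apply: lspan_mem; rewrite mem_cat map_f.
have Sv : S v by apply: hv.
rewrite -[x](subrK v); apply: (submodD hG) => //.
have {Sx Sv hv} Sxv : S (x - v) by exact: (submodB hS).
have e0 : x - v = E (rsubmx (x - v : 'rV_(1 + r))).
  rewrite -[LHS](hsubmxK (x - v : 'rV_(1 + r))); suff -> : lsubmx (x - v : 'rV_(1 + r)) = 0 by [].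
  apply/rowP => i; rewrite ord1 mxE [RHS]mxE.
  have -> : lshift r (0 : 'I_1) = 0 :> 'I_(1 + r) by apply: val_inj.
  by rewrite !mxE ev subrr.
have : S0 (rsubmx (x - v : 'rV_(1 + r))) by rewrite /S0 -e0.
have hE : submod (fun w => lspan G (E w)).
  split=> [|a v' w' h1 h2]; first by rewrite E0; case: hG.
  by have [_ h] := hG; have := h a _ _ h1 h2; rewrite ED.
move=> /gt h; rewrite e0; apply: (h _ hE) => w wt.
by apply: lspan_mem; rewrite mem_cat map_f ?orbT.
Qed.

Section Transfer.
Variables (R S : idomainType) (phi : {rmorphism R -> S}).
Hypothesis hphi : bijective phi.

Lemma rdvd_bij a b : rdvd (phi a) (phi b) <-> rdvd a b.
Proof.
have [psi K1 K2] := hphi; split=> [[c e]|[c ->]]; last by exists (phi c); rewrite rmorphM.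
by exists (psi c); apply: (can_inj K1); rewrite rmorphM K2.
Qed.

Lemma unit_bij a : (phi a \is a GRing.unit) = (a \is a GRing.unit).
Proof.
have [psi K1 K2] := hphi; apply/idP/idP; last exact: rmorph_unit.
move=> h; apply/unitrP; exists (psi (phi a)^-1).
by split; apply: (can_inj K1); rewrite rmorphM K2 rmorph1 ?mulVr ?divrr.
Qed.

Lemma prime_bij a : prime_elt (phi a) -> prime_elt a.
Proof.
move=> [a0 nu h]; split; first by apply: contraNneq a0 => ->; rewrite rmorph0.
  by rewrite -unit_bij.
by move=> x y /rdvd_bij; rewrite rmorphM => /h [] /rdvd_bij; [left|right].
Qed.

Lemma factorial_bij : factorial_ring S -> factorial_ring R.
Proof.
have [psi K1 K2] := hphi; move=> hS a a0.
have [|n [u [s [hu sn hs e]]]] := hS (phi a).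
  by apply: contraNneq a0 => h; apply/eqP/(can_inj K1); rewrite h rmorph0.
exists n, (psi u), (map psi s); split; rewrite ?size_map //.
- by rewrite -unit_bij K2.
- by move=> p /mapP [q /hs hq ->]; apply: prime_bij; rewrite K2.
- apply: (can_inj K1); rewrite e rmorphM K2 big_map rmorph_prod; congr (_ * _).
  by apply: eq_bigr => q _; rewrite K2.
Qed.

Lemma noetherian_bij : noetherian S^o -> noetherian R^o.
Proof.
have [psi K1 K2] := hphi; move=> hS I hI.
have psiM x y : psi (x * y) = psi x * psi y.
  by apply: (can_inj K1); rewrite rmorphM !K2.
have psiD x y : psi (x + y) = psi x + psi y.
  by apply: (can_inj K1); rewrite rmorphD !K2.
have psi0 : psi 0 = 0 by apply: (can_inj K1); rewrite K2 rmorph0.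
have hJ : submod (fun y : S^o => I (psi y)).
  split=> [|a x y hx hy]; first by rewrite psi0; case: hI.
  by rewrite psiD psiM; case: hI => _; apply.
have [s [hs gs]] := hS _ hJ; exists (map psi s); split.
  by move=> y /mapP [z /hs h ->].
move=> x Ix; have : I (psi (phi x)) by rewrite K1.
move=> /gs h T hT sT.
have hT' : submod (fun y : S^o => T (psi y)).
  split=> [|a y z hy hz]; first by rewrite psi0; case: hT.
  by rewrite psiD psiM; case: hT => _; apply.
by rewrite -[x]K1; apply: (h _ hT') => y ys; apply: sT; rewrite map_f.
Qed.
End Transfer.

Lemma mpoly_morph_eq n (R : comNzRingType) (S : comNzRingType)
    (f g : {rmorphism {mpoly R[n]} -> S}) :
  (forall c, f c%:MP = g c%:MP) -> (forall i, f 'X_i = g 'X_i) -> f =1 g.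
Proof.
move=> hC hX p; rewrite [p]mpolyE !rmorph_sum; apply: eq_bigr => m _.
rewrite -mul_mpolyC !rmorphM /= hC mpolyXE_id !rmorph_prod; congr (_ * _).
by apply: eq_bigr => i _; rewrite !rmorphXn /= hX.
Qed.

Section MpolyInduction.
Variable K : fieldType.

(** Polynomials in [n.+1] variables are univariate polynomials over those in [n]
    variables; factoriality and the noetherian property climb along this map. *)
Lemma muni_bij n : bijective (@muni n K).
Proof.
pose w : {rmorphism {mpoly K[n]} -> {mpoly K[n.+1]}} :=
  comp_mpoly [tuple 'X_(widen_ord (leqnSn n) i) | i < n].
pose h : {rmorphism {poly {mpoly K[n]}} -> {mpoly K[n.+1]}} :=
  horner_eval ('X_ord_max : {mpoly K[n.+1]}) \o map_poly w.
have X1 : muni ('X_ord_max : {mpoly K[n.+1]}) = 'X.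
  rewrite muniE msuppX big_seq1 mcoeffX eqxx scale1r mnmE eqxx expr1.
  rewrite (_ : [multinom _ | i < n] = 0%MM) ?mpolyX0 ?scale1r //.
  apply/mnmP => i; rewrite !mnmE; case: eqP => // /(congr1 val) /= e.
  by have := ltn_ord i; rewrite -e ltnn.
have X2 i : muni ('X_(widen_ord (leqnSn n) i) : {mpoly K[n.+1]}) = ('X_i)%:P.
  rewrite muniE msuppX big_seq1 mcoeffX eqxx scale1r mnmE.
  rewrite (_ : (_ == ord_max) = false); last first.
    by apply/eqP => /(congr1 val) /= e; have := ltn_ord i; rewrite e ltnn.
  rewrite expr0 (_ : [multinom _ | i < n] = U_(i)%MM) ?alg_polyC //.
  by apply/mnmP => j; rewrite !mnmE.
have wX i : w 'X_i = 'X_(widen_ord (leqnSn n) i).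
  by rewrite /w /= comp_mpolyXU -tnth_nth tnth_mktuple.
have hX : h 'X = 'X_ord_max by rewrite /h /= map_polyX /horner_eval hornerX.
have hC c : h c%:P = w c by rewrite /h /= map_polyC /horner_eval hornerC.
have wC0 c : w c%:MP = c%:MP by rewrite /w /= comp_mpolyC.
clearbody h; clearbody w; exists h => [p|q].
  apply: (@mpoly_morph_eq n.+1 K {mpoly K[n.+1]} (h \o @muni n K) idfun _ _ p) => [c|i] /=.
    by rewrite muniC hC wC0.
  case: (unliftP ord_max i) => [j ->|->]; last by rewrite X1 hX.
  have -> : lift ord_max j = widen_ord (leqnSn n) j.
    by apply: val_inj; rewrite /= /bump leqNgt ltn_ord.
  by rewrite X2 hC wX.
have wC c : muni (w c) = c%:P.
  apply: (@mpoly_morph_eq n K {poly {mpoly K[n]}} (@muni n K \o w) polyC _ _ c) => [d|i] /=.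
    by rewrite wC0 muniC.
  by rewrite wX X2.
rewrite -[q in RHS]coefK poly_def -{1}[q]coefK poly_def !rmorph_sum /=.
apply: eq_bigr => i _; rewrite -mul_polyC !rmorphM /= hC wC !rmorphXn /=.
by rewrite hX X1.
Qed.

Lemma mpoly0_unit (a : {mpoly K[0]}) : a != 0 -> a \is a GRing.unit.
Proof.
have e : a = (a@_0)%:MP.
  apply/mpolyP => m; rewrite mcoeffC (_ : m = 0%MM) ?eqxx ?mulr1 //.
  by apply/mnmP; case.
rewrite e => a0; apply: rmorph_unit; rewrite unitfE.
by apply: contraNneq a0 => ->.
Qed.

Lemma mpoly_factorial n : factorial_ring {mpoly K[n]}.
Proof.
elim: n => [|n IH]; last exact: factorial_bij (muni_bij n) (poly_factorial IH).
by move=> a /mpoly0_unit ha; exists 0%N; exact: factored_unit.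
Qed.

(** Hilbert's basis theorem. *)
Lemma mpoly_noetherian n : noetherian {mpoly K[n]}^o.
Proof.
elim: n => [|n IH]; last exact: noetherian_bij (muni_bij n) (poly_noetherian IH).
move=> I hI; case: (pselect (exists2 a, I a & a != 0)) => [[a Ia a0]|h].
  exists [:: a]; split=> [y|x _ S hS h]; first by rewrite inE => /eqP ->.
  rewrite (_ : x = (x * a^-1) *: a); last by rewrite /GRing.scale /= mulrVK ?mpoly0_unit.
  by apply: submodZ => //; apply: h; rewrite mem_head.
exists [::]; split=> // x Ix S [S0 _] _.
have -> : x = 0 by apply/eqP/negP => /negP x0; apply: h; exists x.
exact: S0.
Qed.
End MpolyInduction.

(** * Primitive families and the grading *)
Section Primitive.
Variables (R : idomainType) (n : nat).

Definition primitive_family (a : 'I_n -> R) :=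
  forall g, (forall i, rdvd g (a i)) -> g \is a GRing.unit.

(** A prime of [q] divides [p], since it would otherwise divide all the [a i]; the
    same argument applies to the quotients. *)
Lemma primitive_dvd (a : 'I_n -> R) p q : factorial_ring R -> primitive_family a ->
  (forall i, rdvd q (p * a i)) -> rdvd q p.
Proof.
move=> hR ha; have [->|q0] := eqVneq q 0.
  move=> h; have [->|p0] := eqVneq p 0; first exact: rdvdd.
  have := unitr0 R; rewrite ha // => i; have [c] := h i.
  by rewrite mulr0 => /eqP; rewrite mulf_eq0 (negbTE p0) => /eqP ->; exact: rdvd0.
have [m [u [s [hu _ hs ->]]]] := hR q q0.
elim: s p hs => [|r s IH] p hs.
  by rewrite big_nil mulr1 => _; exists (p * u^-1); rewrite mulrVK.
rewrite big_cons /= => h; have hr := hs r (mem_head _ _).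
have [r0 nr hP] := hr.
have [|i|p' ep] := IH p; first by move=> x xs; apply: hs; rewrite inE xs orbT.
  by have [c ->] := h i; exists (c * r); ring.
have [p'' ep'] : rdvd r p'; last by exists p''; rewrite ep ep'; ring.
have t0 : u * \prod_(j <- s) j != 0.
  rewrite mulf_neq0 //; first by apply: contraTneq hu => ->; rewrite unitr0.
  rewrite big_seq; elim/big_ind: _ => [|x y|x xs]; rewrite ?oner_eq0 //.
    exact: mulf_neq0.
  by have [] : prime_elt x by apply: hs; rewrite inE xs orbT.
apply: contrapT => np; have := nr; rewrite ha // => i.
have : rdvd r (p' * a i).
  have [c e] := h i; exists c; apply: (mulfI t0).
  by transitivity (p * a i); [rewrite ep|rewrite e]; ring.
by case/hP.
Qed.
End Primitive.

Section Graded.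
Variables (n : nat) (K : fieldType).
Local Notation P := {mpoly K[n]}.
Implicit Types (a b p q : P) (s t k e : nat).

Lemma mcoeff_pihomog d p m : (pihomog mdeg d p)@_m = if mdeg m == d then p@_m else 0.
Proof.
pose k := (maxn (msize p) (mdeg m).+1).
rewrite {2}[p](@mpolywE _ _ k) ?leq_maxl // (pihomogwE _ _ (k := k)) ?leq_maxl //.
rewrite !linear_sum /=.
have hm : (mdeg m < k)%N by rewrite leq_maxr.
rewrite big_mkcond /=.
under eq_bigr => i _ do rewrite linearZ /= mcoeffX.
rewrite (bigD1 (BMultinom hm)) //= eqxx mulr1 big1 ?addr0 => [|i im]; last first.
  case: ifP => // _; rewrite (_ : bmnm i == m = false) ?mulr0 //.
  by apply/negP => /eqP e; case/eqP: im; apply/val_inj.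
case: ifP => // _; under eq_bigr => i _ do rewrite linearZ /= mcoeffX.
rewrite (bigD1 (BMultinom hm)) //= eqxx mulr1 big1 ?addr0 => [//|i im].
rewrite (_ : bmnm i == m = false) ?mulr0 //.
by apply/negP => /eqP e; case/eqP: im; apply/val_inj.
Qed.

(** The degree [k] part of the twist [P(-s)]: polynomials of degree [k - s], which
    is [0] when [k < s]. Stated without subtraction, homogeneous matrix entries
    compose like arrows [t -> s -> k]. *)
Definition whomog s k p := forall m, p@_m != 0 -> (mdeg m + s = k)%N.
Definition wpart s k p := if (s <= k)%N then pihomog mdeg (k - s) p else 0.

Lemma mcoeff_wpart s k p m : (wpart s k p)@_m = if (mdeg m + s == k)%N then p@_m else 0.
Proof.
rewrite /wpart; case: leqP => h; rewrite ?mcoeff_pihomog ?mcoeff0.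
  by rewrite -(eqn_add2r s) subnK.
by case: eqP => // e; lia.
Qed.

Lemma whomog0 k p : whomog 0 k p <-> p \is k.-homog.
Proof.
split=> [h|/dhomogP h m pm]; last by rewrite addn0 h // mcoeff_msupp.
by apply/dhomogP => m; rewrite mcoeff_msupp => /h; rewrite addn0.
Qed.

Lemma whomog_shift s k e p : whomog (s + e) (k + e) p <-> whomog s k p.
Proof. by split=> h m /h; lia. Qed.

Lemma wpart_shift s k e p : wpart (s + e) (k + e) p = wpart s k p.
Proof. by apply/mpolyP => m; rewrite !mcoeff_wpart addnA eqn_add2r. Qed.

Lemma whomog_zero s k : whomog s k 0.
Proof. by move=> m; rewrite mcoeff0 eqxx. Qed.

Lemma whomogP s k p : reflect (whomog s k p) (wpart s k p == p).
Proof.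
apply: (iffP eqP) => [<- m|h]; first by rewrite mcoeff_wpart; case: ifP => [/eqP|_]; rewrite ?eqxx.
apply/mpolyP => m; rewrite mcoeff_wpart; case: eqP => // ne.
by apply/esym/eqP; apply: contraT => /h.
Qed.

Fact wpart_is_linear s k : linear (wpart s k).
Proof.
move=> c p q; apply/mpolyP => m; rewrite mcoeffD mcoeffZ !mcoeff_wpart.
by case: ifP => _; rewrite ?mulr0 ?addr0 // mcoeffD mcoeffZ.
Qed.
HB.instance Definition _ s k :=
  GRing.isLinear.Build K P P _ (wpart s k) (@wpart_is_linear s k).

Lemma wpart_id s k p : whomog s k p -> wpart s k p = p.
Proof. by move/whomogP/eqP. Qed.

Lemma wpart_whomog s k p : whomog s k (wpart s k p).
Proof. by move=> m; rewrite mcoeff_wpart; case: ifP => [/eqP|_]; rewrite ?eqxx. Qed.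

Lemma wpart_ne s j k p : j != k -> whomog s j p -> wpart s k p = 0.
Proof.
move=> jk h; apply/mpolyP => m; rewrite mcoeff_wpart mcoeff0; case: eqP => // e.
apply/eqP; apply: contraT => /h e'; case/eqP: jk; lia.
Qed.

Lemma wpart0E k p : wpart 0 k p = pihomog mdeg k p.
Proof. by rewrite /wpart subn0. Qed.

Lemma whomogD s k p q : whomog s k p -> whomog s k q -> whomog s k (p + q).
Proof. by move=> /wpart_id <- /wpart_id <-; rewrite -raddfD; exact: wpart_whomog. Qed.

Lemma whomogN s k p : whomog s k p -> whomog s k (- p).
Proof. by move=> /wpart_id <-; rewrite -raddfN; exact: wpart_whomog. Qed.

Lemma whomogB s k p q : whomog s k p -> whomog s k q -> whomog s k (p - q).
Proof. by move=> hp /whomogN; exact: whomogD. Qed.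

Lemma whomog_sum s k I (r : seq I) (Q : pred I) (F : I -> P) :
  (forall i, Q i -> whomog s k (F i)) -> whomog s k (\sum_(i <- r | Q i) F i).
Proof.
by move=> h; elim/big_ind: _ => //; [exact: whomog_zero | move=> x y; exact: whomogD].
Qed.

Lemma whomogM s t k p q : whomog s k p -> whomog t s q -> whomog t k (p * q).
Proof.
move=> hp hq; have [->|p0] := eqVneq p 0; first by rewrite mul0r; exact: whomog_zero.
have [->|q0] := eqVneq q 0; first by rewrite mulr0; exact: whomog_zero.
have hp' : p \is (k - s).-homog.
  by apply/dhomogP => m; rewrite mcoeff_msupp => /hp <-; rewrite addnK.
have hq' : q \is (s - t).-homog.
  by apply/dhomogP => m; rewrite mcoeff_msupp => /hq <-; rewrite addnK.
have sk : (s <= k)%N.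
  by have := hp (mlead p); rewrite mleadc_eq0 p0 => /(_ isT); lia.
have ts : (t <= s)%N.
  by have := hq (mlead q); rewrite mleadc_eq0 q0 => /(_ isT); lia.
move=> m; rewrite -mcoeff_msupp => /(dhomog_mf (dhomogM hp' hq')) ->; lia.
Qed.

Lemma wpart_sum s p : exists N, forall N', (N <= N')%N -> p = \sum_(k < N') wpart s k p.
Proof.
exists (msize p + s)%N => N' hN; apply/mpolyP => m; rewrite raddf_sum /=.
under eq_bigr => k _ do rewrite mcoeff_wpart.
have [mN|mN] := ltnP (mdeg m + s) N'.
  rewrite (bigD1 (Ordinal mN)) //= eqxx big1 ?addr0 // => k km.
  by case: eqP => // e; case/eqP: km; apply: val_inj.
rewrite big1 => [|k _]; first by apply: memN_msupp_eq0; apply: msize_mdeg_ge; lia.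
by case: eqP => // e; have := ltn_ord k; lia.
Qed.

Lemma wpartM s t k p q : whomog t s q -> wpart t k (p * q) = wpart s k p * q.
Proof.
move=> hq; have [N hN] := wpart_sum s p.
rewrite {1}(hN (maxn N k.+1)) ?leq_maxl // mulr_suml raddf_sum /=.
have hk : (k < maxn N k.+1)%N by rewrite leq_maxr.
rewrite (bigD1 (Ordinal hk)) //= big1 ?addr0.
  by apply/wpart_id/whomogM/hq; exact: wpart_whomog.
move=> j jk; apply: (@wpart_ne _ j); last by apply/whomogM/hq; exact: wpart_whomog.
by apply: contraNneq jk => e; apply/eqP/val_inj.
Qed.

Lemma whomog_const s p : whomog s s p -> p = (p@_0)%:MP.
Proof.
move=> h; apply/mpolyP => m; rewrite mcoeffC; case: eqP => [<-|ne]; rewrite ?mulr1 //.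
rewrite mulr0; apply/eqP; apply: contraT => /h e; case: ne; apply/eqP.
by rewrite -mdeg_eq0; lia.
Qed.

Lemma mcoeff0_wpart s k p : (wpart s k p)@_0 = if s == k then p@_0 else 0.
Proof. by rewrite mcoeff_wpart mdeg0. Qed.

(** The parts of extremal degree multiply; with [op] the relation [geq] they are
    those of lowest degree, with [leq] those of highest degree. *)
Lemma pihomog_extremal (op : rel nat) a b i j :
  (forall x y z w, op x y -> op z w -> (x + z = y + w)%N -> x = y) ->
  (forall k, pihomog mdeg k a != 0 -> op k i) ->
  (forall k, pihomog mdeg k b != 0 -> op k j) ->
  pihomog mdeg (i + j) (a * b) = pihomog mdeg i a * pihomog mdeg j b.
Proof.
move=> hop ha hb.
have term (p q : P) k l : p \is k.-homog -> q \is l.-homog ->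
    pihomog mdeg (i + j) (p * q) = if (k + l == i + j)%N then p * q else 0.
  move=> hp hq; have hpq := dhomogM hp hq.
  by case: eqP => [<-|/eqP ne]; [exact: pihomog_dE | exact: pihomog_ne0 ne hpq].
have [N1 h1] := wpart_sum 0 a; have [N2 h2] := wpart_sum 0 b.
pose N := maxn (maxn N1 N2) (i + j).+1.
have ea : a = \sum_(k < N) wpart 0 k a by apply: h1; lia.
have eb : b = \sum_(k < N) wpart 0 k b by apply: h2; lia.
rewrite [in LHS]ea [in LHS]eb mulr_suml raddf_sum /=.
under eq_bigr => k _ do rewrite mulr_sumr raddf_sum /=.
under eq_bigr => k _ do under eq_bigr => l _ do
  rewrite !wpart0E (term _ _ k l (pihomogP _ _ _) (pihomogP _ _ _)).
have hi : (i < N)%N by lia. have hj : (j < N)%N by lia.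
have van (k l : 'I_N) : (k : nat, l : nat) != (i, j) ->
    (if (k + l == i + j)%N then pihomog mdeg k a * pihomog mdeg l b else 0) = 0.
  move=> ne; case: eqP => // e.
  have [->|ak] := eqVneq (pihomog mdeg k a) 0; first by rewrite mul0r.
  have [->|bl] := eqVneq (pihomog mdeg l b) 0; first by rewrite mulr0.
  have ki := hop _ _ _ _ (ha _ ak) (hb _ bl) e.
  by case/eqP: ne; rewrite ki; congr (_, _); lia.
rewrite (bigD1 (Ordinal hi)) //= (bigD1 (Ordinal hj)) //= eqxx.
rewrite !big1 ?addr0 // => [k ki|k ki]; first (apply: big1 => l _).
  by apply: van; rewrite xpair_eqE negb_and; apply/orP; left; apply: contraNneq ki => e; apply/eqP/val_inj.
by apply: (van (Ordinal hi) k); rewrite xpair_eqE negb_and; apply/orP; right; apply: contraNneq ki => e; apply/eqP/val_inj.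
Qed.

(** The lowest and the highest homogeneous parts of the factors multiply to those
    of the product, which coincide. *)
Lemma homog_factor d a b : a * b != 0 -> a * b \is d.-homog -> exists e, a \is e.-homog.
Proof.
rewrite mulf_eq0 negb_or => /andP[a0 b0] hab.
have range p : p != 0 -> exists i j, [/\ pihomog mdeg i p != 0, pihomog mdeg j p != 0 &
    forall k, pihomog mdeg k p != 0 -> (i <= k <= j)%N].
  move=> p0; have ex : exists k, pihomog mdeg k p != 0.
    apply/not_existsP => h; case/eqP: p0; have [N hN] := wpart_sum 0 p.
    rewrite (hN N) // big1 // => k _; rewrite wpart0E.
    by apply/eqP; apply: contraT => /h.
  have bd k : pihomog mdeg k p != 0 -> (k <= msize p)%N.
    apply: contraNT => kp; apply/eqP/mpolyP => m; rewrite mcoeff_pihomog mcoeff0.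
    case: eqP => // e; apply: memN_msupp_eq0; apply: msize_mdeg_ge; lia.
  case: (ex_minnP ex) => i hi li; case: (ex_maxnP ex bd) => j hj lj.
  by exists i, j; split=> // k hk; rewrite li // lj.
have [i [j [ai aj ra]]] := range a a0; have [k [l [bk bl rb]]] := range b b0.
have deg x y : pihomog mdeg x a != 0 -> pihomog mdeg y b != 0 ->
    pihomog mdeg (x + y) (a * b) = pihomog mdeg x a * pihomog mdeg y b -> (x + y = d)%N.
  move=> ax bY e; apply/eqP; apply: contraT; rewrite eq_sym => ne.
  by have := pihomog_ne0 ne hab; rewrite e => /eqP; rewrite mulf_eq0 (negbTE ax) (negbTE bY).
have e1 : (i + k = d)%N.
  apply: deg => //; apply: (@pihomog_extremal geq) => [x y z w| |] /=; first by lia.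
    by move=> x /ra/andP[].
  by move=> x /rb/andP[].
have e2 : (j + l = d)%N.
  apply: deg => //; apply: (@pihomog_extremal leq) => [x y z w| |] /=; first by lia.
    by move=> x /ra/andP[].
  by move=> x /rb/andP[].
have /andP[ij _] := ra _ aj; have /andP[kl _] := rb _ bl.
exists i; apply/whomog0 => m am; rewrite addn0.
have := ra (mdeg m); suff -> : pihomog mdeg (mdeg m) a != 0 by move=> /(_ isT); lia.
by apply: contraNneq am => /(congr1 (mcoeff m)); rewrite mcoeff_pihomog eqxx mcoeff0 => ->.
Qed.
End Graded.

(** * Koszul complexes of powers of the variables *)
Section MonomialIdeals.
Variables (n : nat) (K : fieldType) (N : nat).
Local Notation P := {mpoly K[n]}.
Implicit Types (D : pred 'I_n) (p : P).

(** Membership in the ideal of the [N]-th powers of the variables in [D], read off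
    from the monomials. *)
Definition in_mono D p := forall m, p@_m != 0 -> exists2 i, D i & (N <= m i)%N.

Lemma mcoeff_mulXn i p m :
  ('X_i ^+ N * p)@_m = if (N <= m i)%N then p@_(m - U_(i) *+ N)%MM else 0.
Proof.
rewrite mpolyXn; case: ifP => h; last first.
  rewrite mulrC; apply: memN_msupp_eq0; apply: contraFN h => /msuppM_le.
  move=> /allpairsP [[m1 m2] /= [_ + ->]].
  rewrite msuppX inE => /eqP ->.
  by rewrite mnmDE mulmnE mnm1E eqxx mul1n leq_addl.
have {1}-> : m = (U_(i) *+ N + (m - U_(i) *+ N))%MM.
  rewrite addmC submK //; apply/mnm_lepP => j; rewrite mulmnE mnm1E.
  by case: eqP => [<-|_]; rewrite ?mul1n ?mul0n.
by rewrite mulrC mcoeffMX.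
Qed.

Lemma in_mono_mul D i p : D i -> in_mono D ('X_i ^+ N * p).
Proof. by move=> Di m; rewrite mcoeff_mulXn; case: ifP => h; rewrite ?eqxx //; exists i. Qed.

Lemma in_mono_sum D I (r : seq I) (Q : pred I) (F : I -> P) :
  (forall i, Q i -> in_mono D (F i)) -> in_mono D (\sum_(i <- r | Q i) F i).
Proof.
move=> h; elim/big_ind: _ => // [m|p q hp hq m]; first by rewrite mcoeff0 eqxx.
rewrite mcoeffD => pq; have [p0|/hp //] := eqVneq p@_m 0.
by apply: hq; rewrite p0 add0r in pq.
Qed.

Lemma in_monoP D p : in_mono D p ->
  exists a : 'I_n -> P, p = \sum_(i | D i) 'X_i ^+ N * a i.
Proof.
move=> h; have /choice [c hc] : forall m, exists o : option 'I_n,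
    p@_m != 0 -> exists i, [/\ o = Some i, D i & (N <= m i)%N].
  move=> m; have [e|/h [i Di hi]] := eqVneq p@_m 0; first by exists None.
  by exists (Some i) => _; exists i.
exists (fun i => \sum_(m <- msupp p | c m == Some i) p@_m *: 'X_[m - U_(i) *+ N]).
under eq_bigr => i _ do rewrite mulr_sumr big_mkcond.
rewrite exchange_big {1}[p]mpolyE !big_seq; apply: eq_bigr => m.
rewrite mcoeff_msupp => /hc [i [e Di hi]]; rewrite (bigD1 i) //= e eqxx.
rewrite big1 ?addr0 => [|j /andP[_ ji]]; last first.
  by case: eqP => // - [e']; rewrite e' eqxx in ji.
rewrite -scalerAr mpolyXn -mpolyXD addmC submK //; apply/mnm_lepP => j.
by rewrite mulmnE mnm1E; case: eqP => [<-|_]; rewrite ?mul1n ?mul0n.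
Qed.

(** The variables outside [D] are regular modulo the ideal of the powers of the
    variables in [D]. *)
Lemma in_mono_cancel D i p : ~~ D i -> in_mono D ('X_i ^+ N * p) -> in_mono D p.
Proof.
move=> nD h m pm; have := h (m + U_(i) *+ N)%MM.
rewrite mcoeff_mulXn mnmDE mulmnE mnm1E eqxx mul1n leq_addl addmK => /(_ pm) [j Dj].
rewrite mnmDE mulmnE mnm1E; case: eqP => [e|_]; first by rewrite e Dj in nD.
by rewrite mul0n addn0; exists j.
Qed.
End MonomialIdeals.

Lemma mpolyX_neq0 n (K : fieldType) m : 'X_[m] != 0 :> {mpoly K[n]}.
Proof.
apply/eqP => /(congr1 (mcoeff m)); rewrite mcoeffX eqxx mcoeff0.
by apply/eqP; rewrite oner_eq0.
Qed.

Lemma mpolyX_homog n (K : fieldType) (i : 'I_n) : ('X_i : {mpoly K[n]}) \is 1.-homog.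
Proof. by rewrite dhomogX; apply/eqP/mdeg1. Qed.

Lemma Xn_homog n (K : fieldType) (i : 'I_n) k : ('X_i : {mpoly K[n]}) ^+ k \is k.-homog.
Proof. by have := @dhomogMn n K mdeg 1 'X_i k; rewrite mul1n; apply; exact: mpolyX_homog. Qed.
Section Koszul.
Variables (K : fieldType) (N : nat).
Local Notation P := {mpoly K[3]}.

Definition i0 : 'I_3 := ord0.
Definition i1 : 'I_3 := lift ord0 ord0.
Definition i2 : 'I_3 := lift ord0 (lift ord0 ord0).

Lemma big3 (V : nmodType) (F : 'I_3 -> V) : \sum_i F i = F i0 + F i1 + F i2.
Proof. by rewrite !big_ord_recl big_ord0 addr0 addrA. Qed.

Lemma ord3P (Q : 'I_3 -> Prop) : Q i0 -> Q i1 -> Q i2 -> forall i, Q i.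
Proof.
move=> h0 h1 h2 i; case: (unliftP ord0 i) => [j ->|->] //.
case: (unliftP ord0 j) => [k ->|->] //.
by rewrite ord1.
Qed.

Local Notation x i := ('X_i ^+ N : P).

Lemma Xn_neq0 i : x i != 0.
Proof. by rewrite expf_neq0 // mpolyX_neq0. Qed.

Lemma Xn_dvd i j p q : i != j -> x i * p = x j * q -> exists r, p = x j * r.
Proof.
move=> ij e; have : in_mono N (pred1 j) p.
  by apply: (@in_mono_cancel _ _ _ _ i) => //; rewrite e; apply: in_mono_mul; rewrite /= eqxx.
by move=> /in_monoP [a ->]; exists (a j); rewrite big_pred1_eq.
Qed.

(** Exactness of the Koszul complex of [X_0^N, X_1^N, X_2^N] next to its left end. *)
Lemma koszul_glue (g : 'I_3 -> P) : (forall i j, x i * g j = x j * g i) ->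
  exists h, forall i, g i = x i * h.
Proof.
move=> e; have [h eh] := Xn_dvd (isT : i1 != i0) (e i1 i0).
exists h => i; apply: (mulfI (Xn_neq0 i0)).
by rewrite e eh; ring.
Qed.

(** Exactness in the middle: modulo [X_0^N] and [X_1^N] the last variable is regular,
    and modulo [X_1^N] the first one is. *)
Lemma koszul_cycle (u : 'I_3 -> P) : \sum_i x i * u i = 0 ->
  exists v : 'I_3 -> P, [/\ u i0 = x i1 * v i2 - x i2 * v i1,
    u i1 = x i2 * v i0 - x i0 * v i2 & u i2 = x i0 * v i1 - x i1 * v i0].
Proof.
rewrite big3 => e; have : in_mono N (pred2 i0 i1) (u i2).
  apply: (@in_mono_cancel _ _ _ _ i2) => //.
  have -> : x i2 * u i2 = x i0 * - u i0 + x i1 * - u i1.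
    by apply/eqP; rewrite -subr_eq0 -e; apply/eqP; ring.
  rewrite (_ : _ + _ = \sum_(i <- [:: i0; i1]) x i * - u i); last first.
    by rewrite !big_cons big_nil addr0.
  rewrite big_seq; apply: in_mono_sum => i; rewrite !inE => hi; exact: in_mono_mul.
move=> /in_monoP [a]; rewrite (_ : \sum_(i | _) _ = x i0 * a i0 + x i1 * a i1); last first.
  by rewrite big_mkcond big3 /= addr0.
move=> e2; have e3 : x i0 * (u i0 + x i2 * a i0) = x i1 * (- u i1 - x i2 * a i1).
  by apply/eqP; rewrite -subr_eq0 -e e2; apply/eqP; ring.
have [r er] := Xn_dvd (isT : i0 != i1) e3.
exists (fun i => if i == i0 then - a i1 else if i == i1 then a i0 else r) => /=.
split; [|apply: (mulfI (Xn_neq0 i1))|]; last by rewrite e2; ring.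
  by rewrite -er; ring.
have -> : x i1 * u i1 = - (x i1 * (- u i1 - x i2 * a i1)) - x i1 * (x i2 * a i1) by ring.
by rewrite -e3 er; ring.
Qed.

Lemma koszul_glue_row r (g : 'I_3 -> 'rV[P]_r) :
  (forall i j, x i *: g j = x j *: g i) -> exists h, forall i, g i = x i *: h.
Proof.
move=> e; have /choice [h hh] : forall k, exists h, forall i, g i 0 k = x i * h.
  move=> k; apply: (@koszul_glue (fun i => g i 0 k)) => i j.
  by have /rowP/(_ k) := e i j; rewrite !mxE.
by exists (\row_k h k) => i; apply/rowP => k; rewrite !mxE hh.
Qed.

Lemma koszul_cycle_row r (u : 'I_3 -> 'rV[P]_r) : \sum_i x i *: u i = 0 ->
  exists v : 'I_3 -> 'rV[P]_r, [/\ u i0 = x i1 *: v i2 - x i2 *: v i1,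
    u i1 = x i2 *: v i0 - x i0 *: v i2 & u i2 = x i0 *: v i1 - x i1 *: v i0].
Proof.
move=> e; have /choice [v hv] : forall k, exists v : 'I_3 -> P,
   [/\ u i0 0 k = x i1 * v i2 - x i2 * v i1,
    u i1 0 k = x i2 * v i0 - x i0 * v i2 & u i2 0 k = x i0 * v i1 - x i1 * v i0].
  move=> k; apply: (@koszul_cycle (fun i => u i 0 k)).
  have /rowP/(_ k) := e; rewrite summxE mxE => e'; apply: etrans e'.
  by apply: eq_bigr => i _; rewrite mxE.
exists (fun i => \row_k v k i).
by split; apply/rowP => k; rewrite !mxE; have [] := hv k.
Qed.
End Koszul.

Section Maximal.
Variable K : fieldType.
Local Notation P := {mpoly K[3]}.
Implicit Types p : P.

Lemma max_idealP p : p@_0 = 0 -> exists a : 'I_3 -> P, p = \sum_i 'X_i * a i.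
Proof.
move=> p0; suff /in_monoP [a ->] : in_mono 1 predT p.
  by exists a; apply: eq_bigr => i _; rewrite expr1.
move=> m pm; have : m != 0%MM by apply: contraNneq pm => ->; rewrite p0.
rewrite -mdeg_eq0 mdegE => h.
have /existsP [i hi] : [exists i, m i != 0%N].
  apply: contraNT h => /existsPn h; rewrite big1 // => i _.
  by apply/eqP; have := h i; rewrite negbK.
by exists i => //; rewrite lt0n.
Qed.

(** Membership in the [k]-th power of the maximal ideal. *)
Definition mlow k p := forall m, p@_m != 0 -> (k <= mdeg m)%N.

Lemma mlowD k p q : mlow k p -> mlow k q -> mlow k (p + q).
Proof.
move=> hp hq m; rewrite mcoeffD => pq; have [p0|/hp //] := eqVneq p@_m 0.
by apply: hq; rewrite p0 add0r in pq.
Qed.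

Lemma mlowM k l p q : mlow k p -> mlow l q -> mlow (k + l) (p * q).
Proof.
move=> hp hq m; rewrite -mcoeff_msupp => /msuppM_le /allpairsP [[m1 m2] /= [h1 h2 ->]].
by rewrite mdegD leq_add ?hp ?hq // -mcoeff_msupp.
Qed.

Lemma mlow1 p : p@_0 = 0 -> mlow 1 p.
Proof.
move=> p0 m; rewrite lt0n; apply: contraNneq => /eqP; rewrite mdeg_eq0 => /eqP ->.
by rewrite p0.
Qed.

Lemma mlow_eq0 p : (forall k, mlow k p) -> p = 0.
Proof.
move=> h; apply/mpolyP => m; rewrite mcoeff0; apply/eqP; apply: contraT.
by move=> /(h (mdeg m).+1); rewrite ltnn.
Qed.

Lemma common_divisor_X (g : P) : (forall i, rdvd g 'X_i) -> g \is a GRing.unit.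
Proof.
move=> h; have [a ea] := h i0; have [b eb] := h i1.
have [r er] : exists r, a = 'X_i0 ^+ 1 * r.
  apply: (@Xn_dvd _ 1 i1 i0 a b) => //; rewrite !expr1 {1}eb {1}ea; ring.
apply: rdvd_unit (unitr1 _) _; exists r.
have X0 : ('X_i0 : P) != 0 by exact: mpolyX_neq0.
by apply: (mulfI X0); rewrite mulr1 {1}ea er expr1; ring.
Qed.
End Maximal.

(** * Syzygies and homogeneous bases *)
Section Vectors.
Variable K : fieldType.
Local Notation P := {mpoly K[3]}.

Definition dot r (h : 'I_r -> P) (a : 'rV[P]_r) : P := \sum_i a 0 i * h i.

Lemma dotP r (h : 'I_r -> P) c a b : dot h (c *: a + b) = c * dot h a + dot h b.
Proof.
rewrite /dot mulr_sumr -big_split; apply: eq_bigr => i _.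
by rewrite !mxE mulrDl mulrA.
Qed.
Lemma dot0 r (h : 'I_r -> P) : dot h 0 = 0.
Proof. by rewrite /dot big1 // => i _; rewrite mxE mul0r. Qed.
Lemma dotD r (h : 'I_r -> P) a b : dot h (a + b) = dot h a + dot h b.
Proof. by rewrite -[a]scale1r dotP mul1r scale1r. Qed.
Lemma dotZ r (h : 'I_r -> P) c a : dot h (c *: a) = c * dot h a.
Proof. by rewrite -[c *: a]addr0 dotP dot0 addr0. Qed.
Lemma dotB r (h : 'I_r -> P) a b : dot h (a - b) = dot h a - dot h b.
Proof. by rewrite -scaleN1r dotD dotZ mulN1r. Qed.

Definition syz r (h : 'I_r -> P) (a : 'rV[P]_r) : Prop := dot h a = 0.

Lemma syz_submod r (h : 'I_r -> P) : submod (syz h).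
Proof.
split=> [|c a b]; first exact: dot0.
by rewrite /syz dotP => -> ->; rewrite mulr0 addr0.
Qed.

Lemma submod_rsum r (S : 'rV[P]_r -> Prop) I (s : seq I) (Q : pred I) F : submod S ->
  (forall i, Q i -> S (F i)) -> S (\sum_(i <- s | Q i) F i).
Proof. by move=> hS hF; exact: (@submod_sum _ _ S I s Q F hS hF). Qed.

(** Degree [k] vectors of the graded free module with basis in degrees [dg]. *)
Definition vhomog r (dg : 'I_r -> nat) k (v : 'rV[P]_r) :=
  forall i, whomog (dg i) k (v 0 i).
Definition vpart r (dg : 'I_r -> nat) k (v : 'rV[P]_r) : 'rV[P]_r :=
  \row_i wpart (dg i) k (v 0 i).
Definition graded r (dg : 'I_r -> nat) (S : 'rV[P]_r -> Prop) :=
  forall k v, S v -> S (vpart dg k v).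

Section Parts.
Variables (r : nat) (dg : 'I_r -> nat).

Lemma vpart_vhomog k v : vhomog dg k (vpart dg k v).
Proof. by move=> i; rewrite mxE; exact: wpart_whomog. Qed.

Lemma vpart_id k v : vhomog dg k v -> vpart dg k v = v.
Proof. by move=> h; apply/rowP => i; rewrite mxE wpart_id. Qed.

Lemma vpart0 k : vpart dg k 0 = 0.
Proof. by apply/rowP => i; rewrite !mxE raddf0. Qed.

Lemma vpart_sum v : exists N, forall N', (N <= N')%N -> v = \sum_(k < N') vpart dg k v.
Proof.
have /choice [N hN] := fun i => wpart_sum (dg i) (v 0 i).
exists (\max_i N i) => N' hN'; apply/rowP => i; rewrite summxE.
rewrite {1}(hN i _ (leq_trans (leq_bigmax i) hN')); apply: eq_bigr => k _.
by rewrite mxE.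
Qed.

Lemma vpart_mulmx t (c : 'I_t -> nat) (U : 'M[P]_(t, r)) k a :
  (forall j, vhomog dg (c j) (row j U)) ->
  vpart dg k (a *m U) = vpart c k a *m U.
Proof.
move=> hU; apply/rowP => i; rewrite !mxE raddf_sum; apply: eq_bigr => j _ /=.
by rewrite mxE; apply: wpartM; have := hU j i; rewrite mxE.
Qed.
Lemma vpart_of_sum N (c : nat -> 'rV[P]_r) k :
  (forall j, vhomog dg j (c j)) ->
  vpart dg k (\sum_(j < N) c j) = if (k < N)%N then c k else 0.
Proof.
move=> hc; apply/rowP => i; rewrite mxE summxE raddf_sum /=.
have ne (j : 'I_N) : j != k :> nat -> wpart (dg i) k (c j 0 i) = 0.
  by move=> jk; apply: (wpart_ne jk); exact: hc.
case: ltnP => kN; last first.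
  by rewrite mxE big1 // => j _; apply: ne; have := ltn_ord j; lia.
rewrite (bigD1 (Ordinal kN)) //= big1 ?addr0 => [|j jk]; first by apply/wpart_id/hc.
by apply: ne; apply: contraNneq jk => e; apply/eqP/val_inj.
Qed.

Lemma vpart_eq0 (A : 'rV[P]_r) :
  (forall k, vpart dg k A = 0) -> A = 0.
Proof.
move=> h; have [N hN] := vpart_sum A.
by rewrite (hN N) // big1 // => k _; exact: h.
Qed.
End Parts.

Section Generators.
Variables (r : nat) (dg : 'I_r -> nat) (S : 'rV[P]_r -> Prop).
Hypotheses (hS : submod S) (gS : graded dg S).

Definition hgens t (U : 'M[P]_(t, r)) (c : 'I_t -> nat) :=
  [/\ forall j, S (row j U), forall j, vhomog dg (c j) (row j U) &
      forall v, S v -> exists a, v = a *m U].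

Lemma submod_mulmx t (U : 'M[P]_(t, r)) a : (forall j, S (row j U)) -> S (a *m U).
Proof.
move=> hU; rewrite mulmx_sum_row.
by apply: submod_rsum => // j _; exact: submodZ.
Qed.

Lemma exists_hgens : exists t U c, @hgens t U c.
Proof.
have [s [sS gs]] := row_noetherian (@mpoly_noetherian K 3) hS.
have /choice [N hN] := vpart_sum dg.
pose L := flatten [seq [seq (vpart dg k v, k) | k <- iota 0 (N v)] | v <- s].
have hL x : x \in L -> S x.1 /\ vhomog dg x.2 x.1.
  move=> /flatten_mapP [v vs /mapP [k _ ->]] /=; split; last exact: vpart_vhomog.
  exact/gS/sS.
pose U := \matrix_(j < size L) (nth (0, 0%N) L j).1.
have rU j : row j U = (nth (0, 0%N) L j).1 by rewrite rowK.
exists (size L), U, (fun j => (nth (0, 0%N) L j).2).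
split=> [j|j|v]; rewrite ?rU; try by have [] := hL _ (mem_nth (0, 0%N) (ltn_ord j)).
pose T (v : 'rV[P]_r) := exists a, v = a *m U.
have hT : submod T.
  split=> [|a _ _ [x ->] [y ->]]; first by exists 0; rewrite mul0mx.
  by exists (a *: x + y); rewrite mulmxDl scalemxAl.
move=> /gs h; apply: (h T hT) => w ws; rewrite (hN w _ (leqnn _)).
apply: submod_rsum => // k _.
have kL : (vpart dg k w, k : nat) \in L.
  by apply/flatten_mapP; exists w => //; apply/mapP; exists (k : nat); rewrite ?mem_iota ?add0n ?ltn_ord.
have jL : (index (vpart dg k w, k : nat) L < size L)%N by rewrite index_mem.
exists (delta_mx 0 (Ordinal jL)).
by rewrite -rowE rU nth_index.
Qed.

Definition hbasis t (U : 'M[P]_(t, r)) (c : 'I_t -> nat) :=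
  hgens U c /\ forall a : 'rV_t, a *m U = 0 -> a = 0.

Lemma mulmx_drop t (U : 'M[P]_(t.+1, r)) j (b : 'rV_t.+1) :
  b 0 j = 0 -> b *m U = col' j b *m row' j U.
Proof.
move=> bj; apply/rowP => i; rewrite !mxE (bigD1_ord j) //= bj mul0r add0r.
by apply: eq_bigr => k _; rewrite !mxE.
Qed.

(** In a minimal system of homogeneous generators no relation has a coefficient
    with a constant term, since it would express a generator by the others. *)
Lemma minimal_hgens : exists t U c, @hgens t U c /\
  forall a : 'rV_t, a *m U = 0 -> forall j, (a 0 j)@_0 = 0.
Proof.
have ex : exists t, `[< exists U c, @hgens t U c >].
  by have [t [U [c h]]] := exists_hgens; exists t; apply/asboolP; exists U, c.
case: (ex_minnP ex) => t /asboolP [U [c hU]] tmin; exists t, U, c; split=> // a aU j.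
apply/eqP; apply: contraT => aj; exfalso.
have [SU dU gU] := hU.
pose b := vpart c (c j) a.
have bU : b *m U = 0 by rewrite -(vpart_mulmx _ _ dU) aU vpart0.
have bj : b 0 j = ((a 0 j)@_0)%:MP.
  by rewrite (whomog_const (@vpart_vhomog _ c (c j) a j)) mxE mcoeff0_wpart eqxx.
case: t => [|t] in U c hU tmin a aU j aj SU dU gU b bU bj *; first by case: j {aj bj b bU}.
suff /tmin : `[< exists U' c', @hgens t U' c' >] by rewrite ltnn.
apply/asboolP; exists (row' j U), (fun k => c (lift j k)).
have rU k : row k (row' j U) = row (lift j k) U by apply/rowP => i; rewrite !mxE.
split=> [k|k|v]; rewrite ?rU //.
move=> /gU [d ->]; pose e := d - (d 0 j * (((a 0 j)@_0)^-1)%:MP) *: b.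
have -> : d *m U = e *m U by rewrite mulmxBl -scalemxAl bU scaler0 subr0.
exists (col' j e); apply: mulmx_drop; rewrite !mxE -/(b 0 j).
have -> : wpart (c j) (c j) (a 0 j) = ((a 0 j)@_0)%:MP by rewrite -bj mxE.
by rewrite -mulrA -mpolyCM mulVf // mulr1 subrr.
Qed.

(** [Tor_1(S, K) = 0] makes a graded module free: the relations among minimal
    generators lie in [m] times themselves, hence in every power of [m]. *)
Lemma hbasis_of_koszul :
  (forall u : 'I_3 -> 'rV[P]_r, (forall i, S (u i)) -> \sum_i 'X_i *: u i = 0 ->
    exists v : 'I_3 -> 'rV[P]_r, (forall i, S (v i)) /\
    [/\ u i0 = 'X_i1 *: v i2 - 'X_i2 *: v i1,
        u i1 = 'X_i2 *: v i0 - 'X_i0 *: v i2 &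
        u i2 = 'X_i0 *: v i1 - 'X_i1 *: v i0]) ->
  exists t U c, @hbasis t U c.
Proof.
move=> kos; have [t [U [c [hU rel]]]] := minimal_hgens; exists t, U, c; split=> // a aU.
have [SU dU gU] := hU.
suff h k : forall a : 'rV_t, a *m U = 0 -> forall j, mlow k (a 0 j).
  by apply/rowP => j; rewrite mxE; apply: mlow_eq0 => k; exact: h.
elim: k {a aU} => [//|k IH] a aU j.
have /choice [b hb] : forall j, exists b : 'I_3 -> P, a 0 j = \sum_i 'X_i * b i.
  by move=> l; apply: max_idealP; exact: rel.
pose B i := \row_l b l i.
have aB : a = \sum_i 'X_i *: B i.
  by apply/rowP => l; rewrite summxE hb; apply: eq_bigr => i _; rewrite !mxE.
clearbody B.
have [|| v [Sv [v0 v1 v2]]] := kos (fun i => B i *m U).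
- by move=> i; exact: submod_mulmx.
- by apply: etrans aU; rewrite aB mulmx_suml; apply: eq_bigr => i _; rewrite scalemxAl.
have /choice [d hd] : forall i, exists d, v i = d *m U by move=> i; exact: gU.
have E (x y z : 'rV[P]_t) (p q : P) : x *m U = p *: (y *m U) - q *: (z *m U) ->
    forall l, mlow k (x 0 l - (p * y 0 l - q * z 0 l)).
  move=> e l; have -> : x 0 l - (p * y 0 l - q * z 0 l) = (x - (p *: y - q *: z)) 0 l.
    by rewrite !mxE.
  by apply: IH; rewrite !mulmxBl e -!scalemxAl subrr.
have {v0}E0 : forall l, mlow k (B i0 0 l - ('X_i1 * d i2 0 l - 'X_i2 * d i1 0 l)).
  apply: (E (B i0) (d i2) (d i1) 'X_i1 'X_i2).
  rewrite -(hd i2) -(hd i1).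
  exact: v0.
have {v1}E1 : forall l, mlow k (B i1 0 l - ('X_i2 * d i0 0 l - 'X_i0 * d i2 0 l)).
  apply: (E (B i1) (d i0) (d i2) 'X_i2 'X_i0).
  rewrite -(hd i0) -(hd i2).
  exact: v1.
have {v2}E2 : forall l, mlow k (B i2 0 l - ('X_i0 * d i1 0 l - 'X_i1 * d i0 0 l)).
  apply: (E (B i2) (d i1) (d i0) 'X_i0 'X_i1).
  rewrite -(hd i1) -(hd i0).
  exact: v2.
have aBj : a 0 j = 'X_i0 * B i0 0 j + 'X_i1 * B i1 0 j + 'X_i2 * B i2 0 j.
  by rewrite aB summxE big3 !mxE.
have id3 (x y z b0 b1 b2 d0 d1 d2 : P) : x * b0 + y * b1 + z * b2 =
    x * (b0 - (y * d2 - z * d1)) + y * (b1 - (z * d0 - x * d2)) +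
    z * (b2 - (x * d1 - y * d0)) by ring.
rewrite aBj (id3 _ _ _ _ _ _ (d i0 0 j) (d i1 0 j) (d i2 0 j)).
have X1 i : mlow 1 ('X_i : P).
  apply: mlow1; rewrite mcoeffX; case: eqP => // /(congr1 (fun m => mdeg m)).
  by rewrite mdeg1 mdeg0.
rewrite -add1n; apply: mlowD; last exact: mlowM (X1 _) (E2 j).
by apply: mlowD; [exact: mlowM (X1 _) (E0 j) | exact: mlowM (X1 _) (E1 j)].
Qed.
End Generators.
End Vectors.

(** * The cross product *)
Section Cross.
Variable R : comNzRingType.

Lemma rowDE r (A B : 'rV[R]_r) i : (A + B) 0 i = A 0 i + B 0 i.
Proof. by rewrite mxE. Qed.
Lemma rowZE r x (A : 'rV[R]_r) i : (x *: A) 0 i = x * A 0 i.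
Proof. by rewrite mxE. Qed.
Lemma rowBE r (A B : 'rV[R]_r) i : (A - B) 0 i = A 0 i - B 0 i.
Proof. by rewrite !mxE. Qed.

(* locked: coordinates are only computed through [cE], never by conversion *)
Fact cross_key : unit. Proof. exact: tt. Qed.
Definition cross : 'rV[R]_3 -> 'rV[R]_3 -> 'rV[R]_3 := locked_with cross_key
  (fun A B => \row_i
    (if i == i0 then A 0 i1 * B 0 i2 - A 0 i2 * B 0 i1
     else if i == i1 then A 0 i2 * B 0 i0 - A 0 i0 * B 0 i2
     else A 0 i0 * B 0 i1 - A 0 i1 * B 0 i0)).

Lemma cross0E A B : cross A B 0 i0 = A 0 i1 * B 0 i2 - A 0 i2 * B 0 i1.
Proof. by rewrite /cross unlock mxE. Qed.
Lemma cross1E A B : cross A B 0 i1 = A 0 i2 * B 0 i0 - A 0 i0 * B 0 i2.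
Proof. by rewrite /cross unlock mxE. Qed.
Lemma cross2E A B : cross A B 0 i2 = A 0 i0 * B 0 i1 - A 0 i1 * B 0 i0.
Proof. by rewrite /cross unlock mxE. Qed.
Definition cE := (cross0E, cross1E, cross2E).

Lemma cross_comb A B x y z w :
  cross (x *: A + y *: B) (z *: A + w *: B) = (x * w - y * z) *: cross A B.
Proof. by apply/rowP; apply: ord3P; rewrite rowZE !cE !mxE; ring. Qed.

Lemma cross_linr A B C x y : cross A (x *: B + y *: C) = x *: cross A B + y *: cross A C.
Proof. by apply/rowP; apply: ord3P; rewrite rowDE !rowZE !cE !mxE; ring. Qed.

Lemma cross0l A : cross 0 A = 0.
Proof. by apply/rowP; apply: ord3P; rewrite !cE !mxE; ring. Qed.

Lemma cross_eq0 A B p q : cross A B = 0 -> A 0 p * B 0 q = A 0 q * B 0 p.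
Proof.
move/rowP=> h; have := h i0; have := h i1; have := h i2; rewrite !cE !mxE.
move=> /eqP; rewrite subr_eq0 => /eqP e2 /eqP; rewrite subr_eq0 => /eqP e1.
move=> /eqP; rewrite subr_eq0 => /eqP e0.
by move: p q; apply: ord3P; apply: ord3P.
Qed.

Lemma koszul_boundary r (x y z : R) (a b c : 'rV[R]_r) :
  x *: (y *: c - z *: b) + y *: (z *: a - x *: c) + z *: (x *: b - y *: a) = 0.
Proof. by apply/rowP => i; rewrite !mxE; ring. Qed.

(** If the Koszul cocycle of [a1] and [a2] is a combination of [A] and [B] whose
    coefficients are Koszul boundaries, then [a1] and [a2] may be corrected by
    combinations of [A] and [B] so as to satisfy the gluing condition. *)
Lemma koszul_correct r (c x y p q : R) (a1 a2 A B : 'rV[R]_r) p1 p2 q1 q2 :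
  p = x * p2 - y * p1 -> q = x * q2 - y * q1 ->
  c *: (x *: a2 - y *: a1) = p *: A + q *: B ->
  x *: (c *: a2 - (p2 *: A + q2 *: B)) = y *: (c *: a1 - (p1 *: A + q1 *: B)).
Proof.
move=> -> -> e; apply/rowP => k; have /rowP/(_ k) := e.
rewrite !mxE => e'.
apply/eqP; rewrite -subr_eq0; apply/eqP.
transitivity (c * (x * a2 0 k - y * a1 0 k) -
  ((x * p2 - y * p1) * A 0 k + (x * q2 - y * q1) * B 0 k)); first by ring.
by rewrite e' subrr.
Qed.
Lemma cocycle_raise r (xi xj ki kj : R) (Bi Bj : 'rV[R]_r) :
  (xi * ki) *: (kj *: Bj) - (xj * kj) *: (ki *: Bi) = (ki * kj) *: (xi *: Bj - xj *: Bi).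
Proof. by apply/rowP => l; rewrite !mxE; ring. Qed.

Lemma cocycle_lin r (p q a : R) (Ci Cj Ei Ej : 'rV[R]_r) :
  p *: (a *: Cj + Ej) - q *: (a *: Ci + Ei) =
  a *: (p *: Cj - q *: Ci) + (p *: Ej - q *: Ei).
Proof. by apply/rowP => l; rewrite !mxE; ring. Qed.

Lemma cocycle_cobound r (p q : R) (Ci Cj B : 'rV[R]_r) :
  p *: (Cj - q *: B) - q *: (Ci - p *: B) = p *: Cj - q *: Ci.
Proof. by apply/rowP => l; rewrite !mxE; ring. Qed.

Lemma cocycle_diff r (p q : R) (Ci Cj Ei Ej : 'rV[R]_r) :
  p *: Cj - q *: Ci = p *: Ej - q *: Ei -> p *: (Cj - Ej) = q *: (Ci - Ei).
Proof.
move=> e; apply/rowP => l; have /rowP/(_ l) := e; rewrite !mxE => e'.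
apply/eqP; rewrite -subr_eq0; apply/eqP.
transitivity ((p * Cj 0 l - q * Ci 0 l) - (p * Ej 0 l - q * Ei 0 l)); first by ring.
by rewrite e' subrr.
Qed.

Lemma fraction_comb r (g t x q y : R) (B C v : 'rV[R]_r) : g *: B = t *: C ->
  (g * x) *: v = (q * y) *: C -> g *: ((x * t) *: v) = g *: ((q * y) *: B).
Proof.
move=> e1 e2; apply/rowP => i; have /rowP/(_ i) := e1; have /rowP/(_ i) := e2; rewrite !mxE => h2 h1.
transitivity (t * (g * x * v 0 i)); first by ring.
by rewrite h2; transitivity (q * y * (t * C 0 i)); [|rewrite -h1]; ring.
Qed.

Lemma comb_eq0 r x y (A B : 'rV[R]_r) : x *: A + (- y) *: B = 0 -> x *: A = y *: B.
Proof. by rewrite scaleNr => /eqP; rewrite subr_eq0 => /eqP. Qed.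
End Cross.

(** * Rank two syzygy modules and their graded isomorphisms *)
Section Syzygies.
Variable K : fieldType.
Local Notation P := {mpoly K[3]}.

Lemma syz_graded r (h : 'I_r -> P) dg : (forall i, h i \is (dg i).-homog) ->
  graded dg (syz h).
Proof.
move=> hh k v hv; rewrite /syz -(raddf0 (wpart 0 k)) -[in RHS]hv raddf_sum.
apply: eq_bigr => i _ /=; rewrite mxE; apply/esym/wpartM.
exact/whomog0.
Qed.

(** First syzygies of a saturated ideal form a free module: [Tor_1] of the
    syzygies is the socle of the quotient by the ideal. *)
Lemma syz_hbasis r (h : 'I_r -> P) dg : (forall i, h i \is (dg i).-homog) ->
  (forall w, (forall i, exists a, dot h a = 'X_i * w) -> exists a, dot h a = w) ->
  exists t U c, @hbasis K r dg (syz h) t U c.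
Proof.
move=> hh sat; apply: (hbasis_of_koszul (syz_submod h) (syz_graded hh)) => u hu eu.
have [|v [v0 v1 v2]] := @koszul_cycle_row _ 1 r u.
  by rewrite -[RHS]eu; apply: eq_bigr => i _; rewrite expr1.
rewrite !expr1 in v0 v1 v2.
have p0 : 'X_i1 * dot h (v i2) = 'X_i2 * dot h (v i1).
  by apply/eqP; rewrite -subr_eq0 -!dotZ -dotB -v0; apply/eqP; exact: hu.
have p1 : 'X_i2 * dot h (v i0) = 'X_i0 * dot h (v i2).
  by apply/eqP; rewrite -subr_eq0 -!dotZ -dotB -v1; apply/eqP; exact: hu.
have p2 : 'X_i0 * dot h (v i1) = 'X_i1 * dot h (v i0).
  by apply/eqP; rewrite -subr_eq0 -!dotZ -dotB -v2; apply/eqP; exact: hu.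
have [|w hw] := @koszul_glue K 1 (fun i => dot h (v i)).
  by apply: ord3P; apply: ord3P; rewrite !expr1.
have [|t ht] := sat w; first by move=> i; exists (v i); rewrite hw expr1.
exists (fun i => v i - 'X_i *: t); split.
  by move=> i; rewrite /syz dotB dotZ hw ht expr1 subrr.
by split; apply/rowP => k; rewrite ?v0 ?v1 ?v2 !mxE; ring.
Qed.

Section Rank2.
Variable g : 'I_3 -> P.
Hypothesis pg : primitive_family g.

(** The polynomial [e] with [A x B = e * g]; on syzygies of [g] this identifies the
    second exterior power with a twist of the structure sheaf. *)
Definition isdelta A B e := forall k, cross A B 0 k = e * g k.

Lemma primitive_neq0 : exists k, g k != 0.
Proof.
apply: contrapT => /forallNP h; have := unitr0 P; rewrite pg // => i.
by have /negP := h i; rewrite negbK => /eqP ->; exact: rdvd0.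
Qed.

Lemma isdelta_inj A B x y : isdelta A B x -> isdelta A B y -> x = y.
Proof.
have [k gk] := primitive_neq0; move=> /(_ k) h /(_ k); rewrite h.
exact: mulIf.
Qed.

(** [A x B] is parallel to [g], both being orthogonal to [A] and [B]; as [g] is
    primitive the ratio is a polynomial. *)
Lemma isdelta_exists A B : syz g A -> syz g B -> exists e, isdelta A B e.
Proof.
rewrite /syz /dot !big3 => hA hB.
have par : forall i j, g i * cross A B 0 j = g j * cross A B 0 i.
  have h (i j k : 'I_3) C : (A 0 k * 0 - B 0 k * 0 = C) -> C = 0.
    by rewrite !mulr0 subrr => <-.
  have e01 : g i0 * cross A B 0 i1 = g i1 * cross A B 0 i0.
    by apply/eqP; rewrite -subr_eq0; apply/eqP/(h i0 i1 i2); rewrite -{1}hB -hA !cE; ring.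
  have e12 : g i1 * cross A B 0 i2 = g i2 * cross A B 0 i1.
    by apply/eqP; rewrite -subr_eq0; apply/eqP/(h i0 i1 i0); rewrite -{1}hB -hA !cE; ring.
  have e20 : g i2 * cross A B 0 i0 = g i0 * cross A B 0 i2.
    by apply/eqP; rewrite -subr_eq0; apply/eqP/(h i0 i1 i1); rewrite -{1}hB -hA !cE; ring.
  by apply: ord3P; apply: ord3P.
have [k gk] := primitive_neq0.
have [|e he] := primitive_dvd (p := cross A B 0 k) (q := g k) (@mpoly_factorial K 3) pg.
  by move=> i; exists (cross A B 0 i); rewrite [RHS]mulrC par mulrC.
by exists e => i; apply: (mulfI gk); rewrite par he; ring.
Qed.

Lemma isdelta_comb A B x y z w e : isdelta A B e ->
  isdelta (x *: A + y *: B) (z *: A + w *: B) ((x * w - y * z) * e).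
Proof. by move=> h k; rewrite cross_comb mxE h mulrA. Qed.

(** Cramer's rule in the rank two module of syzygies. *)
Lemma cramer A0 B0 A e x y : syz g A -> isdelta A0 B0 e -> isdelta A B0 x ->
  isdelta A0 A y -> e *: A = x *: A0 + y *: B0.
Proof.
move=> hA he hx hy; have [k gk] := primitive_neq0.
have det : \sum_i A 0 i * cross A0 B0 0 i = 0.
  under eq_bigr => i _ do rewrite he mulrCA.
  by rewrite -mulr_sumr [\sum_i _]hA mulr0.
rewrite big3 in det.
apply/rowP => i; rewrite !mxE; apply: (mulfI gk).
have -> : g k * (e * A 0 i) = cross A0 B0 0 k * A 0 i by rewrite he; ring.
have -> : g k * (x * A0 0 i + y * B0 0 i) =
    cross A B0 0 k * A0 0 i + cross A0 A 0 k * B0 0 i by rewrite hx hy; ring.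
apply/eqP; rewrite -subr_eq0; apply/eqP; move: k gk i.
apply: ord3P => _; apply: ord3P; rewrite ?cE; try ring.
all: by rewrite -[RHS]det !cE; ring.
Qed.

Definition kos j := cross (\row_i g i) (delta_mx 0 j).

Lemma kos_syz j : syz g (kos j).
Proof. by rewrite /syz /dot big3 /kos !cE !mxE; ring. Qed.

(** The values of [delta] on Koszul syzygies include the [g k]. *)
Lemma delta_koszul D k : (forall i, g i \is D.-homog) -> exists A B,
  [/\ syz g A, syz g B, vhomog (fun=> 0%N) D A, vhomog (fun=> 0%N) D B &
      isdelta A B (g k)].
Proof.
move=> hg; have Hk j : vhomog (fun=> 0%N) D (kos j).
  have h (b : bool) i : g i * b%:R \is D.-homog.
    by case: b; rewrite ?mulr1 ?mulr0 ?dhomog0.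
  by apply: ord3P; apply/whomog0; rewrite !cE !mxE; apply: rpredB; exact: h.
suff [A [B h]] : exists i j, isdelta (kos i) (kos j) (g k).
  by exists (kos A), (kos B); split=> //; exact: kos_syz.
move: k; apply: ord3P; [exists i1, i2 | exists i2, i0 | exists i0, i1].
all: by apply: ord3P; rewrite !cE !mxE /=; ring.
Qed.
End Rank2.

(** A graded isomorphism between two syzygy modules, as a relation; [s] and [s']
    are the twists for which it preserves degrees. *)
Record syz_iso (g g' : 'I_3 -> P) s s' (rho : 'rV[P]_3 -> 'rV[P]_3 -> Prop) := SyzIso {
  si_total : forall A, syz g A -> exists B, rho A B;
  si_onto : forall B, syz g' B -> exists A, rho A B;
  si_syz : forall A B, rho A B -> syz g A /\ syz g' B;
  si_lin : forall a A B A' B', rho A B -> rho A' B' -> rho (a *: A + A') (a *: B + B');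
  si_inj : forall A, rho A 0 -> A = 0;
  si_fun : forall B, rho 0 B -> B = 0;
  si_homog : forall k A B, rho A B -> vhomog (fun=> s) k A -> vhomog (fun=> s') k B }.

Lemma si_unique g g' s s' rho A B B' : syz_iso g g' s s' rho ->
  rho A B -> rho A B' -> B = B'.
Proof.
move=> h hB hB'; apply/eqP; rewrite -subr_eq0; apply/eqP/(si_fun h).
have := si_lin h (-1) hB' hB; rewrite !scaleN1r addNr.
by rewrite addrC.
Qed.

(** By Cramer's rule [delta] transports up to a fixed ratio [e0' / e0]. The [g k] and
    the [g' k] being values of [delta], primitivity makes [e0] and [e0'] divide each
    other. Comparing the degrees of [A0' x B0' = e0' * g'] relates the twists. *)
Lemma syz_iso_degree g g' D D' s s' rho :
  primitive_family g -> primitive_family g' ->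
  (forall i, g i \is D.-homog) -> (forall i, g' i \is D'.-homog) ->
  syz_iso g g' s s' rho -> (D + s.*2 = D' + s'.*2)%N.
Proof.
move=> pg pg' hg hg' h.
have [k0 gk] := primitive_neq0 pg.
have [A0 [B0 [SA0 SB0 HA0 HB0 de0]]] := delta_koszul k0 hg; set e0 := g k0 in de0 gk.
have [A0' rA0] := si_total h SA0; have [B0' rB0] := si_total h SB0.
have [_ SA0'] := si_syz h rA0; have [_ SB0'] := si_syz h rB0.
have [e0' de0'] := isdelta_exists pg' SA0' SB0'.
have image A A' x y : rho A A' -> isdelta g A B0 x -> isdelta g A0 A y ->
    e0 *: A = x *: A0 + y *: B0 /\ e0 *: A' = x *: A0' + y *: B0'.
  move=> rA dx dy; have [SA SA'] := si_syz h rA.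
  have e := cramer pg SA de0 dx dy; split=> //.
  have r0 : rho 0 0.
    by have := si_lin h (-1) rA rA; rewrite !scaleN1r !addNr.
  have r1 := si_lin h e0 rA r0; have r2 := si_lin h x rA0 (si_lin h y rB0 r0).
  by rewrite !addr0 -?e in r1 r2; exact: si_unique h r1 r2.
have transport A B A' B' e e' : rho A A' -> rho B B' -> isdelta g A B e ->
    isdelta g' A' B' e' -> e' * e0 = e * e0'.
  move=> rA rB de de'; have [SA SA'] := si_syz h rA; have [SB SB'] := si_syz h rB.
  have [x dx] := isdelta_exists pg SA SB0; have [y dy] := isdelta_exists pg SA0 SA.
  have [z dz] := isdelta_exists pg SB SB0; have [w dw] := isdelta_exists pg SA0 SB.
  have [eA eA'] := image _ _ _ _ rA dx dy; have [eB eB'] := image _ _ _ _ rB dz dw.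
  have E1 : (x * w - y * z) * e0 = e0 * e0 * e.
    apply: (isdelta_inj pg (isdelta_comb x y z w de0)).
    have := isdelta_comb e0 0 0 e0 de; rewrite !scale0r addr0 add0r eA eB.
    by rewrite mul0r subr0.
  have E2 : (x * w - y * z) * e0' = e0 * e0 * e'.
    apply: (isdelta_inj pg' (isdelta_comb x y z w de0')).
    have := isdelta_comb e0 0 0 e0 de'; rewrite !scale0r addr0 add0r eA' eB'.
    by rewrite mul0r subr0.
  apply: (mulfI (mulf_neq0 gk gk)).
  transitivity ((e0 * e0 * e') * e0); first by ring.
  by rewrite -E2; transitivity ((e0 * e0 * e) * e0'); [rewrite -E1|]; ring.
have [u eu] : rdvd e0 e0'.
  apply: primitive_dvd (@mpoly_factorial K 3) pg _ => k.
  have [A [B [SA SB _ _ de]]] := delta_koszul k hg.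
  have [A' rA] := si_total h SA; have [B' rB] := si_total h SB.
  have [_ SA'] := si_syz h rA; have [_ SB'] := si_syz h rB.
  have [e' de'] := isdelta_exists pg' SA' SB'.
  by exists e'; rewrite (transport _ _ _ _ _ _ rA rB de de') mulrC.
have [v ev] : rdvd e0' e0.
  apply: primitive_dvd (@mpoly_factorial K 3) pg' _ => k.
  have [A' [B' [SA' SB' _ _ de']]] := delta_koszul k hg'.
  have [A rA] := si_onto h SA'; have [B rB] := si_onto h SB'.
  have [SA _] := si_syz h rA; have [SB _] := si_syz h rB.
  have [e de] := isdelta_exists pg SA SB.
  by exists e; rewrite -(transport _ _ _ _ _ _ rA rB de de') mulrC.
have uv : u * v = 1.
  by apply: (mulIf gk); rewrite mul1r {2}ev eu; ring.
have [c c0 ec] : exists2 c, c != 0 & u = c%:MP.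
  have : u \is a GRing.unit by apply/unitrP; exists v; rewrite mulrC.
  move=> /andP[/eqP -> hc]; exists (u@_0) => //.
  by move: hc; rewrite unitfE mcoeffC eqxx mulr1.
have he0' : e0' \is D.-homog by rewrite eu ec mul_mpolyC; apply: dhomogZ; exact: hg.
have [k gk'] := primitive_neq0 pg'.
have n0 : cross A0' B0' 0 k != 0.
  by rewrite de0' mulf_neq0 // eu mulf_neq0 // ec mpolyC_eq0.
have H1 : cross A0' B0' 0 k \is (D + D').-homog by rewrite de0'; apply: dhomogM.
have tw A A' : rho A A' -> vhomog (fun=> 0%N) D A -> vhomog (fun=> s') (D + s) A'.
  by move=> rA hA; apply: (si_homog h rA) => i; apply/(@whomog_shift _ _ 0 D s)/hA.
have H2 : forall k, whomog s'.*2 (D + s).*2 (cross A0' B0' 0 k).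
  have hM i j : whomog s'.*2 (D + s).*2 (A0' 0 i * B0' 0 j).
    rewrite -!addnn; apply: (@whomogM _ _ (s' + (D + s))).
      exact: (proj2 (whomog_shift _ _ (D + s) _) (tw _ _ rA0 HA0 i)).
    rewrite [X in whomog _ X _]addnC.
    exact: (proj2 (whomog_shift _ _ s' _) (tw _ _ rB0 HB0 j)).
  by apply: ord3P; rewrite !cE; apply: whomogB; exact: hM.
have lc : (cross A0' B0' 0 k)@_(mlead (cross A0' B0' 0 k)) != 0 by rewrite mleadc_eq0.
have := H2 _ _ lc; have /dhomogP := H1; move=> /(_ (mlead (cross A0' B0' 0 k))).
by rewrite mcoeff_msupp => /(_ lc) ->; lia.
Qed.
End Syzygies.

(** * Free syzygies *)
Section FreeSyzygies.
Variable K : fieldType.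
Local Notation P := {mpoly K[3]}.
Variable g : 'I_3 -> P.
Hypothesis pg : primitive_family g.

Definition in_ideal r (h : 'I_r -> P) w := exists a, dot h a = w.

Lemma isdelta_free A B c x y : isdelta g A B c -> c != 0 ->
  x *: A + y *: B = 0 -> x = 0 /\ y = 0.
Proof.
move=> h c0 e; have [k gk] := primitive_neq0 pg.
have z C : cross 0 C 0 k = 0 :> P by rewrite cross0l mxE.
have c1 : (x * c) * g k = 0.
  have := isdelta_comb x y 0 1 h k.
  by rewrite e z mulr1 mulr0 subr0 => <-.
have c2 : (y * c) * g k = 0.
  have := isdelta_comb x y 1 0 h k.
  by rewrite e z mulr1 mulr0 sub0r => /eqP; rewrite mulNr mulNr eq_sym oppr_eq0 => /eqP.
split; apply/eqP; [move/eqP: c1 | move/eqP: c2].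
all: by rewrite !mulf_eq0 (negbTE gk) (negbTE c0) !orbF.
Qed.

(** Hilbert-Burch: when the syzygies have a basis [A, B] the gradient consists of
    the minors of [A, B] and the jacobian ideal is saturated. *)
Lemma free_socle A B c : syz g A -> syz g B -> isdelta g A B c -> c \is a GRing.unit ->
  forall w, (forall i, in_ideal g ('X_i * w)) -> in_ideal g w.
Proof.
move=> SA SB dAB uc w /choice [a ha].
have c0 : c != 0 by apply: contraTneq uc => ->; rewrite unitr0.
pose C i := if i == i0 then 'X_i1 *: a i2 - 'X_i2 *: a i1
  else if i == i1 then 'X_i2 *: a i0 - 'X_i0 *: a i2 else 'X_i0 *: a i1 - 'X_i1 *: a i0.
have SC i : syz g (C i).
  move: i; apply: ord3P; rewrite /C /= /syz dotB !dotZ !ha; ring.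
have /choice [al hal] := fun i => isdelta_exists pg (SC i) SB.
have /choice [be hbe] := fun i => isdelta_exists pg SA (SC i).
have eC i : c *: C i = al i *: A + be i *: B by exact: (cramer pg (SC i) dAB (hal i) (hbe i)).
have cyc : \sum_i 'X_i *: C i = 0.
  by rewrite big3; exact: koszul_boundary.
have [s0 t0] : \sum_i 'X_i ^+ 1 * al i = 0 /\ \sum_i 'X_i ^+ 1 * be i = 0.
  apply: (isdelta_free dAB c0).
  transitivity (c *: \sum_i 'X_i *: C i); last by rewrite cyc scaler0.
  rewrite !scaler_suml scaler_sumr -big_split; apply: eq_bigr => i _ /=.
  by rewrite expr1 -!scalerA -scalerDr -eC !scalerA [c * _]mulrC.
have [u [u0 u1 u2]] := koszul_cycle s0; have [v [v0 v1 v2]] := koszul_cycle t0.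
rewrite !expr1 in u0 u1 u2 v0 v1 v2.
pose b i := c *: a i - (u i *: A + v i *: B).
have e01 : 'X_i0 *: b i1 = 'X_i1 *: b i0 by exact: (koszul_correct u2 v2 (eC i2)).
have e12 : 'X_i1 *: b i2 = 'X_i2 *: b i1 by exact: (koszul_correct u0 v0 (eC i0)).
have e20 : 'X_i2 *: b i0 = 'X_i0 *: b i2 by exact: (koszul_correct u1 v1 (eC i1)).
have glue i j : 'X_i ^+ 1 *: b j = 'X_j ^+ 1 *: b i.
  rewrite !expr1; move: i j; apply: ord3P; apply: ord3P;
    [exact: erefl | exact: e01 | exact: esym e20 | exact: esym e01 | exact: erefl |
     exact: e12 | exact: e20 | exact: esym e12 | exact: erefl].
have [z hz] := koszul_glue_row glue.
have dz : dot g z = c * w.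
  apply: (mulfI (Xn_neq0 K 1 i0)); rewrite -dotZ -(hz i0) /b dotB dotD !dotZ SA SB ha.
  rewrite expr1 !mulr0 addr0 subr0; exact: mulrCA.
exists (c^-1 *: z); rewrite dotZ dz mulrA mulVr ?mul1r; exact.
Qed.

Lemma isdelta_kos A j : syz g A -> isdelta g A (kos g j) (A 0 j).
Proof.
rewrite /syz /dot big3 => hA k; apply/eqP; rewrite -subr_eq0; apply/eqP.
transitivity (- (delta_mx 0 j : 'rV[P]_3) 0 k * (A 0 i0 * g i0 + A 0 i1 * g i1 + A 0 i2 * g i2)).
  by move: k j; apply: ord3P; apply: ord3P; rewrite /kos !cE !mxE /=; ring.
by rewrite hA mulr0.
Qed.

(** If a syzygy [A] generates a free direct summand then the syzygies are free:
    [kernel of la] has rank one, and factoriality makes it generated by one [B]. *)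
Lemma summand_free A (la : 'rV[P]_3 -> P) : syz g A ->
  (forall x y B C, syz g B -> syz g C -> la (x *: B + y *: C) = x * la B + y * la C) ->
  la A \is a GRing.unit -> exists2 B, syz g B & isdelta g A B (la A).
Proof.
move=> SA hla uA; set e := la A in uA *.
have e0 : e != 0 by apply: contraTneq uA => ->; rewrite unitr0.
have laZ x B : syz g B -> la (x *: B) = x * la B.
  by move=> SB; have := hla x 0 _ _ SB SB; rewrite scale0r addr0 mul0r addr0.
have SD x y B C : syz g B -> syz g C -> syz g (x *: B + y *: C).
  by move=> hB hC; rewrite /syz dotP dotZ hB hC !mulr0 addr0.
have pA : primitive_family (fun i => A 0 i).
  move=> q /choice [a ha]; have eA : A = q *: \row_i a i.
    by apply/rowP => i; rewrite !mxE ha mulrC.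
  have q0 : q != 0.
    apply: contraNneq e0 => q0; rewrite /e eA q0 scale0r.
    by have := laZ 0 _ SA; rewrite scale0r mul0r => ->.
  have Sa : syz g (\row_i a i).
    by apply: (mulfI q0); rewrite mulr0 -dotZ -eA.
  by apply: (rdvd_unit uA); exists (la (\row_i a i)); rewrite /e eA laZ // mulrC.
pose w i := e *: kos g i + (- la (kos g i)) *: A.
have Sw i : syz g (w i) by apply: SD => //; exact: kos_syz.
have law i : la (w i) = 0.
  by rewrite /w hla -/e ?mulNr 1?mulrC ?subrr //; exact: kos_syz.
have dw i : isdelta g A (w i) (e * A 0 i).
  have := isdelta_comb 1 0 (- la (kos g i)) e (isdelta_kos i SA).
  by rewrite scale1r scale0r addr0 mul1r mul0r subr0 addrC.
clearbody w.
have par i k : A 0 k *: w i = A 0 i *: w k.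
  have cz p : cross A (A 0 k *: w i + (- A 0 i) *: w k) 0 p = 0.
    rewrite cross_linr rowDE !rowZE !dw.
    by move: (A 0 i) (A 0 k) (g p) => *; ring.
  have Sz : syz g (A 0 k *: w i + (- A 0 i) *: w k) by exact: SD.
  have laz : la (A 0 k *: w i + (- A 0 i) *: w k) = 0 by rewrite hla // !law !mulr0 addr0.
  apply: comb_eq0; move: (_ + _) cz Sz laz => z cz Sz laz.
  have pz p : A 0 p *: z = z 0 p *: A.
    have h q : A 0 p * z 0 q = z 0 p * A 0 q.
      by rewrite [RHS]mulrC; apply: cross_eq0; apply/rowP => t; rewrite cz mxE.
    by apply/rowP => q; rewrite !rowZE h.
  apply/rowP => p; rewrite mxE; apply: (mulIf e0); rewrite mul0r.
  by rewrite -laZ // -pz laZ // laz mulr0.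
have [k Ak] : exists k, A 0 k != 0.
  apply: contrapT => /forallNP h; have := unitr0 P; rewrite pA // => i.
  by have /negP := h i; rewrite negbK => /eqP ->; exact: rdvd0.
have /choice [b hb] : forall q, exists b, w k 0 q = b * A 0 k.
  move=> q; apply: (primitive_dvd (@mpoly_factorial K 3) pA) => i.
  by exists (w i 0 q); have /rowP/(_ q) := par i k; rewrite !rowZE => e'; rewrite mulrC -e' mulrC.
have eB : w k = A 0 k *: \row_q b q by apply/rowP => q; rewrite hb !mxE mulrC.
exists (\row_q b q).
  by apply: (mulfI Ak); rewrite mulr0 -dotZ -eB; exact: Sw.
move=> q; apply: (mulfI Ak).
have := dw k q; rewrite eB -[_ *: _]addr0 -[X in _ + X](scale0r 0) cross_linr.
by rewrite rowDE !rowZE mul0r addr0 => ->; ring.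
Qed.
End FreeSyzygies.

(** * Saturation, and the gradient of a reduced form *)
Section Saturation.
Variable K : fieldType.
Local Notation P := {mpoly K[3]}.

Section Ideal.
Variables (r : nat) (h : 'I_r -> P).

Lemma in_ideal_submod : submod (V := P^o) (in_ideal h).
Proof.
split=> [|c _ _ [a <-] [b <-]]; first by exists 0; rewrite dot0.
by exists (c *: a + b); rewrite dotP.
Qed.

Lemma in_idealM c w : in_ideal h w -> in_ideal h (c * w).
Proof. exact: (submodZ c in_ideal_submod). Qed.

Lemma in_idealD v w : in_ideal h v -> in_ideal h w -> in_ideal h (v + w).
Proof. exact: (submodD in_ideal_submod). Qed.

Lemma in_ideal_sum I (s : seq I) (Q : pred I) (F : I -> P) :
  (forall i, Q i -> in_ideal h (F i)) -> in_ideal h (\sum_(i <- s | Q i) F i).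
Proof.
move=> hF; elim/big_ind: _ => //; last exact: in_idealD.
by exists 0; rewrite dot0.
Qed.

Lemma in_ideal_mem i : in_ideal h (h i).
Proof.
exists (delta_mx 0 i); rewrite /dot (bigD1 i) //= big1 => [|j ji].
  by rewrite mxE !eqxx mul1r addr0.
by rewrite mxE (negbTE ji) andbF mul0r.
Qed.

Lemma in_ideal_part k w dg : (forall i, h i \is (dg i).-homog) ->
  in_ideal h w -> in_ideal h (wpart 0 k w).
Proof.
move=> hh [a <-]; exists (vpart dg k a); rewrite raddf_sum.
by apply: eq_bigr => i _ /=; rewrite mxE; apply/esym/wpartM/whomog0.
Qed.
End Ideal.

Section Sat.
Variables (g : 'I_3 -> P) (D : nat).
Hypothesis hg : forall i, g i \is D.-homog.

Definition in_sat (w : P) := exists n, forall e (h : P), (n <= e)%N ->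
  h \is e.-homog -> in_ideal g (h * w).

Lemma in_sat_submod : submod (V := P^o) in_sat.
Proof.
split; first by exists 0%N => e h _ _; rewrite mulr0; exists 0; rewrite dot0.
move=> a v w [n hn] [m hm]; exists (maxn n m) => e h; rewrite geq_max.
move=> /andP[ne me] hh; rewrite (_ : h * _ = a * (h * v) + h * w); last first.
  by rewrite /GRing.scale /=; ring.
by apply: in_idealD; [apply/in_idealM/(hn e) | apply: (hm e)].
Qed.

Lemma in_sat_sum I (r : seq I) (Q : pred I) (F : I -> P) :
  (forall i, Q i -> in_sat (F i)) -> in_sat (\sum_(i <- r | Q i) F i).
Proof. by move=> h; exact: (@submod_sum _ P^o in_sat _ r Q F in_sat_submod h). Qed.

Lemma in_ideal_sat w : in_ideal g w -> in_sat w.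
Proof. by move=> h; exists 0%N => e c _ _; exact: in_idealM. Qed.

Lemma in_sat_part k w : in_sat w -> in_sat (wpart 0 k w).
Proof.
move=> [n hn]; exists n => e h ne hh; rewrite mulrC.
rewrite -(wpart_shift 0 k e) add0n -(@wpartM _ _ e 0); last exact/whomog0.
by rewrite mulrC; apply: in_ideal_part hg _; exact: (hn e).
Qed.

Lemma homog_split e (h : P) : h \is e.+1.-homog ->
  exists2 b : 'I_3 -> P, (forall i, b i \is e.-homog) & h = \sum_i b i * 'X_i.
Proof.
move=> hh; have [|a ea] := @max_idealP K h.
  by apply: (dhomog_nemf_coeff hh); rewrite /= mdeg0.
exists (fun i => wpart 1 e.+1 (a i)).
  move=> i; apply/whomog0; apply/(@whomog_shift _ _ 0 e 1).
  by rewrite add0n addn1; exact: wpart_whomog.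
rewrite -{1}(wpart_id (proj2 (whomog0 _ _) hh)) ea raddf_sum; apply: eq_bigr => i _ /=.
by rewrite mulrC; apply/wpartM/whomog0; rewrite dhomogX; apply/eqP; exact: mdeg1.
Qed.

Lemma in_sat_saturated w : (forall i, in_sat ('X_i * w)) -> in_sat w.
Proof.
move=> /choice [n hn]; exists (\max_i n i).+1 => -[//|e] h ne hh.
have [b hb ->] := homog_split hh; rewrite mulr_suml; apply: in_ideal_sum => i _.
rewrite -mulrA; apply: (hn i e) => //.
by apply: leq_trans (leq_bigmax i) _; rewrite -ltnS.
Qed.

(** A nonzero module in which every element is killed by a power of the maximal
    ideal has a nonzero element killed by the variables. *)
Lemma sat_of_socle : (forall w, (forall i, in_ideal g ('X_i * w)) -> in_ideal g w) ->
  forall w, in_sat w -> in_ideal g w.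
Proof.
move=> soc w [n hn]; suff H : forall k, (k <= n)%N -> forall e h, (k <= e)%N ->
    h \is e.-homog -> in_ideal g (h * w).
  by rewrite -[w]mul1r; apply: (H 0%N _ 0%N) => //; exact: dhomog1.
move=> k kn; rewrite -(subKn kn); elim: (n - k)%N => [|j IH] e h ke hh.
  by apply: (hn e) => //; rewrite subn0 in ke.
apply: soc => i; rewrite mulrA; apply: (IH e.+1); first by lia.
apply: (@dhomogM _ _ _ 1 _ e) => //; rewrite dhomogX; apply/eqP; exact: mdeg1.
Qed.

Lemma sat_generators : exists m (h : 'I_m -> P) dg,
  [/\ forall j, h j \is (dg j).-homog, forall j, in_sat (h j) &
      forall w, in_sat w -> in_ideal h w].
Proof.
pose S (v : 'rV[P]_1) := in_sat (v 0 0).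
have hS : submod S.
  have [S0 SP] := in_sat_submod; split=> [|a v w hv hw]; rewrite /S !mxE //.
  exact: SP.
have gS : graded (fun=> 0%N) S by move=> k v hv; rewrite /S mxE; exact: in_sat_part.
have [m [U [c [hU dU gU]]]] := exists_hgens hS gS.
exists m, (fun j => U j 0), c; split=> [j|j|w hw].
- by have := dU j 0; rewrite mxE => /whomog0.
- by have := hU j; rewrite /S mxE.
have [|a ea] := gU (const_mx w); first by rewrite /S mxE.
by exists a; have /rowP/(_ 0) := ea; rewrite !mxE => ->.
Qed.
End Sat.
End Saturation.

Section Gradient.
Variable K : fieldType.
Hypothesis char0 : [pchar K] =i pred0.
Local Notation P := {mpoly K[3]}.
Implicit Type X : plane_curve K.

Definition grad X (i : 'I_3) : P := (eqn X)^`M(i).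

Lemma grad_homog X i : grad X i \is (cdeg X).-1.-homog.
Proof. exact: partial_homog. Qed.

Lemma jacP X w : w \in gs_pred (jacobian_ideal X) <-> in_ideal (grad X) w.
Proof.
split=> [/asboolP[A ->]|[a <-]].
  by exists (\row_i A i); apply: eq_bigr => i _; rewrite mxE.
by apply/asboolP; exists (a 0).
Qed.

Lemma natr_neq0 n : (0 < n)%N -> n%:R != 0 :> K.
Proof. by move=> n0; rewrite (proj1 (pcharf0P K) char0) -lt0n. Qed.

Lemma eqn_neq0 X : eqn X != 0.
Proof.
apply/eqP => e; have := @eqn_reduced _ X 0 0; rewrite e mulr0 => /(_ erefl).
by rewrite unitr0.
Qed.

Lemma dot_grad_euler X : dot (grad X) (euler_field K) = (cdeg X)%:R *: eqn X.
Proof. by rewrite -euler; apply: eq_bigr => i _; rewrite mxE. Qed.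

Lemma mderiv_const (p : P) : (forall i, p^`M(i) = 0) -> p = (p@_0)%:MP.
Proof.
move=> h; apply/mpolyP => m; rewrite mcoeffC; case: eqP => [->|/eqP m0]; first by rewrite mulr1.
rewrite mulr0; have [i mi] : exists i, m i != 0%N.
  apply/existsP; apply: contraNT m0 => /existsPn e; apply/eqP/mnmP => i.
  by rewrite mnm0E; apply/eqP; have := e i; rewrite negbK.
have /(congr1 (mcoeff (m - U_(i))%MM)) := h i; rewrite mcoeff_mderiv mcoeff0.
rewrite submK; last first.
  by apply/mnm_lepP => j; rewrite mnm1E; case: eqP => // <-; rewrite lt0n.
rewrite -mulr_natl => /eqP; rewrite mulf_eq0 (negbTE (natr_neq0 _)) //.
by move=> /eqP.
Qed.

(** In characteristic zero a polynomial that is not constant has a nonzero partial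
    derivative, and its degree is too small for a multiple of [p]. *)
Lemma prime_divides_partials (p : P) : prime_elt p -> ~ forall i, rdvd p p^`M(i).
Proof.
move=> [p0 nu _] h; have [i pi] : exists i, p^`M(i) != 0.
  apply: contrapT => /forallNP e; have pc : p = (p@_0)%:MP.
    by apply: mderiv_const => i; apply/eqP; have /negP := e i; rewrite negbK.
  case/negP: nu; rewrite pc; apply: rmorph_unit; rewrite unitfE.
  by apply: contraNneq p0 => e0; rewrite pc e0.
have [c ec] := h i; have c0 : c != 0 by apply: contraNneq pi => c0; rewrite ec c0 mul0r.
have : (msize p^`M(i) < msize p)%N.
  have sp : (0 < msize p)%N by rewrite lt0n msize_poly_eq0.
  rewrite -(prednK sp) ltnS msizeE; apply/bigmax_leqP_seq => m.
  rewrite mcoeff_msupp mcoeff_mderiv => hm _.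
  have : (m + U_(i))%MM \in msupp p.
    by rewrite mcoeff_msupp; apply: contraNneq hm => ->; rewrite mul0rn.
  by move=> /msize_mdeg_lt; rewrite mdegD mdeg1; lia.
have : (0 < msize c)%N by rewrite lt0n msize_poly_eq0.
rewrite ec msizeM //; move: (msize c) (msize p) => x y; clear; lia.
Qed.

(** A prime [p] dividing all partial derivatives divides [f] by Euler's relation;
    [f = p * h] is reduced, so [p] does not divide [h], and [df = h dp + p dh] makes
    [p] divide its own derivatives. *)
Lemma primitive_grad X : primitive_family (grad X).
Proof.
move=> q hq; have f0 := eqn_neq0 X; set f := eqn X in f0.
have qf : rdvd q f.
  have := dot_grad_euler X; rewrite -/f => e.
  have -> : f = ((cdeg X)%:R^-1)%:MP * dot (grad X) (euler_field K).
    by rewrite e mul_mpolyC scalerA mulVf ?scale1r // natr_neq0 // cdeg_gt0.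
  by apply/rdvdMl/rdvd_sum => i _; exact: rdvdMl.
have q0 : q != 0 by apply: contraNneq f0 => q0; have [c ->] := qf; rewrite q0 mulr0.
have [n [u [[|p s] [hu _ hs eq]]]] := @mpoly_factorial K 3 q q0.
  by rewrite eq big_nil mulr1.
have hp := hs p (mem_head _ _); have [p0 nu hP] := hp.
have pq : rdvd p q by rewrite eq big_cons /=; exact/rdvdMl/rdvdMr/rdvdd.
have [h ef] := rdvd_trans pq qf.
have nph : ~ rdvd p h.
  move=> [k ek]; case/negP: nu; apply: (@eqn_reduced _ X p k).
  by rewrite -/f ef ek; ring.
case: (prime_divides_partials hp) => i.
have : rdvd p (h * p^`M(i)).
  have -> : h * p^`M(i) = grad X i - h^`M(i) * p.
    by rewrite /grad -/f ef mderivM; ring.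
  apply: rdvdD; first exact: rdvd_trans pq (hq i).
  exact/rdvdN/rdvdMl/rdvdd.
by case/hP.
Qed.
End Gradient.

(** * From local cohomology to syzygies *)
Section Horrocks.
Variable K : fieldType.
Local Notation P := {mpoly K[3]}.

Section Presentation.
Variables (g : 'I_3 -> P) (D m : nat) (h : 'I_m -> P) (dg : 'I_m -> nat).
Hypotheses (hg : forall i, g i \is D.-homog) (hh : forall j, h j \is (dg j).-homog).

(** A graded free cover [F] of the relations between [g] and [h]; with [h]
    generating the saturation modulo [g] it presents the local cohomology module,
    and the syzygies of [g] are the kernel of the presentation matrix [Bm]. *)
Definition presentation t (Am : 'M[P]_(t, 3)) (Bm : 'M[P]_(t, m)) (c : 'I_t -> nat) :=
  [/\ forall a, dot g (a *m Am) + dot h (a *m Bm) = 0,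
      forall A B, dot g A + dot h B = 0 -> exists a, A = a *m Am /\ B = a *m Bm,
      forall a : 'rV_t, a *m Am = 0 -> a *m Bm = 0 -> a = 0,
      forall k a, vpart (fun=> D) k (a *m Am) = vpart c k a *m Am &
      forall k a, vpart dg k (a *m Bm) = vpart c k a *m Bm].

Lemma exists_presentation :
  (forall w, in_sat g w -> exists a b, dot g a + dot h b = w) ->
  (forall j, in_sat g (h j)) -> exists t Am Bm c, @presentation t Am Bm c.
Proof.
move=> gen hs.
pose G (i : 'I_(3 + m)) := match split i with inl i => g i | inr j => h j end.
pose dG (i : 'I_(3 + m)) := match split i with inl i => D | inr j => dg j end.
have hG i : G i \is (dG i).-homog by rewrite /G /dG; case: split.
have Gl i : G (lshift m i) = g i by rewrite /G (unsplitK (inl i)).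
have Gr j : G (rshift 3 j) = h j by rewrite /G (unsplitK (inr j)).
have dGl i : dG (lshift m i) = D by rewrite /dG (unsplitK (inl i)).
have dGr j : dG (rshift 3 j) = dg j by rewrite /dG (unsplitK (inr j)).
have dotG a b : dot G (row_mx a b) = dot g a + dot h b.
  rewrite /dot big_split_ord; congr (_ + _); apply: eq_bigr => i _.
    by rewrite row_mxEl Gl.
  by rewrite row_mxEr Gr.
have satG w : in_sat g w <-> exists a, dot G a = w.
  split=> [/gen [a [b e]]|[a <-]]; first by exists (row_mx a b); rewrite dotG.
  rewrite -[a]hsubmxK dotG; have SS := in_sat_submod g.
  apply: (submodD SS); first by apply: in_ideal_sat; exists (lsubmx a).
  by apply: in_sat_sum => j _; exact: (submodZ (rsubmx a 0 j) SS (hs j)).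
have [w hw|t [U [c [[SU dU gU] fU]]]] := syz_hbasis hG.
  by apply/satG/in_sat_saturated => i; apply/satG.
clearbody G dG.
exists t, (lsubmx U), (rsubmx U), c; split.
- move=> a; rewrite -dotG -mul_mx_row hsubmxK.
  exact: (submod_mulmx (syz_submod G)).
- move=> A B e; have [|a ea] := gU (row_mx A B); first by rewrite /syz dotG.
  exists a; rewrite -[U]hsubmxK mul_mx_row in ea.
  by move/eq_row_mx: ea => [-> ->].
- by move=> a e1 e2; apply: fU; rewrite -[U]hsubmxK mul_mx_row e1 e2 row_mx0.
- move=> k a; apply: vpart_mulmx => j i; have := dU j (lshift m i).
  by rewrite dGl !mxE.
- move=> k a; apply: vpart_mulmx => j i; have := dU j (rshift 3 i).
  by rewrite dGr !mxE.
Qed.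

Hypothesis pg : primitive_family g.

(** The syzygies lie in [m F] unless the saturation is the ideal itself. *)
Lemma presentation_minimal t Am Bm (c : 'I_t -> nat) w : presentation Am Bm c ->
  in_sat g w -> ~ in_ideal g w ->
  forall a : 'rV_t, a *m Bm = 0 -> forall j, (a 0 j)@_0 = 0.
Proof.
move=> [F1 F2 F3 F4 F5] sw nw a aB j; apply/eqP; apply: contraT => aj; exfalso.
pose b := vpart c (c j) a.
have bB : b *m Bm = 0 by rewrite /b -F5 aB vpart0.
have bj : b 0 j = ((a 0 j)@_0)%:MP.
  by rewrite (whomog_const (@vpart_vhomog _ _ c (c j) a j)) mxE mcoeff0_wpart eqxx.
have /choice [co hco] : forall C, exists x, syz g C -> C = x *m Am /\ x *m Bm = 0.
  move=> C; have [SC|nS] := pselect (syz g C); last by exists 0.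
  have [|x [e1 e2]] := F2 C 0; first by rewrite dot0 addr0.
  by exists x.
have coE C x : syz g C -> C = x *m Am -> x *m Bm = 0 -> co C = x.
  move=> SC e1 e2; have [e3 e4] := hco C SC.
  apply/eqP; rewrite -subr_eq0; apply/eqP/F3; rewrite mulmxBl ?e2 ?e4 ?subrr //.
  by rewrite -e1 -e3 subrr.
have SA : syz g (b *m Am) by rewrite /syz -[RHS](F1 b) bB dot0 addr0.
have laA : co (b *m Am) 0 j = ((a 0 j)@_0)%:MP by rewrite (coE _ b) ?bj.
have [||B SB dB] := @summand_free _ _ (b *m Am) (fun C => co C 0 j) SA.
- move=> x y B C SB SC; have [b1 b2] := hco B SB; have [c1 c2] := hco C SC.
  rewrite (coE _ (x *: co B + y *: co C)) ?mxE //.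
  + by rewrite /syz dotP dotZ SB SC !mulr0 addr0.
  + by rewrite mulmxDl -!scalemxAl -b1 -c1.
  + by rewrite mulmxDl -!scalemxAl b2 c2 !scaler0 addr0.
- by rewrite laA; apply: rmorph_unit; rewrite unitfE.
apply: nw; apply: (sat_of_socle _ sw).
apply: (free_socle pg SA SB dB).
by rewrite laA; apply: rmorph_unit; rewrite unitfE.
Qed.
End Presentation.

(** A matrix of degree zero whose entries lie in [m] is nilpotent. *)
Lemma graded_unipotent t (c : 'I_t -> nat) (E : 'M[P]_t) :
  (forall i j, whomog (c j) (c i) (E i j)) -> (forall i j, (E i j)@_0 = 0) ->
  exists S, (1%:M + E) *m S = 1%:M.
Proof.
move=> hE E0; pose C := \max_i c i.
have hpw n i j : whomog (c j) (c i) (((- E) ^+ n) i j) /\ mlow n (((- E) ^+ n) i j).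
  elim: n i j => [|n IH] i j.
    split=> //; rewrite expr0 mxE; case: eqP => [->|_]; last exact: whomog_zero.
    move=> m; rewrite mcoeff1; case: (m =P 0%MM) => [->|_]; last by rewrite eqxx.
    by rewrite mdeg0.
  rewrite exprS -mulmxE mxE; split.
    apply: whomog_sum => k _; have [h _] := IH k j; apply: whomogM h.
    by rewrite mxE; exact/whomogN.
  elim/big_ind: _ => [m|p q|k _]; first by rewrite mcoeff0 eqxx.
    exact: mlowD.
  have [_ h] := IH k j; rewrite -add1n; apply: mlowM h; apply: mlow1.
  by rewrite mxE mcoeffN E0 oppr0.
have pw0 : (- E) ^+ C.+1 = 0.
  apply/matrixP => i j; apply/mpolyP => m; rewrite mxE mcoeff0; apply/eqP.
  apply: contraT => hm; have [h1 h2] := hpw C.+1 i j; have := h1 _ hm; have := h2 _ hm.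
  by have : (c i <= C)%N by [exact: leq_bigmax]; lia.
exists (\sum_(n < C.+1) (- E) ^+ n).
have := subrX1 (- E) C.+1; rewrite pw0 sub0r -opprD [E + 1]addrC mulNr => /oppr_inj e.
exact: esym e.
Qed.

(** The local cohomology modules of [g] and [g'] as a relation between
    representatives in the two saturated ideals. *)
Record h0_iso (g g' : 'I_3 -> P) (tau : P -> P -> Prop) := H0Iso {
  hi_total : forall k w, in_sat g w -> w \is k.-homog ->
    exists2 w', w' \is k.-homog & tau w w';
  hi_onto : forall w', in_sat g' w' -> exists2 w, in_sat g w & tau w w';
  hi_sat : forall w w', tau w w' -> in_sat g' w';
  hi_lin : forall a v w v' w', tau v v' -> tau w w' -> tau (a * v + w) (a * v' + w');
  hi_ideal : forall w w', tau w w' -> in_ideal g w <-> in_ideal g' w' }.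

(** Horrocks' correspondence: a nonzero module of finite length determines the
    rank two syzygy module, as the kernel of its minimal presentation. *)
Lemma syz_iso_of_h0_iso g g' D D' tau w0 :
  primitive_family g -> primitive_family g' ->
  (forall i, g i \is D.-homog) -> (forall i, g' i \is D'.-homog) ->
  h0_iso g g' tau -> in_sat g w0 -> ~ in_ideal g w0 ->
  exists rho, syz_iso g g' D D' rho.
Proof.
move=> pg pg' hg hg' hi s0 n0.
have [m [h [dg [hh hs gen]]]] := sat_generators hg.
have /choice [h' hh'] : forall j, exists w', w' \is (dg j).-homog /\ tau (h j) w'.
  by move=> j; have [w' ? ?] := hi_total hi (hs j) (hh j); exists w'.
have tau0 : tau 0 0.
  have [w [w' t0]] : exists w w', tau w w'.
    have [w' _ t0] := hi_total hi (in_ideal_sat (in_ideal_mem g i0)) (hg i0).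
    by exists (g i0), w'.
  by have := hi_lin hi (-1) t0 t0; rewrite !mulN1r !addNr.
have tauB B : tau (dot h B) (dot h' B).
  rewrite /dot; elim/big_ind2: _ => // [x x' y y' tx ty|j _].
    by have := hi_lin hi 1 tx ty; rewrite !mul1r.
  by have := hi_lin hi (B 0 j) (hh' j).2 tau0; rewrite !addr0.
have hh'0 j : h' j \is (dg j).-homog by case: (hh' j).
have [t [Am [Bm [c hP]]]] : exists t Am Bm c, @presentation g D m h dg t Am Bm c.
  apply: (exists_presentation hg hh) => // w /gen [b eb].
  by exists 0, b; rewrite dot0 add0r.
(* the images [h'] of the generators present the second module as well *)
have [t' [Am' [Bm' [c' hP']]]] : exists t Am Bm c, @presentation g' D' m h' dg t Am Bm c.
  apply: (exists_presentation hg' hh'0) => [w' sw'|j]; last exact: (hi_sat hi (hh' j).2).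
  have [w sw tw] := hi_onto hi sw'; have [b eb] := gen w sw.
  have := hi_lin hi (-1) (tauB b) tw; rewrite !mulN1r eb addNr.
  move=> /(hi_ideal hi) [+ _]; case; first by exists 0; rewrite dot0.
  move=> a ea; exists a, b; rewrite ea; ring.
have [F1 F2 F3 F4 F5] := hP; have [F1' F2' F3' F4' F5'] := hP'.
have dd n (d : 'I_n -> nat) j : vpart d (d j) (delta_mx 0 j) = delta_mx 0 j.
  apply: vpart_id => i; rewrite mxE eqxx /=; case: eqP => [->|_]; last exact: whomog_zero.
  move=> mm; rewrite mcoeff1; case: (mm =P 0%MM) => [->|_]; last by rewrite eqxx.
  by rewrite mdeg0.
have flip A B : dot g A + dot h B = 0 -> exists A', dot g' A' + dot h' B = 0.
  move=> e; have [+ _] := hi_ideal hi (tauB B); case.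
    by exists (- A); rewrite -scaleN1r dotZ mulN1r; apply/eqP; rewrite -subr_eq0 -opprD e oppr0.
  by move=> a ea; exists (- a); rewrite -scaleN1r dotZ mulN1r ea addNr.
have flip' A' B : dot g' A' + dot h' B = 0 -> exists A, dot g A + dot h B = 0.
  move=> e; have [_] := hi_ideal hi (tauB B); case.
    by exists (- A'); rewrite -scaleN1r dotZ mulN1r; apply/eqP; rewrite -subr_eq0 -opprD e oppr0.
  by move=> a ea; exists (- a); rewrite -scaleN1r dotZ mulN1r ea addNr.
(* lifts [Tm] and [Tm'] of the isomorphism and of its inverse to the free covers *)
have /choice [T hT] : forall j, exists b : 'rV_t', vhomog c' (c j) b /\ row j Bm = b *m Bm'.
  move=> j; have [A' e] := flip _ _ (F1 (delta_mx 0 j)); have [b [_ eb]] := F2' _ _ e.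
  exists (vpart c' (c j) b); split; first exact: vpart_vhomog.
  by rewrite -F5' -eb F5 dd -rowE.
have /choice [T' hT'] : forall j, exists b : 'rV_t, vhomog c (c' j) b /\ row j Bm' = b *m Bm.
  move=> j; have [A' e] := flip' _ _ (F1' (delta_mx 0 j)); have [b [_ eb]] := F2 _ _ e.
  exists (vpart c (c' j) b); split; first exact: vpart_vhomog.
  by rewrite -F5 -eb F5' dd -rowE.
pose Tm := \matrix_j T j; pose Tm' := \matrix_j T' j.
have eT : Bm = Tm *m Bm'.
  by apply/row_matrixP => j; rewrite row_mul rowK; case: (hT j).
have eT' : Bm' = Tm' *m Bm.
  by apply/row_matrixP => j; rewrite row_mul rowK; case: (hT' j).
have wT j l : whomog (c' l) (c j) (Tm j l) by rewrite mxE; case: (hT j) => + _; exact.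
have wT' j l : whomog (c l) (c' j) (Tm' j l) by rewrite mxE; case: (hT' j) => + _; exact.
have [b0 eb0] := gen w0 s0.
have s0' : in_sat g' (dot h' b0) := hi_sat hi (tauB b0).
have n0' : ~ in_ideal g' (dot h' b0) by move/(hi_ideal hi (tauB b0)); rewrite eb0.
have min := presentation_minimal pg hP s0 n0.
have min' := presentation_minimal pg' hP' s0' n0'.
(* [V *m V'] differs from the identity by rows in the kernel of the presentation *)
have inv n n' (C : 'M[P]_(n, m)) (d : 'I_n -> nat) (d' : 'I_n' -> nat) (V : 'M_(n, n')) (V' : 'M_(n', n)) :
    (forall j l, whomog (d' l) (d j) (V j l)) -> (forall j l, whomog (d l) (d' j) (V' j l)) ->
    (forall a : 'rV_n, a *m C = 0 -> forall j, (a 0 j)@_0 = 0) ->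
    V *m V' *m C = C -> exists S, V *m V' *m S = 1%:M.
  move=> hV hV' hC eC; pose E := V *m V' - 1%:M.
  have [||S hS] := @graded_unipotent n d E.
  - move=> i j; rewrite /E !mxE; apply: whomogB.
      by apply: whomog_sum => k _; apply: whomogM (hV i k) (hV' k j).
    case: (i =P j) => [->|_]; last exact: whomog_zero.
    move=> mm; rewrite mcoeff1; case: (mm =P 0%MM) => [->|_]; last by rewrite eqxx.
    by rewrite mdeg0.
  - move=> i j; have := hC (row i E) _ j; rewrite mxE; apply.
    by rewrite -row_mul /E mulmxBl eC mul1mx subrr row0.
  by exists S; rewrite -hS /E addrC subrK.
have [S hS] := inv _ _ Bm _ _ Tm Tm' wT wT' min (etrans (esym (mulmxA _ _ _)) (etrans (congr1 (mulmx Tm) (esym eT')) (esym eT))).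
have [S' hS'] := inv _ _ Bm' _ _ Tm' Tm wT' wT min' (etrans (esym (mulmxA _ _ _)) (etrans (congr1 (mulmx Tm') (esym eT)) (esym eT'))).
clear inv min min'.
have injT (a : 'rV_t) : a *m Tm = 0 -> a = 0.
  by move=> e; rewrite -[a]mulmx1 -hS !mulmxA e !mul0mx.
have surT (b : 'rV_t') : exists a, b = a *m Tm.
  by exists (b *m S' *m Tm'); rewrite -!mulmxA (mulmx1C hS') mulmx1.
exists (fun A A' => exists a, [/\ A = a *m Am, a *m Bm = 0 & A' = a *m Tm *m Am']).
split.
- move=> A SA; have [|a [ea eb]] := F2 A 0; first by rewrite SA dot0 addr0.
  by exists (a *m Tm *m Am'), a.
- move=> A' SA'; have [|b [ea eb]] := F2' A' 0; first by rewrite SA' dot0 addr0.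
  have [a ea'] := surT b; exists (a *m Am), a; split=> //; last by rewrite -ea'.
  by rewrite eT mulmxA -ea' -eb.
- move=> A A' [a [-> e2 ->]]; split; rewrite /syz.
    by rewrite -[RHS](F1 a) e2 dot0 addr0.
  by rewrite -[RHS](F1' (a *m Tm)) -[_ *m Bm']mulmxA -eT e2 dot0 addr0.
- move=> x A A1 A' A1' [a [-> e2 ->]] [b [-> e2' ->]]; exists (x *: a + b).
  by rewrite !mulmxDl -!scalemxAl e2 e2' scaler0 addr0.
- move=> A [a [-> e2 e3]]; have -> : a = 0; last by rewrite mul0mx.
  by apply: injT; apply: F3' => //; rewrite -mulmxA -eT.
- move=> A' [a [e1 e2 ->]]; rewrite (F3 a) ?mul0mx //.
- move=> k A A' [a [-> e2 ->]] hA.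
  have ha : vhomog c k a.
    have <- : vpart c k a = a; last exact: vpart_vhomog.
    apply/eqP; rewrite -subr_eq0; apply/eqP/F3; rewrite mulmxBl.
      by rewrite -F4 vpart_id ?subrr.
    by rewrite -F5 e2 vpart0 subrr.
  rewrite -(vpart_id (v := a *m Tm) (dg := c') (k := k)).
    by rewrite -F4'; exact: vpart_vhomog.
  by move=> l; rewrite mxE; apply: whomog_sum => j _; apply: whomogM (ha j) (wT j l).
Qed.
End Horrocks.

(** * From syzygies to local cohomology *)
Section Cech.
Variable K : fieldType.
Local Notation P := {mpoly K[3]}.
Implicit Types g : 'I_3 -> P.

Lemma syz_iso0 g g' s s' rho A B : syz_iso g g' s s' rho -> rho A B -> rho 0 0.
Proof. by move=> h r; have := si_lin h (-1) r r; rewrite !scaleN1r !addNr. Qed.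

Lemma syz_isoZ g g' s s' rho a A B : syz_iso g g' s s' rho -> rho A B ->
  rho (a *: A) (a *: B).
Proof. by move=> h r; have := si_lin h a r (syz_iso0 h r); rewrite !addr0. Qed.

Lemma syz_isoD g g' s s' rho A B A' B' : syz_iso g g' s s' rho ->
  rho A B -> rho A' B' -> rho (A + A') (B + B').
Proof. by move=> h r r'; have := si_lin h 1 r r'; rewrite !scale1r. Qed.

Lemma syz_isoN g g' s s' rho A B : syz_iso g g' s s' rho -> rho A B -> rho (- A) (- B).
Proof. by move=> h r; have := syz_isoZ (-1) h r; rewrite !scaleN1r. Qed.

Lemma syz_isoB g g' s s' rho A B A' B' : syz_iso g g' s s' rho ->
  rho A B -> rho A' B' -> rho (A - A') (B - B').
Proof.
by move=> h r r'; have := si_lin h (-1) r' r; rewrite !scaleN1r ![- _ + _]addrC.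
Qed.

Lemma syz_iso_part g g' D rho k A B : (forall i, g i \is D.-homog) ->
  syz_iso g g' D D rho -> rho A B -> rho (vpart (fun=> D) k A) (vpart (fun=> D) k B).
Proof.
move=> hg h r; have [SA _] := si_syz h r.
have /choice [C hC] : forall j, exists C, rho (vpart (fun=> D) j A) C.
  by move=> j; apply: (si_total h); exact: (syz_graded hg j SA).
have [N hN] := vpart_sum (fun=> D) A; pose M := maxn N k.+1.
have rs : rho (\sum_(j < M) vpart (fun=> D) j A) (\sum_(j < M) C j).
  elim/big_ind2: _ => [|A1 B1 A2 B2 r1 r2|j _]; first exact: (syz_iso0 h r).
    by have := si_lin h 1 r1 r2; rewrite !scale1r.
  exact: hC.
rewrite -hN ?leq_maxl // in rs.
have eB := si_unique h r rs.
suff <- : C k = vpart (fun=> D) k B by exact: hC.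
have kM : (k < M)%N by rewrite leq_maxr.
apply/rowP => i; rewrite mxE eB summxE raddf_sum (bigD1 (Ordinal kM)) //= big1 ?addr0.
  by rewrite wpart_id //; apply: (si_homog h (hC k)); exact: vpart_vhomog.
move=> j jk; apply: (@wpart_ne _ _ _ j).
  by apply: contraNneq jk => e; apply/eqP/val_inj.
by apply: (si_homog h (hC j)); exact: vpart_vhomog.
Qed.

Lemma syz_iso_sym g g' D rho : (forall i, g i \is D.-homog) ->
  syz_iso g g' D D rho -> syz_iso g' g D D (fun A B => rho B A).
Proof.
move=> hg h; split=> [||A B|a A B A' B'|||k A B r hA].
- exact: si_onto h.
- exact: si_total h.
- by move/(si_syz h) => [].
- by move=> r r'; exact: (si_lin h).
- by move=> A r; exact: (si_fun h r).
- by move=> A r; exact: (si_inj h r).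
have r' := syz_iso_part k hg h r; rewrite (vpart_id hA) in r'.
have -> : B = vpart (fun=> D) k B; last exact: vpart_vhomog.
apply/eqP; rewrite -subr_eq0; apply/eqP/(si_inj h).
by have := syz_isoB h r r'; rewrite subrr.
Qed.

Lemma in_sat_powers g n w : (forall i, in_ideal g ('X_i ^+ n * w)) -> in_sat g w.
Proof.
move=> hn; exists (n * 3)%N => e h ne hh.
have /in_monoP [a ->] : in_mono n predT h.
  move=> m; rewrite -mcoeff_msupp => /(dhomog_mf hh) em; apply: contrapT => no.
  have lt i : (m i < n)%N by rewrite ltnNge; apply/negP => ni; apply: no; exists i.
  have : (mdeg m < n * 3)%N.
    by rewrite mdegE big3; have := lt i0; have := lt i1; have := lt i2; lia.
  by have : mdeg m = e by []; lia.
rewrite mulr_suml; apply: in_ideal_sum => i _.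
by rewrite mulrAC mulrC; exact: in_idealM.
Qed.

Variables (g g' : 'I_3 -> P) (D : nat) (rho : 'rV[P]_3 -> 'rV[P]_3 -> Prop).
Hypotheses (hg : forall i, g i \is D.-homog) (hg' : forall i, g' i \is D.-homog).
Local Notation x n i := ('X_i ^+ n : P).

(** Local cohomology through Cech cocycles of the syzygies: if [X_i^n w] is
    [A_i] paired with [g] then the [X_i^n A_j - X_j^n A_i] are syzygies, and their
    class modulo coboundaries is that of [w] modulo the ideal. *)
Definition cech_witness n w w' (A A' : 'I_3 -> 'rV[P]_3) :=
  [/\ forall i, dot g (A i) = x n i * w, forall i, dot g' (A' i) = x n i * w' &
      forall i j, rho (x n i *: A j - x n j *: A i) (x n i *: A' j - x n j *: A' i)].

Definition cech_rel w w' := exists n A A', cech_witness n w w' A A'.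

Hypothesis h : syz_iso g g' D D rho.

Lemma cech_raise n k w w' A A' : cech_witness n w w' A A' ->
  cech_witness (n + k) w w' (fun i => x k i *: A i) (fun i => x k i *: A' i).
Proof.
move=> [hA hA' hr]; split=> [i|i|i j].
- by rewrite dotZ hA exprD; ring.
- by rewrite dotZ hA' exprD; ring.
by rewrite !exprD !cocycle_raise; exact: (syz_isoZ _ h).
Qed.

Lemma cech_lin a v w v' w' : cech_rel v v' -> cech_rel w w' ->
  cech_rel (a * v + w) (a * v' + w').
Proof.
move=> [n [A [A' /cech_raise hA]]] [k [B [B' /cech_raise hB]]].
have [A1 A2 A3] := hA k; have := hB n; rewrite (addnC k n) => -[B1 B2 B3].
exists (n + k)%N, (fun i => a *: (x k i *: A i) + x n i *: B i),
  (fun i => a *: (x k i *: A' i) + x n i *: B' i); split=> [i|i|i j].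
- by rewrite dotP A1 B1 mulrDr mulrCA.
- by rewrite dotP A2 B2 mulrDr mulrCA.
by rewrite !cocycle_lin; apply: (si_lin h).
Qed.

(** The images of the cocycle satisfy the relation between its three members, so they
    come from rows [v i] by exactness of the Koszul complex; they are syzygies, so
    the values [dot g' (v i)] glue to [w']. *)
Lemma cech_total w : in_sat g w -> exists w', cech_rel w w'.
Proof.
move=> [n hn]; have /choice [A hA] : forall i, exists a, dot g a = x n i * w.
  move=> i; apply: (hn n) => //.
  exact: Xn_homog.
have SC i j : syz g (x n i *: A j - x n j *: A i).
  by rewrite /syz dotB !dotZ !hA; ring.
have [C0 r0] := si_total h (SC i1 i2); have [C1 r1] := si_total h (SC i2 i0).
have [C2 r2] := si_total h (SC i0 i1).
pose C i := if i == i0 then C0 else if i == i1 then C1 else C2.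
have [|v [v0 v1 v2]] := @koszul_cycle_row K n 3 C.
  apply: (si_fun h); rewrite big3 /C /=.
  have := syz_isoD h (syz_isoD h (syz_isoZ (x n i0) h r0) (syz_isoZ (x n i1) h r1))
            (syz_isoZ (x n i2) h r2).
  by rewrite koszul_boundary.
rewrite /C /= in v0 v1 v2.
have [_ S0] := si_syz h r0; have [_ S1] := si_syz h r1; have [_ S2] := si_syz h r2.
rewrite v0 /syz dotB !dotZ in S0; rewrite v1 /syz dotB !dotZ in S1.
rewrite v2 /syz dotB !dotZ in S2.
have [|w' hw'] := @koszul_glue K n (fun i => dot g' (v i)).
  move/eqP: S0; rewrite subr_eq0 => /eqP S0; move/eqP: S1; rewrite subr_eq0 => /eqP S1.
  move/eqP: S2; rewrite subr_eq0 => /eqP S2.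
  apply: ord3P; apply: ord3P; [exact: erefl | exact: S2 | exact: esym S1 |
    exact: esym S2 | exact: erefl | exact: S0 | exact: S1 | exact: esym S0 | exact: erefl].
exists w', n, A, v; split=> // i j.
pose Q i j := rho (x n i *: A j - x n j *: A i) (x n i *: v j - x n j *: v i).
have rev a b : Q a b -> Q b a by move=> r; have := syz_isoN h r; rewrite !opprB.
have diag a : Q a a by rewrite /Q !subrr; exact: (syz_iso0 h r0).
have q12 : Q i1 i2 by rewrite /Q -v0.
have q20 : Q i2 i0 by rewrite /Q -v1.
have q01 : Q i0 i1 by rewrite /Q -v2.
change (Q i j); move: i j; apply: ord3P; apply: ord3P;
  [exact: diag | exact: q01 | exact: rev | exact: rev | exact: diag |
   exact: q12 | exact: q20 | exact: rev | exact: diag].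
Qed.

Lemma wpart_Xn s n k i (p : P) : wpart s (n + k) (x n i * p) = x n i * wpart s k p.
Proof.
rewrite mulrC [RHS]mulrC -(wpart_shift s k n) [in RHS]addnC [(k + n)%N]addnC.
apply: wpartM; suff : whomog (0 + s) (n + s) (x n i) by rewrite add0n addnC.
apply/whomog_shift/whomog0.
exact: Xn_homog.
Qed.

Lemma cech_part k w w' : cech_rel w w' -> cech_rel (wpart 0 k w) (wpart 0 k w').
Proof.
move=> [n [A [A' [hA hA' hr]]]].
exists n, (fun i => vpart (fun=> D) (n + k) (A i)), (fun i => vpart (fun=> D) (n + k) (A' i)).
have dotv q (B : 'rV[P]_3) l : (forall i, q i \is D.-homog) ->
    dot q (vpart (fun=> D) l B) = wpart 0 l (dot q B).
  move=> hq; rewrite raddf_sum; apply: eq_bigr => i _ /=; rewrite mxE.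
  exact/esym/wpartM/whomog0.
split=> [i|i|i j]; rewrite ?dotv // ?hA ?hA' ?wpart_Xn //.
have e (B : 'I_3 -> 'rV[P]_3) : vpart (fun=> D) (n + (n + k)) (x n i *: B j - x n j *: B i) =
    x n i *: vpart (fun=> D) (n + k) (B j) - x n j *: vpart (fun=> D) (n + k) (B i).
  by apply/rowP => l; rewrite !mxE raddfB /= !wpart_Xn.
by rewrite -!e; apply: syz_iso_part hg h _.
Qed.

(** A presentation of [w] by the ideal makes the cocycle a coboundary. *)
Lemma cech_ideal w w' : cech_rel w w' -> in_ideal g w -> in_ideal g' w'.
Proof.
move=> [n [A [A' [hA hA' hr]]]] [B eB].
have /choice [E hE] : forall i, exists E, rho (A i - x n i *: B) E.
  by move=> i; apply: (si_total h); rewrite /syz dotB dotZ hA eB subrr.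
have [|z hz] := @koszul_glue_row K n 3 (fun i => A' i - E i).
  move=> i j; apply: cocycle_diff; apply: (si_unique h) (hr i j) _.
  have := syz_isoB h (syz_isoZ (x n i) h (hE j)) (syz_isoZ (x n j) h (hE i)).
  by rewrite cocycle_cobound.
exists z; apply: (mulfI (Xn_neq0 K n i0)); rewrite -dotZ -hz dotB hA'.
by have [_ SE] := si_syz h (hE i0); rewrite SE subr0.
Qed.
End Cech.

Lemma h0_iso_of_syz_iso (K : fieldType) (g g' : 'I_3 -> {mpoly K[3]}) D rho :
  (forall i, g i \is D.-homog) -> (forall i, g' i \is D.-homog) ->
  syz_iso g g' D D rho -> h0_iso g g' (cech_rel g g' rho).
Proof.
move=> hg hg' h; have h' := syz_iso_sym hg h.
have flip w w' : cech_rel g' g (fun A B => rho B A) w' w -> cech_rel g g' rho w w'.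
  by move=> [n [A [A' [? ? hr]]]]; exists n, A', A; split=> // i j; exact: hr.
have flip' w w' : cech_rel g g' rho w w' -> cech_rel g' g (fun A B => rho B A) w' w.
  by move=> [n [A [A' [? ? hr]]]]; exists n, A', A; split=> // i j; exact: hr.
split.
- move=> k w sw hw; have [w' r] := cech_total h sw; exists (wpart 0 k w').
    exact/whomog0/wpart_whomog.
  have hw0 : whomog 0 k w by exact/whomog0.
  by rewrite -{1}(wpart_id hw0); exact: cech_part hg hg' h _ _ _ r.
- move=> w' sw'; have [w r] := cech_total h' sw'.
  exists w; last exact: flip.
  by have [n [A [A' [_ hA' _]]]] := r; apply: (@in_sat_powers _ _ n) => i; exists (A' i).
- by move=> w w' [n [A [A' [_ hA' _]]]]; apply: (@in_sat_powers _ _ n) => i; exists (A' i).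
- move=> a v w v' w'; exact: (cech_lin h).
- by move=> w w' r; split; [exact: (cech_ideal h r) | exact: (cech_ideal h' (flip' _ _ r))].
Qed.

(** * Local cohomology modules and relations between polynomials *)
Section GmodIso.
Variable K : fieldType.
Local Notation P := {mpoly K[3]}.

(** An isomorphism is specified by its graph, so that maps defined through auxiliary
    choices need not be shown independent of them. *)
Lemma linear_iso_of_rel (M N : lmodType P) (R : M -> N -> Prop) :
  (forall x, exists y, R x y) -> (forall y, exists x, R x y) ->
  (forall a x y x' y', R x y -> R x' y' -> R (a *: x + x') (a *: y + y')) ->
  (forall x, R x 0 -> x = 0) -> (forall y, R 0 y -> y = 0) ->
  exists (phi : {linear M -> N}) (psi : {linear N -> M}),
    [/\ cancel phi psi, cancel psi phi & forall x, R x (phi x)].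
Proof.
move=> tot ont lin inj fun0.
have sub x y x' y' : R x y -> R x' y' -> R (x - x') (y - y').
  by move=> r r'; have := lin (-1) _ _ _ _ r' r; rewrite !scaleN1r ![- _ + _]addrC.
have uni x y y' : R x y -> R x y' -> y = y'.
  move=> r r'; apply/eqP; rewrite -subr_eq0; apply/eqP/fun0.
  by have := sub _ _ _ _ r r'; rewrite subrr.
have inj' x x' y : R x y -> R x' y -> x = x'.
  move=> r r'; apply/eqP; rewrite -subr_eq0; apply/eqP/inj.
  by have := sub _ _ _ _ r r'; rewrite subrr.
have [phi hphi] := choice tot; have [psi hpsi] := choice ont.
have lphi : linear phi by move=> a x y; apply: uni (hphi _) (lin _ _ _ _ _ (hphi x) (hphi y)).
have lpsi : linear psi by move=> a x y; apply: inj' (hpsi _) (lin _ _ _ _ _ (hpsi x) (hpsi y)).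
pose F : {linear M -> N} := HB.pack phi (GRing.isLinear.Build P M N _ phi lphi).
pose G : {linear N -> M} := HB.pack psi (GRing.isLinear.Build P N M _ psi lpsi).
exists F, G; split=> [x|y|x] //=; first exact: inj' (hpsi _) (hphi x).
exact: uni (hphi _) (hpsi y).
Qed.

Lemma gmod_iso_of_rel (M N : gmod K) (R : M -> N -> Prop) :
  (forall x, exists y, R x y) -> (forall y, exists x, R x y) ->
  (forall a x y x' y', R x y -> R x' y' -> R (a *: x + x') (a *: y + y')) ->
  (forall x, R x 0 -> x = 0) -> (forall y, R 0 y -> y = 0) ->
  (forall k x y, R x y -> ofdeg k x -> ofdeg k y) -> gmod_iso M N.
Proof.
move=> tot ont lin inj fun0 deg.
have [phi [psi [K1 K2 r]]] := linear_iso_of_rel tot ont lin inj fun0.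
by exists phi; split=> [|k x]; [exists psi | exact: (deg k x (phi x) (r x))].
Qed.

Implicit Types X : plane_curve K.

Lemma torsE X (w : P) : qproj (jacobian_ideal X) w \in in_tors (M := Rjac X) <->
  in_sat (grad X) w.
Proof.
apply: iff_trans (tors_Rjac X w) _; split=> -[n hn]; exists n => e h ne hh.
  exact/jacP/(hn e).
exact/jacP/(hn e).
Qed.

Lemma qprojE X (v w : P) : qproj (jacobian_ideal X) v = qproj (jacobian_ideal X) w <->
  in_ideal (grad X) (v - w).
Proof. by apply: iff_trans (@proj_eq _ _ (jacobian_ideal X) v w) _; exact: jacP. Qed.

Lemma qproj0E X (v : P) : qproj (jacobian_ideal X) v = 0 <-> in_ideal (grad X) v.
Proof. by apply: iff_trans (@proj_eq0 _ _ (jacobian_ideal X) v) _; exact: jacP. Qed.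

Definition h0_class X w (hw : in_sat (grad X) w) : H0m (Rjac X) :=
  exist (fun x => x \in in_tors (M := Rjac X)) _ (proj2 (torsE X w) hw).

Lemma h0_classP X (x : H0m (Rjac X)) : exists w : P,
  in_sat (grad X) w /\ val x = qproj (jacobian_ideal X) w.
Proof.
have [w ew] := proj_onto (val x); exists w; split=> //.
by apply/torsE; rewrite -ew; exact: valP x.
Qed.

Lemma h0_iso_total g g' D tau w : (forall i, g i \is D.-homog) ->
  @h0_iso K g g' tau -> in_sat g w -> exists w', tau w w'.
Proof.
move=> hg hi sw; have [N hN] := wpart_sum 0 w; rewrite (hN N) //.
have [w0 t0] : exists w', tau 0 w'.
  have [w' _ t] := hi_total hi (in_ideal_sat (in_ideal_mem g i0)) (hg i0).
  by have := hi_lin hi (-1) t t; rewrite mulN1r addNr; exists (-1 * w' + w').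
elim: (N) => [|M [w' IH]]; first by rewrite big_ord0; exists w0.
have [v' _ t] := hi_total hi (in_sat_part hg M sw) (proj1 (whomog0 _ _) (@wpart_whomog _ _ 0 M w)).
by rewrite big_ord_recr /=; exists (1 * w' + v'); rewrite -[X in tau (X + _)]mul1r; exact: (hi_lin hi).
Qed.

Lemma gmod_iso_of_h0_iso X X' tau : h0_iso (grad X) (grad X') tau ->
  gmod_iso (H0m (Rjac X)) (H0m (Rjac X')).
Proof.
move=> hi; pose q := qproj (jacobian_ideal X); pose q' := qproj (jacobian_ideal X').
pose R (x : H0m (Rjac X)) (y : H0m (Rjac X')) := exists w w' : P,
  [/\ tau w w', in_sat (grad X) w, val x = q w & val y = q' w'].
apply: (@gmod_iso_of_rel _ _ R).
- move=> x; have [w [sw ex]] := h0_classP x.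
  have [w' t] := h0_iso_total (grad_homog X) hi sw.
  by exists (h0_class (hi_sat hi t)), w, w'.
- move=> y; have [w' [sw' ey]] := h0_classP y; have [w sw t] := hi_onto hi sw'.
  by exists (h0_class sw), w, w'.
- move=> a x y x' y' [v [v' [t1 s1 e1 e2]]] [w [w' [t2 s2 e3 e4]]].
  exists (a * v + w), (a * v' + w'); split; first exact: (hi_lin hi).
  + by have [_ h] := in_sat_submod (grad X); exact: h.
  + by rewrite /= e1 e3 -projZ -projD.
  + by rewrite /= e2 e4 -projZ -projD.
- move=> x [w [w' [t sw ex /esym/qproj0E hw']]]; apply: val_inj; rewrite ex.
  exact/qproj0E/(hi_ideal hi t).
- move=> y [w [w' [t sw /esym/qproj0E hw ey]]]; apply: val_inj; rewrite ey.
  exact/qproj0E/(hi_ideal hi t).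
move=> k x y [w [w' [t sw ex ey]]] [v hv ev].
have sv : in_sat (grad X) v by apply/torsE; rewrite -ev; exact: valP x.
have [v' hv' tv] := hi_total hi sv hv; exists v' => //.
rewrite ey; apply/qprojE; have := hi_lin hi (-1) tv t; rewrite !mulN1r => t'.
rewrite addrC; apply/(hi_ideal hi t'); rewrite addrC; apply/qprojE.
by rewrite -/q -ex.
Qed.

Lemma h0_iso_of_gmod_iso X X' : gmod_iso (H0m (Rjac X)) (H0m (Rjac X')) ->
  exists tau, h0_iso (grad X) (grad X') tau.
Proof.
move=> [psi [[psi' K1 K2] hpsi]].
pose q := qproj (jacobian_ideal X); pose q' := qproj (jacobian_ideal X').
exists (fun w w' => exists x : H0m (Rjac X), val x = q w /\ val (psi x) = q' w'); split.
- move=> k w sw hw; pose x := h0_class sw.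
  have [w' hw' e] : @ofdeg _ (H0m (Rjac X')) k (psi x) by apply: hpsi; exists w.
  by exists w' => //; exists x.
- move=> w' sw'; have [w [sw ex]] := h0_classP (psi' (h0_class sw')).
  by exists w => //; exists (psi' (h0_class sw')); rewrite K2.
- by move=> w w' [x [_ e]]; apply/torsE; rewrite -/q' -e; exact: valP (psi x).
- move=> a v w v' w' [x [e1 e2]] [y [e3 e4]]; exists (a *: x + y); split.
    by rewrite /= e1 e3 -projZ -projD.
  by rewrite linearP /= e2 e4 -projZ -projD.
move=> w w' [x [e1 e2]]; split=> hw.
  apply/qproj0E; rewrite -/q' -e2; have -> : x = 0 by apply: val_inj; rewrite e1; exact/qproj0E.
  by rewrite linear0.
apply/qproj0E; rewrite -/q -e1; have -> : x = 0; last by [].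
apply: (can_inj K1); rewrite linear0; apply: val_inj; rewrite e2; exact/qproj0E.
Qed.
End GmodIso.

(** * Logarithmic vector fields as syzygies *)
Section SheafIso.
Variable K : fieldType.
Local Notation P := {mpoly K[3]}.

Lemma omod_iso_trans (A B C : omod K) : omod_iso A B -> omod_iso B C -> omod_iso A C.
Proof.
move=> [phi hphi] [psi hpsi].
have hres U V (h : zsub V U) (s : A U) :
    (psi V \o phi V) (om_res h s) = om_res h ((psi U \o phi U) s).
  by rewrite /= !oh_res.
exists (@OModHom K A C (fun U => psi U \o phi U : {linear A U -> C U}) hres) => U.
exact: bij_comp (hpsi U) (hphi U).
Qed.

Lemma omod_inverse (A B : omod K) (phi : omod_hom A B) :
  (forall U, bijective (phi U)) -> exists psi : omod_hom B A,
  forall U, cancel (phi U) (psi U) /\ cancel (psi U) (phi U).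
Proof.
move=> hphi; have hg U : {g : B U -> A U | cancel (phi U) g /\ cancel g (phi U)}.
  by apply: cid; have [g K1 K2] := hphi U; exists g.
pose g U := sval (hg U).
have K1 U : cancel (phi U) (g U) by case: (svalP (hg U)).
have K2 U : cancel (g U) (phi U) by case: (svalP (hg U)).
have lg U : linear (g U).
  by move=> a x y; apply: (can_inj (K1 U)); rewrite linearP !K2.
pose G U : {linear B U -> A U} :=
  HB.pack (g U) (GRing.isLinear.Build (regfun U) (B U) (A U) _ (g U) (lg U)).
have hres U V (h : zsub V U) (s : B U) : G V (om_res h s) = om_res h (G U s).
  by apply: (can_inj (K1 V)); rewrite /= K2 oh_res K2.
by exists (@OModHom K B A G hres) => U; split; [exact: K1 | exact: K2].
Qed.

Lemma omod_iso_sym (A B : omod K) : omod_iso A B -> omod_iso B A.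
Proof.
move=> [phi /omod_inverse [psi hpsi]]; exists psi => U; have [K1 K2] := hpsi U.
by exists (phi U).
Qed.

Section TildeIso.
Variables (M N : gmod K) (a : nat) (phi : {linear M -> N}) (psi : {linear N -> M}).
Hypotheses (K1 : cancel phi psi) (K2 : cancel psi phi).
Hypotheses (dphi : forall k x, ofdeg k x -> ofdeg k (phi x)).
Hypotheses (dpsi : forall k x, ofdeg k x -> ofdeg k (psi x)).

Lemma stalk_mapK p : cancel (stalk_map (fun k => @dphi (k + a)) (p := p))
  (stalk_map (fun k => @dpsi (k + a)) (p := p)).
Proof.
move=> x; have [y ->] := germ_onto x; rewrite !stalk_mapE; apply: germ_val => /=.
by rewrite K1 -surjective_pairing.
Qed.
End TildeIso.

Lemma tilde_iso (M N : gmod K) a (phi : {linear M -> N}) (psi : {linear N -> M}) :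
  cancel phi psi -> cancel psi phi ->
  (forall k x, ofdeg k x -> ofdeg k (phi x)) ->
  (forall k x, ofdeg k x -> ofdeg k (psi x)) -> omod_iso (tilde M a) (tilde N a).
Proof.
move=> K1 K2 dphi dpsi.
exists (tilde_hom (h := phi) (a := a) (b := a) (fun k => @dphi (k + a))) => U.
exists (tsec_map (h := psi) (a := a) (b := a) (fun k => @dpsi (k + a)) (U := U)) => s.
  by apply: tsec_eq => p Up; exact: (stalk_mapK K1).
by apply: tsec_eq => p Up; exact: (stalk_mapK K2).
Qed.

Lemma stalk_map_inj (M N : gmod K) (a b : nat) (h : {linear M -> N})
    (hdeg : forall k x, ofdeg (k + a) x -> ofdeg (k + b) (h x)) p :
  (forall x, h x = 0 -> x = 0) -> injective (stalk_map (h := h) hdeg (p := p)).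
Proof.
move=> hinj x y; have [x' ->] := germ_onto x; have [y' ->] := germ_onto y.
rewrite !stalk_mapE => /germ_eq/asboolP [e [u [hu pu k]]].
apply/germ_eq/asboolP; exists e, u; split=> //; apply: hinj.
by rewrite (linearZ_LR h) linearB !(linearZ_LR h).
Qed.

Fact zopenD_open (u : P) k : u \is k.-homog ->
  exists T : P -> Prop, (forall g, T g -> exists k, g \is k.-homog) /\
    forall p : ppoint K, (u \notin pt_ideal p) <-> exists2 g, T g & g \notin pt_ideal p.
Proof.
move=> hu; exists (eq u); split=> [g <-|p]; first by exists k.
by split=> [|[g <-]]; first by exists u.
Qed.
Definition zopenD (u : P) k (hu : u \is k.-homog) : zopen K := ZOpen (zopenD_open hu).
End SheafIso.

Section LogSheaf.
Variable K : fieldType.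
Hypothesis char0 : [pchar K] =i pred0.
Local Notation P := {mpoly K[3]}.
Variable X : plane_curve K.
Local Notation D := (cdeg X).-1.

Definition in_syz : {pred gfree K 3} := [pred A : 'rV[P]_3 | dot (grad X) A == 0].

Fact in_syz_closed : submod_closed in_syz.
Proof.
split=> [|a A B]; first by rewrite inE dot0.
by rewrite !inE dotP => /eqP -> /eqP ->; rewrite mulr0 addr0.
Qed.

Lemma free_vhomog k (A : gfree K 3) : ofdeg k A <-> vhomog (fun=> D) (k + D) A.
Proof.
split=> h i; last by apply/whomog0; apply/(whomog_shift 0 k D)/h.
by apply/(whomog_shift 0 k D)/whomog0/h.
Qed.

Fact in_syz_graded n (c : nat -> gfree K 3) : (forall k, ofdeg k (c k)) ->
  \sum_(k < n) c k \in in_syz -> forall k, (k < n)%N -> c k \in in_syz.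
Proof.
move=> hc; rewrite inE => /eqP hs k kn; rewrite inE; apply/eqP.
have := syz_graded (grad_homog X) (k + D) hs; suff -> : vpart (fun=> D) (k + D) (\sum_(k < n) c k) = c k by [].
apply/rowP => i; rewrite mxE summxE raddf_sum (bigD1 (Ordinal kn)) //= big1 ?addr0.
  by apply/wpart_id; exact: (proj1 (free_vhomog k (c k)) (hc k)).
move=> j jk; apply: (@wpart_ne _ _ _ (j + D)%N); last exact: (proj1 (free_vhomog j (c j)) (hc j)).
by rewrite eqn_add2r; apply: contraNneq jk => e; apply/eqP/val_inj.
Qed.

Definition syz_gmod : gmod K := gsub (GSubmod in_syz_closed in_syz_graded).

Definition to_tangent (A : syz_gmod) : tangent_gmod K :=
  qproj (gspan (M := gfree K 3) (euler_field_homog K)) (val A).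

Fact to_tangent_linear : linear to_tangent.
Proof. by move=> a x y; rewrite /to_tangent /= projD projZ. Qed.
HB.instance Definition _ :=
  GRing.isLinear.Build P syz_gmod (tangent_gmod K) _ to_tangent to_tangent_linear.

Lemma to_tangent_homog k x : ofdeg (k + 1) x -> ofdeg (k + 1) (to_tangent x).
Proof. by move=> h; exists (val x). Qed.

Lemma in_eulerP (A : 'rV[P]_3) : A \in gs_pred (gspan (M := gfree K 3) (euler_field_homog K)) <->
  exists b, A = b *: euler_field K.
Proof.
split=> [/asboolP[b ->]|[b ->]]; first by exists (b ord0); rewrite big_ord1.
by apply/asboolP; exists (fun=> b); rewrite big_ord1.
Qed.

Lemma to_tangent_inj x : to_tangent x = 0 -> x = 0.
Proof.
move=> /proj_eq0/in_eulerP [b eb]; apply: val_inj; rewrite eb /=.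
have : dot (grad X) (val x) = 0 by apply/eqP; exact: valP x.
rewrite eb dotZ dot_grad_euler => /eqP; rewrite mulf_eq0 => /orP[/eqP -> |]; first exact: scale0r.
by rewrite scaler_eq0 (negbTE (natr_neq0 char0 (cdeg_gt0 X))) (negbTE (eqn_neq0 X)).
Qed.

Lemma eta_to_tangent x : @eta_gmod K X (to_tangent x) = 0.
Proof.
rewrite /eta_gmod qliftE; last exact: eta_row_euler.
apply: val_inj => /=; have hx : dot (grad X) (val x) = 0 by apply/eqP; exact: valP x.
transitivity (qproj (eqn_ideal X) (dot (grad X) (val x))); last by rewrite hx; apply/proj_eq0; case: (gs_closed (eqn_ideal X)).
rewrite /dot raddf_sum; apply: eq_bigr => i _; exact: esym (projZ _ _ _).
Qed.
End LogSheaf.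

Section LogSheafIso.
Variable K : fieldType.
Hypothesis char0 : [pchar K] =i pred0.
Local Notation P := {mpoly K[3]}.
Variable X : plane_curve K.
Local Notation S := (syz_gmod X).
Local Notation T := (tangent_gmod K).

Definition syz_stalk (p : ppoint K) : stalk S 1 p -> stalk T 1 p :=
  stalk_map (h := @to_tangent K X) (@to_tangent_homog K X) (p := p).

Lemma syz_stalkE p z :
  syz_stalk (germ z) = germ (frac_map (h := @to_tangent K X) (@to_tangent_homog K X) (p := p) z).
Proof. exact: stalk_mapE. Qed.

Lemma syz_stalk_inj p : injective (@syz_stalk p).
Proof.
exact: (@stalk_map_inj K S T 1 1 (@to_tangent K X) (@to_tangent_homog K X) p (@to_tangent_inj K char0 X)).
Qed.

(** A vector field killed by [eta] at [p] becomes, after multiplication by a form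
    not vanishing at [p], a syzygy up to a multiple of the Euler field. *)
Lemma local_lift (U : zopen K) (s : tsec T 1 U) : eta X U s = 0 ->
  forall p, U p -> exists (V : zopen K) (x : S * P), V p /\
    forall q (Uq : U q), V q -> exists2 z : hfrac S 1 q, val z = x & syz_stalk (germ z) = s q Uq.
Proof.
move=> es p Up; have [V [[m r] [Vp hV]]] := tvalP s Up.
have [z ez sz] := hV p Up Vp.
have : eta X U s p Up = 0 by rewrite es.
rewrite (_ : eta X U s p Up = stalk_map (h := eta_gmod X) (@eta_gmod_homog K X) (s p Up)) //.
rewrite sz stalk_mapE => /germ_eq/asboolP [e [u [hu pu]]].
rewrite /= ez /= scale1r scaler0 subr0 => eu.
have [k [hm hr pr]] := fracP z; rewrite ez /= in hm hr pr.
have [A hA eA] := hm.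
have [b eb] : exists b, dot (grad X) (u *: A) = b * eqn X.
  have : @eta_gmod K X (u *: m) = 0 by rewrite linearZ.
  rewrite eA -projZ /eta_gmod qliftE; last exact: eta_row_euler.
  move=> /(congr1 val) /=.
  have -> : \sum_i (u *: A) 0 i *: partialX X i = qproj (eqn_ideal X) (dot (grad X) (u *: A)).
    by rewrite /dot raddf_sum; apply: eq_bigr => i _; exact: esym (projZ _ _ _).
  by move=> /proj_eq0/asboolP [b ->]; exists (b ord0); rewrite big_ord1.
pose d := (cdeg X)%:R : K; have d0 : d != 0 by exact: (natr_neq0 char0 (cdeg_gt0 X)).
pose b' := (d^-1)%:MP * b.
have SC : syz (grad X) (u *: A - b' *: euler_field K).
  rewrite /syz dotB eb dotZ dot_grad_euler -mul_mpolyC /b' -/d.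
  have -> : (d^-1)%:MP * b * (d%:MP * eqn X) = ((d^-1)%:MP * d%:MP) * (b * eqn X) :> P by ring.
  by rewrite -mpolyCM mulVf // mul1r subrr.
pose n := (e + k)%N; pose D := (cdeg X).-1.
have huA : vhomog (fun=> D) (n + 1 + D) (u *: A).
  apply/free_vhomog; rewrite /n -addnA; exact: (@ofdegZ _ (gfree K 3)).
pose C := vpart (fun=> D) (n + 1 + D) (u *: A - b' *: euler_field K).
have SC' : C \in in_syz X.
  by rewrite inE; apply/eqP; exact: (syz_graded (grad_homog X) (n + 1 + D) SC).
have hC : @ofdeg _ (gfree K 3) (n + 1) C by apply/free_vhomog; exact: vpart_vhomog.
pose C' : S := exist (fun x => x \in in_syz X) C SC'.
have eC : to_tangent C' = u *: m.
  rewrite eA -projZ /to_tangent; apply/proj_eq; rewrite /= /C.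
  apply/in_eulerP; exists (- wpart D.+1 (n + 1 + D) b'); apply/rowP => i.
  have hX : whomog D D.+1 ('X_i : P).
    suff : whomog (0 + D) (1 + D) ('X_i : P) by rewrite add0n add1n.
    by apply/whomog_shift/whomog0; rewrite dhomogX; apply/eqP/mdeg1.
  have eE x : (x *: euler_field K) 0 i = x * 'X_i by rewrite !mxE.
  have e1 : (u *: A - b' *: euler_field K) 0 i = (u *: A) 0 i - b' * 'X_i.
    by rewrite rowBE eE.
  rewrite eE rowBE [X in X - _]mxE e1 raddfB /= (wpart_id (huA i)) (wpartM _ _ hX).
  by rewrite mulNr addrAC subrr add0r.
have ur : u * r \is (e + k)%N.-homog by exact: dhomogM.
exists (zopenI V (zopenD hu)), (C', u * r); split=> [|q Uq [Vq uq]]; first by split.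
have [z' ez' sz'] := hV q Uq Vq.
have qr : r \notin pt_ideal q by have [k' [_ _]] := fracP z'; rewrite ez'.
have hz : is_frac (M := S) 1 q (C', u * r).
  by exists n; split; [exact: hC | exact: ur | rewrite /= ptM negb_or uq].
exists (mkfrac hz) => //; rewrite sz' syz_stalkE; apply/germ_eq/asboolP.
exists 0%N, 1; rewrite dhomog1 pt1; split=> //.
by rewrite /= ez' /= eC scale1r !scalerA [u * r]mulrC subrr.
Qed.

(** Syzygies meet the multiples of the Euler field in zero, since that field maps the
    equation to a nonzero multiple of itself; locally they exhaust the kernel of
    [eta]. *)
Lemma log_sheaf_iso : omod_iso (tilde S 1) (log_sheaf X).
Proof.
pose L := tilde_hom (h := @to_tangent K X) (@to_tangent_homog K X).
have L0 (U : zopen K) (s : tsec S 1 U) : L U s \in in_ker (eta X) (U := U).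
  rewrite inE; apply/eqP/tsec_eq => p Up.
  have [x ex] := germ_onto (s p Up).
  have -> : eta X U (L U s) p Up =
    stalk_map (h := eta_gmod X) (@eta_gmod_homog K X) (@syz_stalk p (s p Up)) by [].
  rewrite ex syz_stalkE stalk_mapE; apply/germ_eq/asboolP.
  exists 0%N, 1; rewrite dhomog1 pt1; split=> //.
  by rewrite /= eta_to_tangent !scaler0 subrr scaler0.
pose F U (s : tsec S 1 U) : kersec (eta X) U := exist (fun x => x \in in_ker (eta X) (U := U)) _ (L0 U s).
have linF U : linear (F U).
  by move=> a x y; apply: val_inj; rewrite /= linearP.
pose FL U : {linear tilde S 1 U -> log_sheaf X U} :=
  HB.pack (F U) (GRing.isLinear.Build (regfun U) (tsec S 1 U) (kersec (eta X) U) _ (F U) (linF U)).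
have resF U V (h : zsub V U) (s : tilde S 1 U) : FL V (om_res h s) = om_res h (FL U s).
  by apply: val_inj; exact: (oh_res L h s).
exists (@OModHom K (tilde S 1) (log_sheaf X) FL resF) => U.
have inj : injective (F U).
  move=> s t /(congr1 val) e; apply: tsec_eq => p Up; apply: syz_stalk_inj.
  exact: (congr1 (fun x : tsec T 1 U => x p Up) e).
have sur t : exists s, F U s = t.
  have et : eta X U (val t) = 0 by apply/eqP; exact: valP t.
  have pre p (Up : U p) : {y : stalk S 1 p | syz_stalk y = val t p Up}.
    apply: cid; have [V [x [Vp hV]]] := local_lift et Up.
    by have [z _ e] := hV p Up Vp; exists (germ z).
  have hs : @is_section K S 1 U (fun p Up => sval (pre p Up)).
    move=> p Up; have [V [x [Vp hV]]] := local_lift et Up.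
    exists V, x; split=> // q Uq Vq; have [z ez e] := hV q Uq Vq; exists z => //.
    by apply: syz_stalk_inj; rewrite e; exact: (svalP (pre q Uq)).
  exists (TSec hs); apply: val_inj; apply: tsec_eq => p Up.
  exact: (svalP (pre p Up)).
have [G hG] := choice sur; exists G => x; last exact: hG.
by apply: inj; rewrite hG.
Qed.
End LogSheafIso.

Lemma tilde_iso_of_syz_iso (K : fieldType) (X X' : plane_curve K) rho : (cdeg X).-1 = (cdeg X').-1 ->
  syz_iso (grad X) (grad X') (cdeg X).-1 (cdeg X).-1 rho ->
  omod_iso (tilde (syz_gmod X) 1) (tilde (syz_gmod X') 1).
Proof.
move=> eD h; pose R (x : syz_gmod X) (y : syz_gmod X') := rho (val x) (val y).
have Sx (x : syz_gmod X) : syz (grad X) (val x) by apply/eqP; exact: valP x.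
have Sy (x : syz_gmod X') : syz (grad X') (val x) by apply/eqP; exact: valP x.
pose mk Y (A : 'rV[{mpoly K[3]}]_3) (hA : syz (grad Y) A) : syz_gmod Y :=
  exist (fun x => x \in in_syz Y) A (introT eqP hA).
have [||a x y x' y'|x r|y r|phi [psi [K1 K2 hR]]] := @linear_iso_of_rel K (syz_gmod X) (syz_gmod X') R.
- move=> x; have [B r] := si_total h (Sx x); have [_ SB] := si_syz h r.
  by exists (mk _ _ SB).
- move=> y; have [A r] := si_onto h (Sy y); have [SA _] := si_syz h r.
  by exists (mk _ _ SA).
- exact: (si_lin h).
- by apply: val_inj; exact: (si_inj h r).
- by apply: val_inj; exact: (si_fun h r).
have hs := syz_iso_sym (grad_homog X) h.
apply: (tilde_iso _ K1 K2) => k x hx.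
  apply/(free_vhomog X' k (val (phi x))); rewrite -eD; apply: (si_homog h (hR x)).
  exact/(free_vhomog X k (val x)).
apply/(free_vhomog X k (val (psi x))); have := hR (psi x); rewrite K2 => r.
by apply: (si_homog hs r); rewrite eD; exact/(free_vhomog X' k (val x)).
Qed.

(** * Points of the projective plane *)
Section Points.
Variable K : fieldType.
Local Notation P := {mpoly K[3]}.

Definition zero_ideal : P -> bool := fun p => p == 0.

Definition generic_point : ppoint K.
Proof.
apply: (@PPoint K zero_ideal).
- split=> [|| a x y /eqP -> /eqP ->]; [exact: eqxx | exact: oner_neq0 |].
  by apply/eqP; rewrite mulr0 addr0.
- by move=> x y /eqP/esym/eqP; rewrite eq_sym mulf_eq0.
- by move=> g /eqP -> k; rewrite raddf0; exact: eqxx.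
- by exists ord0; exact: mpolyX_neq0.
Defined.

Lemma pt0 (p : ppoint K) : 0 \in pt_ideal p.
Proof. by have [] := pt_idealr p. Qed.

Lemma pt_neq0 (p : ppoint K) g : g \notin pt_ideal p -> g != 0.
Proof. by apply: contraNneq => ->; exact: pt0. Qed.

Lemma in_generic (U : zopen K) p : U p -> U generic_point.
Proof.
have [T [_ hT]] := zset_open U; move=> /hT [g Tg pg]; apply/hT; exists g => //.
exact: pt_neq0 pg.
Qed.

Definition prime_point (q : P) d (hq : prime_elt q) (dq : q \is d.-homog) : ppoint K.
Proof.
apply: (@PPoint K (fun p => `[< rdvd q p >])).
- split; rewrite ?inE.
  + exact/asboolP/rdvd0.
  + apply/asboolP => /(rdvd_unit (unitr1 _)); have [_ /negP] := hq; by move=> + _.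
  + move=> a x y /asboolP hx /asboolP hy; apply/asboolP.
    by apply: rdvdD => //; exact: rdvdMl.
- have [_ _ h] := hq; move=> x y /asboolP/h [] hx.
    by apply/orP; left; apply/asboolP.
  by apply/orP; right; apply/asboolP.
- move=> g /asboolP [c ->] k; apply/asboolP; rewrite -wpart0E.
  by rewrite (@wpartM _ _ d 0); [exists (wpart d k c) | exact/whomog0].
- apply: contrapT => no; have [_ /negP nu _] := hq; apply: nu.
  apply: common_divisor_X => i; apply: contrapT => ni; apply: no; exists i.
  by apply/asboolP.
Defined.

Lemma prime_pointE q d hq dq g : g \in pt_ideal (@prime_point q d hq dq) <-> rdvd q g.
Proof. by split=> [/asboolP|] //; move=> h; apply/asboolP. Qed.

(** The primes of [q] are divided out of [v] one at a time: the multiplier at a prime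
    [r] is not divisible by [r], so [r] divides what is left of [v]. *)
Lemma local_dvd d (q v : P) : q != 0 -> q \is d.-homog ->
  (forall r e, prime_elt r -> r \is e.-homog -> exists2 c, ~ rdvd r c & rdvd q (c * v)) ->
  rdvd q v.
Proof.
move=> q0 dq; have [n [u [s [hu _ hs eq]]]] := @mpoly_factorial K 3 q q0.
have hom r : r \in s -> exists e, r \is e.-homog.
  move=> rs; have eqr : q = r * (u * \prod_(j <- rem r s) j).
    by rewrite eq (perm_big _ (perm_to_rem rs)) big_cons /= mulrCA.
  by apply: (@homog_factor _ _ d r (u * \prod_(j <- rem r s) j)); rewrite -eqr.
rewrite eq; have u0 : u != 0 by apply: contraTneq hu => ->; rewrite unitr0.
elim: s v hs hom {eq} => [|r s IH] v hs hom.
  by rewrite big_nil mulr1 => _; exists (v * u^-1); rewrite mulrVK.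
rewrite big_cons /= => loc; have [e he] := hom r (mem_head _ _).
have hr := hs r (mem_head _ _); have [r0 _ hP] := hr.
have [|||v' ev] := IH v.
- by move=> x xs; apply: hs; rewrite inE xs orbT.
- by move=> x xs; apply: hom; rewrite inE xs orbT.
- move=> r' e' hr' he'; have [c nc [w ew]] := loc r' e' hr' he'; exists c => //.
  by exists (w * r); rewrite ew; ring.
have [c nc [w ew]] := loc r e hr he.
have t0 : u * \prod_(j <- s) j != 0.
  rewrite mulf_neq0 // big_seq; elim/big_ind: _ => [|x y|x xs]; rewrite ?oner_eq0 //.
    exact: mulf_neq0.
  by have [] : prime_elt x by apply: hs; rewrite inE xs orbT.
have : rdvd r (c * v').
  exists w; apply: (mulfI t0); transitivity (c * v); first by rewrite ev; ring.
  by rewrite ew; ring.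
by case/hP => // -[v'' ev']; exists v''; rewrite ev ev'; ring.
Qed.

Section OneFraction.
Variables (M : gmod K) (a : nat) (U : zopen K) (x : M * P).
Hypothesis hx : forall p, U p -> is_frac a p x.

Fact onefrac_section : @is_section K M a U (fun p Up => germ (mkfrac (hx Up))).
Proof. by move=> p Up; exists U, x; split=> // q Uq _; exists (mkfrac (hx Uq)). Qed.

Definition onefrac : tsec M a U := TSec onefrac_section.
End OneFraction.

Definition zX i : zopen K := zopenD (mpolyX_homog K i).
End Points.

(** * From the sheaf of syzygies to its module *)
Section GlobalSections.
Variable K : fieldType.
Local Notation P := {mpoly K[3]}.

Lemma rowZI r (c : P) (u v : 'rV[P]_r) : c != 0 -> c *: u = c *: v -> u = v.
Proof.
move=> c0 /rowP e; apply/rowP => i; have := e i; rewrite !mxE; exact: mulfI.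
Qed.

Section OneCurve.
Variable X : plane_curve K.
Local Notation S := (syz_gmod X).

Lemma syz_valP (x : S) : syz (grad X) (val x).
Proof. by apply/eqP; exact: valP x. Qed.

Definition syz_mk (A : 'rV[P]_3) (hA : syz (grad X) A) : S :=
  exist (fun x => x \in in_syz X) A (introT eqP hA).

Lemma syz_torsion_free c (x y : S) : c != 0 -> c *: x = c *: y -> x = y.
Proof. by move=> c0 /(congr1 val) e; apply: val_inj; exact: rowZI c0 e. Qed.

Lemma syz_germ a p (z w : hfrac S a p) : germ z = germ w <->
  (val w).2 *: (val z).1 = (val z).2 *: (val w).1.
Proof.
split=> [/germ_eq/asboolP [e [u [_ pu k]]]|e].
  apply: (syz_torsion_free (pt_neq0 pu)); apply/eqP; rewrite -subr_eq0 -scalerBr.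
  exact/eqP.
apply/germ_eq/asboolP; exists 0%N, 1; rewrite dhomog1 pt1; split=> //.
by rewrite e subrr scaler0.
Qed.

Lemma zX_pow (p : ppoint K) i k : zX K i p -> ('X_i : P) ^+ k \notin pt_ideal p.
Proof.
move=> hi; elim: k => [|k IH]; first by rewrite expr0 pt1.
by rewrite exprS ptM negb_or IH andbT.
Qed.

Lemma zX_generic i : zX K i (generic_point K).
Proof. exact: mpolyX_neq0. Qed.

Fact fracX_is_frac i k (x : S) : ofdeg k x ->
  forall p, zX K i p -> is_frac 1 p ('X_i *: x, 'X_i ^+ k).
Proof.
move=> hx p hp; exists k; split=> /=; last exact: zX_pow.
  rewrite addnC; exact: (@ofdegZ _ S 1 'X_i k x (mpolyX_homog K i) hx).
exact: Xn_homog.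
Qed.

(** The chart [D(X_i)] of the [k]-th twist of the sheaf of syzygies; the factor [X_i]
    in the numerator makes up for the twist by one. *)
Definition secX i k (x : S) (hx : ofdeg k x) : tsec S 1 (zX K i) :=
  onefrac (@fracX_is_frac i k x hx).

(** The generic point lies in every nonempty open set, in particular where the
    section is given by the fraction that represents it at [p]. *)
Lemma section_rep (U : zopen K) (t : tsec S 1 U) (Ux : U (generic_point K)) p (Up : U p) :
  exists x : S * P, [/\ x.2 \notin pt_ideal p,
    (exists2 z : hfrac S 1 p, val z = x & t p Up = germ z) &
    (exists2 z : hfrac S 1 (generic_point K), val z = x & t _ Ux = germ z)].
Proof.
have [V [x [Vp hV]]] := tvalP t Up; exists x; split.
- by have [z <- _] := hV p Up Vp; have [k []] := fracP z.
- exact: hV.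
- exact: hV (in_generic Vp).
Qed.
End OneCurve.

Variables (X X' : plane_curve K).
Local Notation S := (syz_gmod X).
Local Notation S' := (syz_gmod X').

Section Hom.
Variable phi : omod_hom (tilde S 1) (tilde S' 1).

(** [phi] maps the section of the [k]-th twist given by [x] to the one given by [y];
    the twist is expressed in the three charts [D(X_i)], where it is trivial. *)
Definition sec_rel k (x : S) (y : S') := exists (hx : ofdeg k x) (hy : ofdeg k y),
  forall i, phi (zX K i) (secX i hx) = secX i hy.

(** The images of [x] in two charts agree on the overlap up to the change of chart,
    and so do the fractions that represent them at the generic point. *)
Lemma sec_overlap k (x : S) (hx : ofdeg k x) i j
    (z : hfrac S' 1 (generic_point K)) (w : hfrac S' 1 (generic_point K)) :
  (phi (zX K i) (secX i hx) : tsec S' 1 (zX K i)) _ (zX_generic i) = germ z ->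
  (phi (zX K j) (secX j hx) : tsec S' 1 (zX K j)) _ (zX_generic j) = germ w ->
  ((val w).2 * ('X_i ^+ k * 'X_j)) *: (val z).1 =
  ((val z).2 * ('X_i * 'X_j ^+ k)) *: (val w).1.
Proof.
move=> ez ew; pose W := zopenI (zX K i) (zX K j).
have hi : zsub W (zX K i) by move=> p [].
have hj : zsub W (zX K j) by move=> p [].
have homX (l : 'I_3) n : ('X_l : P) ^+ n \is n.-homog by exact: Xn_homog.
have ha (p : ppoint K) : W p -> is_frac (M := greg K) 0 p (('X_i ^+ k * 'X_j : P), 'X_i ^+ k.+1).
  move=> [pi pj]; exists k.+1; split; [|exact: homX|exact: zX_pow].
  by rewrite addn0 -addn1; apply: dhomogM; [exact: homX | exact: mpolyX_homog].
have hb (p : ppoint K) : W p -> is_frac (M := greg K) 0 p (('X_i * 'X_j ^+ k : P), 'X_i ^+ k.+1).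
  move=> [pi pj]; exists k.+1; split; [|exact: homX|exact: zX_pow].
  by rewrite addn0 -add1n; apply: dhomogM; [exact: mpolyX_homog | exact: homX].
pose a : regfun W := onefrac ha; pose b : regfun W := onefrac hb.
have e : a *: tres hi (secX i hx) = b *: tres hj (secX j hx).
  apply: tsec_eq => p Wp.
  have -> : (a *: tres hi (secX i hx)) p Wp =
    stalk_act (germ (mkfrac (ha p Wp))) (germ (mkfrac (@fracX_is_frac X i k x hx p (hi p Wp)))) by [].
  have -> : (b *: tres hj (secX j hx)) p Wp =
    stalk_act (germ (mkfrac (hb p Wp))) (germ (mkfrac (@fracX_is_frac X j k x hx p (hj p Wp)))) by [].
  rewrite !stalk_actE; apply/syz_germ => /=; rewrite !scalerA; congr (_ *: _).
  by move: ('X_i : P) ('X_j : P) => s t; rewrite !exprS; ring.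
have := congr1 (fun s : tsec S 1 W => phi W s) e; rewrite !linearZ.
have res l (hl : zsub W (zX K l)) (s : tsec S 1 (zX K l)) :
    phi W (tres hl s) = tres hl (phi (zX K l) s) by exact: (oh_res phi hl s).
rewrite !res => e'.
have Wx : W (generic_point K) by split; exact: zX_generic.
have := congr1 (fun s : tsec S' 1 W => s _ Wx) e'.
have ei : tres hi (phi (zX K i) (secX i hx)) _ Wx = germ z.
  by rewrite -ez /=; congr (tval _ _); exact: Prop_irrelevance.
have ej : tres hj (phi (zX K j) (secX j hx)) _ Wx = germ w.
  by rewrite -ew /=; congr (tval _ _); exact: Prop_irrelevance.
have -> : (a *: tres hi (phi (zX K i) (secX i hx))) _ Wx =
  stalk_act (germ (mkfrac (ha _ Wx))) (tres hi (phi (zX K i) (secX i hx)) _ Wx) by [].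
have -> : (b *: tres hj (phi (zX K j) (secX j hx))) _ Wx =
  stalk_act (germ (mkfrac (hb _ Wx))) (tres hj (phi (zX K j) (secX j hx)) _ Wx) by [].
rewrite ei ej !stalk_actE => /syz_germ /=; rewrite !scalerA => e2.
have X0 : ('X_i : P) ^+ k.+1 != 0 by rewrite expf_neq0 // mpolyX_neq0.
apply: (syz_torsion_free X0); rewrite !scalerA !mulrA.
by move: e2; rewrite !mulrA.
Qed.
End Hom.
End GlobalSections.

Section SheafToModule.
Variable K : fieldType.
Local Notation P := {mpoly K[3]}.
Variables (X X' : plane_curve K).
Local Notation S := (syz_gmod X).
Local Notation S' := (syz_gmod X').
Variable phi : omod_hom (tilde S 1) (tilde S' 1).
Local Notation xi := (generic_point K).

(** The image of a syzygy of degree [k] is given at the generic point by one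
    fraction; its denominator divides locally at every prime of height one since
    some [D(X_i)] contains that prime, hence the image is a syzygy. *)
Lemma sec_total k (x : S) : ofdeg k x -> exists y, sec_rel phi k x y.
Proof.
move=> hx; pose t i : tsec S' 1 (zX K i) := phi (zX K i) (secX i hx).
have /choice [z hz] : forall i, exists z, t i xi (zX_generic K i) = germ z.
  by move=> i; have [z ->] := germ_onto (t i xi (zX_generic K i)); exists z.
pose B i : S' := (val (z i)).1; pose g i : P := (val (z i)).2.
have g0 i : g i != 0 by have [n [_ _ h]] := fracP (z i); exact: pt_neq0 h.
have ov i j : (g j * ('X_i ^+ k * 'X_j)) *: B i = (g i * ('X_i * 'X_j ^+ k)) *: B j.
  exact: (sec_overlap (hz i) (hz j)).
have rep i p (Up : zX K i p) : exists x : S' * P, [/\ x.2 \notin pt_ideal p,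
    (exists2 w : hfrac S' 1 p, val w = x & t i p Up = germ w) & g i *: x.1 = x.2 *: B i].
  have [y [py hy [w ew hw]]] := section_rep (t i) (zX_generic K i) Up.
  exists y; split=> //; move: hw; rewrite hz => /syz_germ; rewrite ew => e.
  exact: esym e.
have [n [dB dg _]] := fracP (z i0); rewrite -/(B i0) -/(g i0) in dB dg.
pose q := 'X_i0 * g i0; pose v := 'X_i0 ^+ k *: val (B i0).
have X0 i : ('X_i : P) != 0 by exact: mpolyX_neq0.
have q0 : q != 0 by rewrite mulf_neq0.
have dq : q \is (1 + n).-homog by apply: dhomogM => //; exact: mpolyX_homog.
have ov0 i : (g i * 'X_i) *: v = (q * 'X_i ^+ k) *: val (B i).
  have := congr1 val (ov i0 i) => /= e; rewrite /v scalerA.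
  have -> : g i * 'X_i * 'X_i0 ^+ k = g i * ('X_i0 ^+ k * 'X_i) by ring.
  by rewrite e; congr (_ *: _); rewrite /q; ring.
have loc i p (Up : zX K i p) : exists x : S' * P, [/\ x.2 \notin pt_ideal p,
    (exists2 w : hfrac S' 1 p, val w = x & t i p Up = germ w) &
    ('X_i * x.2) *: v = (q * 'X_i ^+ k) *: val x.1].
  have [y [py hy ey]] := rep i p Up; exists y; split=> //.
  apply: (rowZI (g0 i)); apply: fraction_comb (ov0 i).
  exact: (congr1 val ey).
have /choice [E hE] : forall l, exists e, v 0 l = e * q.
  move=> l; apply: (local_dvd q0 dq) => r e hr he.
  have [i hi] := pt_relevant (prime_point hr he).
  have [y [py _ ey]] := loc i _ hi; exists ('X_i * y.2).
    move/(prime_pointE hr he); rewrite ptM => /orP []; apply/negP; [exact: hi | exact: py].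
  have /rowP/(_ l) := ey; rewrite !rowZE => ->.
  by exists ('X_i ^+ k * val y.1 0 l); ring.
have ev : v = q *: \row_l E l by apply/rowP => l; rewrite hE rowZE mxE mulrC.
have SE : syz (grad X') (\row_l E l).
  apply: (mulfI q0); rewrite mulr0 -dotZ -ev /v dotZ.
  by rewrite (syz_valP (B i0)) mulr0.
have dE : @ofdeg _ S' k (syz_mk SE).
  have hv l : v 0 l \is (k + (n + 1)).-homog.
    rewrite /v rowZE; apply: dhomogM; last exact: (dB l).
    exact: Xn_homog.
  move=> l; rewrite /= mxE; apply/whomog0; apply/(whomog_shift 0 k (1 + n)).
  rewrite add0n [(1 + n)%N]addnC; suff <- : wpart (n + 1) (k + (n + 1)) (E l) = E l by exact: wpart_whomog.
  have hq : whomog 0 (n + 1) q by rewrite addnC; exact/whomog0.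
  apply: (mulIf q0); rewrite -(wpartM _ _ hq) -hE wpart_id //.
  exact/whomog0/hv.
exists (syz_mk SE), hx, dE => i; apply: tsec_eq => p Up.
have [y [py [w ew hw] ey]] := loc i p Up.
rewrite -/(t i) hw; apply/syz_germ; rewrite ew /=; apply: val_inj => /=.
apply: (rowZI q0); apply: esym; rewrite !scalerA [q * (y.2 * _)]mulrC -[LHS]scalerA -ev.
by rewrite [y.2 * _]mulrC.
Qed.

Lemma sec_relD k x y x' y' : sec_rel phi k x y -> sec_rel phi k x' y' ->
  sec_rel phi k (x + x') (y + y').
Proof.
move=> [hx [hy h]] [hx' [hy' h']]; exists (ofdegD hx hx'), (ofdegD hy hy') => i.
have secD (Y : plane_curve K) (u u' : syz_gmod Y) (hu : ofdeg k u) (hu' : ofdeg k u') :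
    secX i (ofdegD hu hu') = secX i hu + secX i hu'.
  apply: tsec_eq => p Up; apply: etrans (esym (germD _ _)); apply/syz_germ => /=.
  by rewrite !scalerDr !scalerA.
by rewrite !secD linearD h h'.
Qed.

Lemma sec_relZ k e (a : P) x y : a \is e.-homog -> sec_rel phi k x y ->
  sec_rel phi (e + k) (a *: x) (a *: y).
Proof.
move=> ha [hx [hy h]]; exists (ofdegZ ha hx), (ofdegZ ha hy) => i.
have hr (p : ppoint K) : zX K i p -> is_frac (M := greg K) 0 p ((a : P), 'X_i ^+ e).
  move=> pi; exists e; split; [by rewrite addn0 | | exact: zX_pow].
  exact: Xn_homog.
pose r : regfun (zX K i) := onefrac hr.
have secZ (Y : plane_curve K) (u : syz_gmod Y) (hu : ofdeg k u) :
    secX i (ofdegZ ha hu) = r *: secX i hu.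
  apply: tsec_eq => p Up.
  have -> : (r *: secX i hu) p Up =
    stalk_act (germ (mkfrac (hr p Up))) (germ (mkfrac (@fracX_is_frac K Y i k u hu p Up))) by [].
  rewrite stalk_actE; apply/syz_germ => /=; rewrite !scalerA; congr (_ *: _).
  by rewrite exprD; ring.
by rewrite !secZ linearZ h.
Qed.

Lemma secX0 (Y : plane_curve K) i k (h0 : @ofdeg _ (syz_gmod Y) k 0) : secX i h0 = 0.
Proof.
apply: tsec_eq => p Up; apply/germ_eq/asboolP; exists 0%N, 1.
by rewrite dhomog1 pt1; split=> //=; rewrite !scaler0 subrr scaler0.
Qed.

Lemma secX_eq0 (Y : plane_curve K) i k (x : syz_gmod Y) (hx : ofdeg k x) :
  secX i hx = 0 -> x = 0.
Proof.
move=> e; have := congr1 (fun s : tsec _ 1 (zX K i) => s _ (zX_generic K i)) e.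
move=> /germ_eq/asboolP [d [u [_ pu]]]; rewrite /= scale1r scaler0 subr0.
have X0 : ('X_i : P) != 0 by exact: mpolyX_neq0.
move=> h; apply: (syz_torsion_free X0); apply: (syz_torsion_free (pt_neq0 pu)).
by rewrite h !scaler0.
Qed.

Lemma sec_rel_fun k y : sec_rel phi k 0 y -> y = 0.
Proof.
move=> [hx [hy /(_ i0) e]]; apply: (@secX_eq0 _ i0 k y hy).
by rewrite -e secX0 linear0.
Qed.

Lemma sec_rel_inj k x : (forall U, injective (phi U)) -> sec_rel phi k x 0 -> x = 0.
Proof.
move=> hphi [hx [hy /(_ i0) e]]; apply: (@secX_eq0 _ i0 k x hx); apply: hphi.
by rewrite e secX0 linear0.
Qed.

Definition vec_rel (A B : 'rV[P]_3) := [/\ syz (grad X) A, syz (grad X') B &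
  forall k, exists (x : S) (y : S'), [/\ val x = vpart (fun=> 0%N) k A,
    val y = vpart (fun=> 0%N) k B & sec_rel phi k x y]].

Lemma vec_total A : syz (grad X) A -> exists B, vec_rel A B.
Proof.
move=> SA; have Sk k : syz (grad X) (vpart (fun=> 0%N) k A).
  have := syz_graded (grad_homog X) (k + (cdeg X).-1) SA.
  suff -> : vpart (fun=> (cdeg X).-1) (k + (cdeg X).-1) A = vpart (fun=> 0%N) k A by [].
  by apply/rowP => i; rewrite !mxE -[in LHS](add0n (cdeg X).-1) wpart_shift.
have /choice [y hy] : forall k, exists y, sec_rel phi k (syz_mk (Sk k)) y.
  by move=> k; apply: sec_total => i; apply/whomog0; exact: vpart_vhomog.
have [N hN] := vpart_sum (fun=> 0%N) A.
have dy k : vhomog (fun=> 0%N) k (val (y k)).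
  by have [_ [dy _]] := hy k; move=> i; apply/whomog0/dy.
exists (\sum_(k < N) val (y k)); split=> // [|k].
  by apply: submod_rsum => [|k _]; [exact: syz_submod | exact: syz_valP].
exists (syz_mk (Sk k)), (y k); split=> //.
rewrite (@vpart_of_sum K _ (fun=> 0%N) N (fun k => val (y k)) k dy).
case: ltnP => // Nk; suff -> : y k = 0 by [].
apply: (@sec_rel_fun k); suff <- : syz_mk (Sk k) = 0 by exact: hy.
apply: val_inj => /=; rewrite (hN N) //.
have hv j : vhomog (fun=> 0%N) j (vpart (fun=> 0%N) j A) by exact: vpart_vhomog.
by rewrite (@vpart_of_sum K _ (fun=> 0%N) N _ k hv) ltnNge Nk.
Qed.

Lemma vec_rel_lin a A B A' B' : vec_rel A B -> vec_rel A' B' ->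
  vec_rel (a *: A + A') (a *: B + B').
Proof.
have vadd A1 B1 A2 B2 : vec_rel A1 B1 -> vec_rel A2 B2 -> vec_rel (A1 + A2) (B1 + B2).
  move=> [S1 T1 h1] [S2 T2 h2]; split; rewrite /syz ?dotD ?S1 ?S2 ?T1 ?T2 ?addr0 // => k.
  have [x1 [y1 [ex1 ey1 r1]]] := h1 k; have [x2 [y2 [ex2 ey2 r2]]] := h2 k.
  exists (x1 + x2), (y1 + y2); split; last exact: sec_relD.
    by rewrite /= ex1 ex2; apply/rowP => i; rewrite !mxE raddfD.
  by rewrite /= ey1 ey2; apply/rowP => i; rewrite !mxE raddfD.
have v0 A1 : vpart (fun=> 0%N) 0 (0 *: A1) = 0 :> 'rV[P]_3 by rewrite scale0r vpart0.
have s0 k : exists (x : S) (y : S'), [/\ val x = 0, val y = 0 & sec_rel phi k x y].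
  exists 0, 0; split=> //; exists (ofdeg0 _ k), (ofdeg0 _ k) => i.
  by rewrite !secX0 linear0.
have hom e h A1 B1 : h \is e.-homog -> vec_rel A1 B1 -> vec_rel (h *: A1) (h *: B1).
  move=> hh [S1 T1 h1]; split; rewrite /syz ?dotZ ?S1 ?T1 ?mulr0 // => k.
  have hw : whomog 0 e h by exact/whomog0.
  have pv (C : 'rV[P]_3) : vpart (fun=> 0%N) k (h *: C) =
      if (e <= k)%N then h *: vpart (fun=> 0%N) (k - e) C else 0.
    apply/rowP => i; rewrite !mxE mulrC (wpartM _ _ hw); case: leqP => ek; rewrite !mxE.
      by rewrite mulrC -{1}[e]add0n -{1}(subnK ek) wpart_shift.
    by rewrite /wpart leqNgt ek mul0r.
  rewrite !pv; case: leqP => ek; last exact: s0.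
  have [x [y [ex ey r]]] := h1 (k - e)%N; exists (h *: x), (h *: y).
  by split; rewrite /= ?ex ?ey // -(subnKC ek); exact: sec_relZ.
move=> r r'; apply: (vadd) => //.
have [N hN] := wpart_sum 0 a; rewrite (hN N) // !scaler_suml.
elim/big_ind2: _ => [|A1 B1 A2 B2|k _]; last exact: hom (proj1 (whomog0 _ _) (@wpart_whomog _ _ 0 k a)) r.
  by split=> [||k]; rewrite ?/syz ?dot0 // !vpart0.
exact: vadd.
Qed.
End SheafToModule.

(** The syzygies of degree [k] are the global sections of the [k]-th twist. *)
Lemma syz_iso_of_omod_iso (K : fieldType) (X X' : plane_curve K) :
  omod_iso (tilde (syz_gmod X) 1) (tilde (syz_gmod X') 1) ->
  exists rho, syz_iso (grad X) (grad X') 0 0 rho.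
Proof.
move=> [phi hphi]; have [psi hpsi] := omod_inverse hphi.
have inj U : injective (phi U) by exact: (can_inj (proj1 (hpsi U))).
exists (vec_rel phi); split.
- exact: vec_total.
- move=> B SB; have [A [_ SA h]] := vec_total psi SB; exists A; split=> // k.
  have [y [x [ey ex [hy [hx r]]]]] := h k; exists x, y; split=> //.
  exists hx, hy => i; rewrite -(r i); exact: (proj2 (hpsi _)).
- by move=> A B [].
- by move=> a A B A' B'; exact: vec_rel_lin.
- move=> A [_ _ h]; apply: (@vpart_eq0 K _ (fun=> 0%N)) => k.
  have [x [y [<- ey r]]] := h k; suff -> : x = 0 by [].
  apply: (sec_rel_inj inj (k := k)); suff <- : y = 0 by [].
  by apply: val_inj; rewrite ey vpart0.
- move=> B [_ _ h]; apply: (@vpart_eq0 K _ (fun=> 0%N)) => k.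
  have [x [y [ex <- r]]] := h k; suff -> : y = 0 by [].
  apply: (@sec_rel_fun _ _ _ phi k); suff <- : x = 0 by [].
  by apply: val_inj; rewrite ex vpart0.
move=> k A B [_ _ h] hA i m hm; apply/eqP; apply: contraT => mk.
have [x [y [ex ey r]]] := h (mdeg m); case/eqP: hm.
have x0 : x = 0.
  apply: val_inj; rewrite ex; apply/rowP => j; rewrite !mxE.
  by apply: wpart_ne (hA j); rewrite eq_sym -[mdeg m]addn0.
have y0 : y = 0 by apply: (@sec_rel_fun _ _ _ phi (mdeg m)); rewrite -x0.
have /rowP/(_ i)/(congr1 (mcoeff m)) := congr1 val y0; rewrite ey !mxE mcoeff_wpart.
by rewrite addn0 eqxx mcoeff0.
Qed.

(** * Linear changes of coordinates *)
Section Evaluation.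
Variable K : fieldType.
Hypothesis char0 : [pchar K] =i pred0.

Lemma poly_nonroot (p : {poly K}) : p != 0 -> exists t, p.[t] != 0.
Proof.
move=> p0; apply: contrapT => /forallNP h.
have inj : injective (fun n : nat => n%:R : K).
  suff lt m n : (m < n)%N -> m%:R <> n%:R :> K.
    by move=> m n e; case: (ltngtP m n) => // /lt; [|move/nesym].
  move=> mn /eqP; rewrite eq_sym -subr_eq0 -natrB; last exact: ltnW.
  by apply/negP/(natr_neq0 char0); rewrite subn_gt0.
have := @max_poly_roots K p [seq n%:R | n <- iota 0 (size p)] p0.
rewrite size_map size_iota ltnn map_inj_uniq ?iota_uniq // => /(_ _ isT) H.
suff /H : all (root p) [seq n%:R | n <- iota 0 (size p)] by [].
by apply/allP => x _; rewrite rootE; have /negP := h x; rewrite negbK.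
Qed.

Lemma mpoly_nonzero n (p : {mpoly K[n]}) : p != 0 -> exists v, p.@[v] != 0.
Proof.
elim: n p => [|n IH] p p0.
  exists (fun=> 0); have /unitrP [q [_ e]] := mpoly0_unit p0.
  apply/eqP => pv; have := congr1 (meval (fun=> 0)) e.
  by rewrite mevalM pv mul0r meval1 => /esym/eqP; rewrite oner_eq0.
have m0 : muni p != 0.
  have [g gK _] := muni_bij K n.
  by apply: contraNneq p0 => m0; rewrite -(gK p) m0 -(muni0 n K) gK.
have [v hv] : exists v, (lead_coef (muni p)).@[v] != 0.
  by apply: IH; rewrite lead_coef_eq0.
have [t ht] : exists t, (map_poly (meval v) (muni p)).[t] != 0.
  apply: poly_nonroot; apply: contraNneq hv => e.
  by rewrite /lead_coef -coef_map e coef0.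
exists (fun i => (map_poly (meval v) (muni 'X_i)).[t]).
pose ev : {rmorphism {mpoly K[n.+1]} -> K} :=
  horner_eval t \o map_poly (meval v) \o @muni n K.
apply: contraNneq ht => e.
rewrite -[X in X == _]/(ev p) -e; apply/eqP.
apply: (@mpoly_morph_eq n.+1 K K ev (meval (fun i => ev 'X_i)) _ _ p) => [c|i].
  by rewrite /ev /= muniC map_polyC /= /horner_eval hornerC !mevalC.
exact: (esym (mevalXU (fun i => ev (mpolyX K U_(i))) i)).
Qed.
End Evaluation.

Section LinearSubstitution.
Variable K : fieldType.
Local Notation P := {mpoly K[3]}.

Definition restrict_line (u v : 'I_3 -> K) : {rmorphism P -> {poly K}} :=
  mmap (@polyC K) (fun i => (u i)%:P + (v i)%:P * 'X).

Lemma restrict_lineE u v p t : (restrict_line u v p).[t] = p.@[fun i => u i + v i * t].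
Proof.
pose ev : {rmorphism P -> K} := horner_eval t \o restrict_line u v.
apply: (@mpoly_morph_eq 3 K K ev (meval (fun i => u i + v i * t)) _ _ p) => [c|i].
  by rewrite /ev /= /restrict_line mmapC mevalC; exact: hornerC.
apply: etrans (esym (mevalXU (fun i => u i + v i * t) i)).
by rewrite /ev /= /restrict_line /= mmapX mmap1U /horner_eval !hornerE.
Qed.

(** On a line through the origin a form is a multiple of a power of the parameter. *)
Lemma restrict_line_homog d v p : p \is d.-homog ->
  restrict_line (fun=> 0) v p = p.@[v]%:P * 'X^d.
Proof.
move=> hp; rewrite mevalE {1}[p]mpolyE !rmorph_sum /= mulr_suml !big_seq.
apply: eq_bigr => m hm; rewrite mmapZ polyCM -mulrA; congr (_ * _).
have -> : d = (\sum_i m i)%N by rewrite -mdegE; exact: (esym (dhomog_mf hp hm)).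
rewrite mmapX /mmap1 expr_sum rmorph_prod -big_split.
by apply: eq_bigr => i _; rewrite /= add0r exprMn rmorphXn.
Qed.

Lemma meval_scale d (p : P) v t : p \is d.-homog ->
  p.@[fun i => v i * t] = p.@[v] * t ^+ d.
Proof.
move=> hp; have := congr1 (horner_eval t) (restrict_line_homog v hp).
rewrite /horner_eval restrict_lineE !hornerE => <-.
by apply: meval_eq => i; rewrite add0r.
Qed.

Definition lsub (M : 'M[K]_3) : {rmorphism P -> P} :=
  comp_mpoly [tuple \sum_j (M i j)%:MP * 'X_j | i < 3].

Lemma lsubC M c : lsub M c%:MP = c%:MP.
Proof. exact: comp_mpolyC. Qed.

Lemma lsubX M i : lsub M 'X_i = \sum_j (M i j)%:MP * 'X_j.
Proof. by rewrite /lsub /= comp_mpolyXU -tnth_nth tnth_mktuple. Qed.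

Lemma lsubK (M N : 'M[K]_3) : M *m N = 1%:M -> cancel (lsub M) (lsub N).
Proof.
move=> MN p.
apply: (@mpoly_morph_eq 3 K P (lsub N \o lsub M) idfun _ _ p) => [c|i] /=.
  by rewrite !lsubC.
rewrite lsubX rmorph_sum.
under eq_bigr => j _ do rewrite rmorphM /= lsubC lsubX mulr_sumr.
rewrite exchange_big /= (bigD1 i) //= [X in _ + X]big1 ?addr0 => [|k ki].
  under eq_bigr => j _ do rewrite mulrA -mpolyCM.
  rewrite -mulr_suml -rmorph_sum /=.
  have := congr1 (fun A : 'M_3 => A i i) MN; rewrite !mxE eqxx => ->.
  exact: mul1r.
under eq_bigr => j _ do rewrite mulrA -mpolyCM.
rewrite -mulr_suml -rmorph_sum /=.
have := congr1 (fun A : 'M_3 => A i k) MN.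
by rewrite !mxE eq_sym (negPf ki) => ->; rewrite mpolyC0 mul0r.
Qed.

Lemma lsub_meval M p v : (lsub M p).@[v] = p.@[fun i => \sum_j M i j * v j].
Proof.
rewrite /lsub /= comp_mpoly_meval; apply: meval_eq => i.
rewrite tnth_mktuple raddf_sum; apply: eq_bigr => j _.
by rewrite /= mevalM mevalC mevalXU.
Qed.

Lemma lsub_homog M d p : p \is d.-homog -> lsub M p \is d.-homog.
Proof.
move=> hp; rewrite [p]mpolyE rmorph_sum big_seq; apply: rpred_sum => m hm.
rewrite -(dhomog_mf hp hm) -mul_mpolyC rmorphM /= comp_mpolyC mul_mpolyC.
apply: rpredZ; rewrite comp_mpolyX mdegE.
apply: (big_rec2 (fun k (q : P) => q \is k.-homog)); first exact: dhomog1.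
move=> i k q _ hq; apply: dhomogM => //; rewrite -[X in X.-homog]mul1n.
apply: dhomogMn; rewrite tnth_mktuple; apply: rpred_sum => j _.
by rewrite mul_mpolyC; apply: rpredZ; rewrite dhomogX; apply/eqP/mdeg1.
Qed.

(** The chain rule. *)
Lemma mderiv_lsub M p k :
  (lsub M p)^`M(k) = \sum_i (M i k)%:MP * lsub M p^`M(i).
Proof.
pose good (q : P) := (lsub M q)^`M(k) = \sum_i (M i k)%:MP * lsub M q^`M(i).
have gC c : good c%:MP.
  rewrite /good lsubC mderivC big1 // => i _.
  by rewrite mderivC rmorph0 mulr0.
have gD q r : good q -> good r -> good (q + r).
  rewrite /good rmorphD mderivD => -> ->; rewrite -big_split /=.
  by apply: eq_bigr => i _; rewrite mderivD raddfD mulrDr.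
have gM q r : good q -> good r -> good (q * r).
  rewrite /good rmorphM mderivM => -> ->; rewrite mulr_suml mulr_sumr -big_split /=.
  apply: eq_bigr => i _; rewrite mderivM rmorphD !rmorphM /= mulrDr.
  by congr (_ + _); [rewrite -mulrA | rewrite mulrCA].
have gX i : good 'X_i.
  have dX (j l : 'I_3) : ('X_l : P)^`M(j) = (l == j)%:R%:MP.
    rewrite mderivX mnm1E; case: eqP => [->|_]; last by rewrite scale0r mpolyC0.
    by rewrite -[X in (X - _)%MM]add0m addmK mpolyX0 scale1r mpolyC1.
  rewrite /good lsubX raddf_sum /= (bigD1 k) //= [X in _ + X]big1 ?addr0 => [|j jk].
    rewrite mderiv_mulC dX eqxx (bigD1 i) //= [X in _ + X]big1 ?addr0 => [|j ji].
      by rewrite dX eqxx lsubC.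
    by rewrite dX eq_sym (negPf ji) lsubC mpolyC0 mulr0.
  by rewrite mderiv_mulC dX (negPf jk) mpolyC0 mulr0.
have gS I (s : seq I) F : (forall i, good (F i)) -> good (\sum_(i <- s) F i).
  by move=> h; apply: (big_ind good) => //; rewrite -mpolyC0; exact: gC.
have gP I (s : seq I) F : (forall i, good (F i)) -> good (\prod_(i <- s) F i).
  by move=> h; apply: (big_ind good) => //; rewrite -mpolyC1; exact: gC.
rewrite -/(good p) (mpolyE p); apply: gS => m.
rewrite -mul_mpolyC; apply: (gM); first exact: gC.
rewrite mpolyXE_id; apply: gP => i.
elim: (m i) => [|n IH]; first by rewrite expr0 -mpolyC1; exact: gC.
by rewrite exprS; apply: gM.
Qed.
End LinearSubstitution.

Section SameBetti.
Variable K : fieldType.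
Local Notation P := {mpoly K[3]}.

(** Graded free modules with bases in the same degrees are isomorphic. *)
Lemma syz_iso_of_hbasis (g g' : 'I_3 -> P) D t (U U' : 'M[P]_(t, 3)) c :
  hbasis (fun=> D) (syz g) U c -> hbasis (fun=> D) (syz g') U' c ->
  syz_iso g g' D D (fun A B => exists a : 'rV_t, A = a *m U /\ B = a *m U').
Proof.
move=> [[SU dU gU] iU] [[SU' dU' gU'] iU']; split.
- by move=> A /gU [a ->]; exists (a *m U'), a.
- by move=> B /gU' [a ->]; exists (a *m U), a.
- by move=> A B [a [-> ->]]; split; apply: submod_mulmx => //; exact: syz_submod.
- move=> x A B A' B' [a [-> ->]] [a' [-> ->]]; exists (x *: a + a').
  by rewrite !mulmxDl -!scalemxAl.
- by move=> A [a [-> /esym/iU' ->]]; rewrite mul0mx.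
- by move=> B [a [/esym/iU -> ->]]; rewrite mul0mx.
move=> k A B [a [-> ->]] hA.
have e : vpart c k a = a.
  apply/eqP; rewrite -subr_eq0; apply/eqP/iU.
  by rewrite mulmxBl -(vpart_mulmx _ _ dU) vpart_id // subrr.
by rewrite -e -(vpart_mulmx _ _ dU'); exact: vpart_vhomog.
Qed.
End SameBetti.

Section MovedCurve.
Variables (K : fieldType) (X : plane_curve K) (M N : 'M[K]_3).
Hypotheses (MN : M *m N = 1%:M) (NM : N *m M = 1%:M).
Local Notation P := {mpoly K[3]}.
Local Notation s := (lsub M).

Lemma lsub_whomog e k p : whomog e k p -> whomog e k (s p).
Proof.
case: (leqP e k) => ek h; last first.
  suff -> : p = 0 by rewrite rmorph0; exact: whomog_zero.
  by apply/mpolyP => m; rewrite mcoeff0; apply: contraTeq isT => /h; lia.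
move: h; rewrite -(subnK ek) -[X in whomog X]add0n !whomog_shift !whomog0.
exact: lsub_homog.
Qed.

(** Reducedness is transported by the inverse substitution. *)
Definition moved_curve : plane_curve K.
Proof.
apply: (@PlaneCurve K (s (eqn X)) (cdeg X) (cdeg_gt0 X)).
  exact/lsub_homog/eqn_homog.
move=> g h e.
have /(@eqn_reduced _ X) u : eqn X = (lsub N g) ^+ 2 * lsub N h.
  by rewrite -rmorphXn -rmorphM -e lsubK.
by rewrite -(lsubK NM g); exact: rmorph_unit.
Defined.

Let Mp : 'M[P]_3 := map_mx (@mpolyC 3 K) M.
Let Np : 'M[P]_3 := map_mx (@mpolyC 3 K) N.
Let MNp : Mp *m Np = 1%:M.
Proof. by rewrite -map_mxM MN map_mx1. Qed.
Let NMp : Np *m Mp = 1%:M.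
Proof. by rewrite -map_mxM NM map_mx1. Qed.

(** The differential of the substitution, on rows of coefficients. *)
Definition moved_row n (A : 'M[P]_(n, 3)) := map_mx s A *m Np^T.

Lemma moved_row_mulmx n m (a : 'M[P]_(n, m)) A :
  moved_row (a *m A) = map_mx s a *m moved_row A.
Proof. by rewrite /moved_row map_mxM mulmxA. Qed.

Lemma dot_moved_row A : dot (grad moved_curve) (moved_row A) = s (dot (grad X) A).
Proof.
have -> : dot (grad moved_curve) (moved_row A) =
    \sum_i (moved_row A *m Mp^T) 0 i * s (grad X i).
  rewrite /dot; under eq_bigr => k _ do rewrite /grad mderiv_lsub mulr_sumr.
  rewrite exchange_big; apply: eq_bigr => i _ /=.
  rewrite [in RHS]mxE mulr_suml; apply: eq_bigr => k _.
  by rewrite !mxE mulrA.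
rewrite /moved_row -mulmxA -trmx_mul MNp trmx1 mulmx1 /dot rmorph_sum.
by apply: eq_bigr => i _; rewrite mxE rmorphM.
Qed.

Lemma moved_row_onto n (B : 'M[P]_(n, 3)) :
  B = moved_row (map_mx (lsub N) (B *m Mp^T)).
Proof.
rewrite /moved_row (_ : map_mx s _ = B *m Mp^T).
  by rewrite -mulmxA -trmx_mul NMp trmx1 mulmx1.
by apply/matrixP => i j; rewrite [LHS]mxE [X in s X]mxE lsubK.
Qed.

Lemma moved_row_inj n (A : 'M[P]_(n, 3)) : moved_row A = 0 -> A = 0.
Proof.
move=> /(congr1 (fun B => B *m Mp^T)).
rewrite /moved_row -mulmxA -trmx_mul MNp trmx1 mulmx1 mul0mx => e.
apply/matrixP => i j; have := congr1 (fun B : 'M_(n, 3) => B i j) e.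
by rewrite !mxE => /(congr1 (lsub N)); rewrite lsubK // rmorph0.
Qed.

(** The differential of a linear substitution is semilinear and bijective on
    syzygies, and its entries are constants, so a basis keeps its degrees. *)
Lemma moved_hbasis D t (U : 'M[P]_(t, 3)) c :
  hbasis (fun=> D) (syz (grad X)) U c ->
  hbasis (fun=> D) (syz (grad moved_curve)) (moved_row U) c.
Proof.
move=> [[SU dU gU] iU]; split; first split.
- move=> j; rewrite (_ : row j _ = moved_row (row j U)).
    by rewrite /syz dot_moved_row (SU j) rmorph0.
  by rewrite /moved_row row_mul map_row.
- move=> j i; rewrite mxE /moved_row !mxE.
  apply: whomog_sum => k _; rewrite !mxE; apply: (@whomogM 3 K D D).
    by have := dU j k; rewrite mxE; exact: lsub_whomog.
  by move=> m; rewrite mcoeffC; have [->|_] := eqVneq m 0%MM; rewrite ?mdeg0 ?mulr0 ?eqxx.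
- move=> B; rewrite [B]moved_row_onto; set A := map_mx _ _.
  move=> SB; have [|a ->] := gU A.
    apply: (can_inj (lsubK MN)); rewrite rmorph0 -[RHS]SB.
    by rewrite dot_moved_row.
  by exists (map_mx s a); rewrite moved_row_mulmx.
move=> a e; have ea : a = map_mx s (map_mx (lsub N) a).
  by apply/matrixP => i j; rewrite !mxE lsubK.
move: e; rewrite ea -moved_row_mulmx => /moved_row_inj /iU ->.
by apply/matrixP => i j; rewrite !mxE rmorph0.
Qed.
End MovedCurve.

(** * Zeros of forms *)
(** Up to an invertible matrix every nonzero column is the first basis vector. *)
Lemma transitive_GL (K : fieldType) n (a b : 'cV[K]_n) : a != 0 -> b != 0 ->
  exists M N : 'M[K]_n, [/\ M *m N = 1%:M, N *m M = 1%:M & M *m b = a].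
Proof.
have nf (v : 'cV[K]_n) : v != 0 -> exists2 E, E \in unitmx & v = E *m pid_mx 1.
  move=> v0; have r1 : \rank v = 1%N.
    by apply/eqP; rewrite eqn_leq rank_leq_col lt0n mxrank_eq0.
  have := mulmx_ebase v; rewrite r1 [row_ebase v]mx11_scalar; set y := row_ebase v 0 0 => e.
  have y0 : y != 0.
    have := row_ebase_unit v; rewrite [row_ebase v]mx11_scalar -/y.
    by rewrite unitmxE det_scalar1 unitfE.
  exists (y *: col_ebase v).
    by rewrite unitmxZ ?unitfE // col_ebase_unit.
  by rewrite -[LHS]e mul_mx_scalar scalemxAl.
move=> /nf [E uE ->] /nf [F uF ->].
exists (E *m invmx F), (F *m invmx E); split.
- by rewrite mulmxA mulmxKV // mulmxV.
- by rewrite mulmxA mulmxKV // mulmxV.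
by rewrite mulmxA mulmxKV.
Qed.

Section Points.
Variable K : fieldType.
Local Notation P := {mpoly K[3]}.

Section AtVector.
Variables (b : 'I_3 -> K) (k : 'I_3).
Hypothesis bk : b k != 0.

Lemma restrict_line_wpart j p :
  restrict_line (fun=> 0) b (wpart 0 j p) = ((restrict_line (fun=> 0) b p)`_j)%:P * 'X^j.
Proof.
have hw l : restrict_line (fun=> 0) b (wpart 0 l p) = (wpart 0 l p).@[b]%:P * 'X^l.
  by apply/restrict_line_homog/whomog0/wpart_whomog.
rewrite hw; congr (_%:P * _).
suff h (F : {rmorphism P -> {poly K}}) (e : nat -> K) :
    (forall l, F (wpart 0 l p) = (e l)%:P * 'X^l) -> e j = (F p)`_j.
  exact: (h _ _ hw).
move=> {}hw; have [N hN] := wpart_sum 0 p.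
rewrite [in RHS](hN (maxn N j.+1) (leq_maxl _ _)) rmorph_sum coef_sum.
have jN : (j < maxn N j.+1)%N by exact: leq_maxr.
rewrite (bigD1 (Ordinal jN)) //= [X in _ + X]big1 => [|l lj].
  by rewrite hw coefCM coefXn eqxx mulr1 addr0.
by rewrite hw coefCM coefXn eq_sym (negPf (lj : (l != j :> nat))) mulr0.
Qed.

(** The polynomials vanishing on the line spanned by [b]. *)
Definition vector_point : ppoint K.
Proof.
pose F := restrict_line (fun=> 0) b.
apply: (@PPoint K (fun p => F p == 0)).
- split; first by change (F 0 == 0); rewrite rmorph0.
    by change (F 1 != 0); rewrite rmorph1 oner_neq0.
  move=> a x y /eqP hx /eqP hy; change (F (a * x + y) == 0).
  by rewrite rmorphD rmorphM [F x]hx [F y]hy mulr0 addr0.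
- by move=> x y; change (F (x * y) == 0 -> (F x == 0) || (F y == 0)); rewrite rmorphM mulf_eq0.
- move=> g /eqP hg j; change (F (pihomog mdeg j g) == 0).
  by rewrite -wpart0E restrict_line_wpart [F g]hg coef0 mul0r.
exists k; change (F 'X_k != 0); rewrite /F (@restrict_line_homog _ 1) ?mevalXU; last first.
  by rewrite dhomogX; apply/eqP/mdeg1.
by rewrite mulf_neq0 ?polyC_eq0 // expf_neq0 // polyX_eq0.
Defined.

Lemma vector_pointE d p : p \is d.-homog -> (p \in pt_ideal vector_point) = (p.@[b] == 0).
Proof.
move=> hp; change ((restrict_line (fun=> 0) b p == 0) = (p.@[b] == 0)).
rewrite (restrict_line_homog b hp) mulf_eq0 polyC_eq0.
by rewrite expf_eq0 polyX_eq0 andbF orbF.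
Qed.
End AtVector.

Lemma meval0_homog d (p : P) : (0 < d)%N -> p \is d.-homog -> p.@[fun=> 0] = 0.
Proof.
move=> d0 hp; have <- : p.@[fun=> 0 * 0 : K] = p.@[fun=> 0].
  by apply: meval_eq => i; rewrite mul0r.
by rewrite (meval_scale (fun=> 0) 0 hp) expr0n eqn0Ngt d0 mulr0.
Qed.
End Points.

(** A form of positive degree over an algebraically closed field has a zero: if it
    restricts to a nonzero constant on the affine line through [(1,0,0)] in
    direction [(0,1,0)], then it restricts to a multiple of the [d]-th power of the
    first coordinate on their span, and vanishes at [(0,1,0)]. *)
Lemma form_zero (K : closedFieldType) (char0 : [pchar K] =i pred0) d (p : {mpoly K[3]}) :
  (0 < d)%N -> p \is d.-homog -> exists2 a : 'I_3 -> K, exists i, a i != 0 & p.@[a] = 0.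
Proof.
move=> d0 hp; pose u (i : 'I_3) : K := (i == i0)%:R; pose v (i : 'I_3) : K := (i == i1)%:R.
have [sz|/closed_rootP [t /rootP rt]] := eqVneq (size (restrict_line u v p)) 1%N; last first.
  exists (fun i => u i + v i * t); last by rewrite -restrict_lineE.
  by exists i0; rewrite /u /v mul0r addr0 oner_neq0.
have /size_poly1P [c _ ec] : size (restrict_line u v p) == 1%N by rewrite sz.
exists v; first by exists i1; rewrite oner_neq0.
have line t : t != 0 -> (restrict_line v u p).[t] = c * t ^+ d.
  move=> t0; rewrite -[c](hornerC _ t^-1) -ec !restrict_lineE -(meval_scale _ _ hp).
  by apply: meval_eq => i; rewrite mulrDl mulfVK // addrC.
have e : restrict_line v u p = c%:P * 'X^d.
  apply/eqP; rewrite -subr_eq0; apply: contraT => n0.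
  have [|t] := poly_nonroot char0 (p := ('X * (restrict_line v u p - c%:P * 'X^d))).
    by rewrite mulf_neq0 ?polyX_eq0.
  have [->|t0] := eqVneq t 0; first by rewrite hornerM hornerX mul0r eqxx.
  by rewrite hornerM hornerD hornerN line // !hornerE subrr mulr0 eqxx.
have := restrict_lineE v u p 0; rewrite e !hornerE expr0n eqn0Ngt d0 mulr0 => ->.
by apply: meval_eq => i; rewrite mulr0 addr0.
Qed.

(** * The equivalence *)
Section Conclusion.
Variable K : fieldType.
Local Notation P := {mpoly K[3]}.

(** Raising the twist adds to the condition on degrees only cases in which the
    vector is zero. *)
Lemma syz_iso_shift (g g' : 'I_3 -> P) D rho :
  syz_iso g g' 0 0 rho -> syz_iso g g' D D rho.
Proof.
case=> tot onto sz lin inj fn hom; split=> // k A B rAB hA.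
have [Dk|kD] := leqP D k.
  have sh (C : 'rV[P]_3) : vhomog (fun=> D) k C <-> vhomog (fun=> 0%N) (k - D) C.
    have e i : whomog D k (C 0 i) <-> whomog 0 (k - D) (C 0 i).
      by rewrite -(whomog_shift 0 (k - D) D) add0n subnK.
    by split=> h i; apply/e.
  by apply/sh; apply: hom rAB _; apply/sh.
have A0 : A = 0.
  apply/rowP => i; rewrite mxE; apply/mpolyP => m; rewrite mcoeff0.
  by apply: contraTeq isT => /(hA i m); lia.
by move: rAB; rewrite A0 => /fn -> i; rewrite mxE; exact: whomog_zero.
Qed.

Hypothesis char0 : [pchar K] =i pred0.

Lemma log_sheaf_iso_of_syz_iso (X X' : plane_curve K) rho :
  (cdeg X).-1 = (cdeg X').-1 ->
  syz_iso (grad X) (grad X') (cdeg X).-1 (cdeg X).-1 rho ->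
  omod_iso (log_sheaf X) (log_sheaf X').
Proof.
move=> e /(tilde_iso_of_syz_iso e) h.
apply: omod_iso_trans (omod_iso_sym (log_sheaf_iso char0 X)) _.
exact: omod_iso_trans h (log_sheaf_iso char0 X').
Qed.

Lemma syz_iso_of_log_sheaf_iso (X X' : plane_curve K) :
  omod_iso (log_sheaf X) (log_sheaf X') ->
  exists rho, syz_iso (grad X) (grad X') 0 0 rho.
Proof.
move=> h; apply: syz_iso_of_omod_iso.
apply: omod_iso_trans (log_sheaf_iso char0 X) _.
exact: omod_iso_trans h (omod_iso_sym (log_sheaf_iso char0 X')).
Qed.
End Conclusion.

Section Equivalence.
Variable K : closedFieldType.
Hypothesis char0 : [pchar K] =i pred0.

(** Over a saturated jacobian ideal the syzygies are free, and their sheaf is the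
    same for [X] and for any curve obtained from [X] by a linear change of
    coordinates. The one chosen here passes through a point [b] outside [X]: the
    substitution moves [b] to a zero [a] of the equation. *)
Lemma torelli_not_saturated (X : plane_curve K) : torelli X ->
  ~ forall w, in_sat (grad X) w -> in_ideal (grad X) w.
Proof.
move=> tor sat.
have [t [U [c hU]]] : exists t U c, @hbasis K 3 (fun=> (cdeg X).-1) (syz (grad X)) t U c.
  apply: (syz_hbasis (grad_homog X)) => w hw; apply: sat.
  apply: in_sat_saturated => i.
  exact: in_ideal_sat (hw i).
have [b fb] := mpoly_nonzero char0 (eqn_neq0 X).
have [a [i ai] fa] := form_zero char0 (cdeg_gt0 X) (eqn_homog X).
have [j bj] : exists j, b j != 0.
  apply: contrapT => /forallNP b0; move/negP: fb; apply.
  rewrite -(meval0_homog (cdeg_gt0 X) (eqn_homog X)); apply/eqP/meval_eq => j.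
  by have /negP := b0 j; rewrite negbK => /eqP.
have nz (v : 'I_3 -> K) l : v l != 0 -> (\col_k v k) != 0.
  by apply: contraNneq => /(congr1 (fun A : 'cV_3 => A l 0)); rewrite !mxE => ->.
have [M [N [MN NM Mb]]] := transitive_GL (nz a i ai) (nz b j bj).
have rho := syz_iso_of_hbasis (moved_hbasis MN NM hU) hU.
have /tor same := @log_sheaf_iso_of_syz_iso _ char0 (moved_curve X MN NM) X _ erefl rho.
have [+ _] := same (vector_point bj).
rewrite (vector_pointE bj (eqn_homog X)) (vector_pointE bj (eqn_homog (moved_curve X MN NM))).
rewrite /= lsub_meval => h; move/negP: fb; apply; apply: h.
apply/eqP/(etrans _ fa)/meval_eq => k.
have := congr1 (fun A : 'cV_3 => A k 0) Mb; rewrite !mxE => <-.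
by apply: eq_bigr => l _; rewrite mxE.
Qed.

(** The degrees agree because [syz_iso_degree] reads [D' = D] when both twists are
    zero, and [3 D' = 3 D] when they are the degrees of the gradients. *)
Lemma torelli_iff_reconstructible (X : plane_curve K) :
  torelli X <-> reconstructible_from_H0m X.
Proof.
have pg := primitive_grad char0; have hg := @grad_homog K.
split=> [tor|rec] X' hX'; last first.
  apply: rec; have [rho h] := syz_iso_of_log_sheaf_iso char0 hX'.
  have := syz_iso_degree (pg _) (pg _) (hg X') (hg X) h; rewrite !addn0 => e.
  have hX : forall i, grad X i \is (cdeg X').-1.-homog by move=> i; rewrite e; exact: hg.
  exact: gmod_iso_of_h0_iso (h0_iso_of_syz_iso (hg X') hX (syz_iso_shift _ h)).
have [tau h] := h0_iso_of_gmod_iso hX'.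
have [w0 sw0 nw0] : exists2 w, in_sat (grad X') w & ~ in_ideal (grad X') w.
  apply: contrapT => no; apply: (torelli_not_saturated tor) => w sw.
  have [v sv tvw] := hi_onto h sw.
  apply/(hi_ideal h tvw); apply: contrapT => nv; apply: no.
  by exists v.
have [rho s] := syz_iso_of_h0_iso (pg X') (pg X) (hg X') (hg X) h sw0 nw0.
have e : (cdeg X').-1 = (cdeg X).-1.
  by have := syz_iso_degree (pg _) (pg _) (hg X') (hg X) s; lia.
rewrite -e in s; apply: tor; exact: (@log_sheaf_iso_of_syz_iso _ char0 _ _ _ e s).
Qed.
End Equivalence.

Theorem theorem6p3 (R : realType) (X : plane_curve R[i]%C) :
  torelli X <-> reconstructible_from_H0m X.
Proof.
apply: torelli_iff_reconstructible.
exact: Num.Theory.pchar_num.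
Qed.
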